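(* For any polynomial $p\in\mathbb{Z}[x]$ with $p(0)=0$ and $\deg(p)>1$, there exist an invertible probability preserving system $(X,\mathcal{A},\mu,T)$ which is both weakly mixing and rigid, a set $A\in\mathcal{A}$ with $\mu(A)=\frac12$, a real number $\delta>0$, and an IP$_0$ set $\Gamma\subseteq\mathbb{N}$ such that for any $n\in\Gamma$, $$\mu(A\cap T^{-p(n)}A)<\mu^2(A)-\delta .$$
   Context: $\mathbb{N}=\{1,2,\dots\}$, and $\mu^2(A)=(\mu(A))^2$. An invertible probability preserving system $(X,\mathcal{A},\mu,T)$ is a probability space $(X,\mathcal{A},\mu)$ together with an invertible (bimeasurable) $\mu$-preserving map $T:X\to X$. The unitary operator induced by $T$ on $L^2(\mu)$ is also denoted $T$, so $Tf=f\circ T$. The system is weakly mixing if $T:L^2(\mu)\to L^2(\mu)$ has no non-trivial eigenvectors (i.e. the only eigenvectors are the constant functions). The system is rigid if for each $f\in L^2(\mu)$ there exists an increasing sequence $(n_k)_{k\in\mathbb{N}}$ in $\mathbb{N}$ with $\lim_{k\to\infty}T^{n_k}f=f$ in the $L^2$-norm. For $r\in\mathbb{N}$, a set $E\subseteq\mathbb{N}$ is called IP$_r$ if there exist positive integers $n_1<\cdots<n_r$ with $\{\sum_{j\in F}n_j \mid F\subseteq\{1,\dots,r\},\ F\neq\emptyset\}\subseteq E$. A set $\Gamma\subseteq\mathbb{N}$ is called IP$_0$ if it is an IP$_r$ set for every $r\in\mathbb{N}$. *)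

(* Defs.v *)
From HB Require Import structures.
From mathcomp Require Import all_boot all_order all_algebra.
From mathcomp Require Import complex.
From mathcomp Require Import all_classical all_reals all_analysis.
Set Implicit Arguments.
Unset Strict Implicit.
Unset Printing Implicit Defensive.
Import Order.TTheory GRing.Theory Num.Theory.
Import numFieldNormedType.Exports.

Local Open Scope classical_set_scope.
Local Open Scope ring_scope.

(* Bundles T with its two-sided inverse Tinv, so that negative powers of T are
   available. *)
Record invertible_mps (R : realType) (d : measure_display)
    (X : measurableType d) (mu : probability X R) (T Tinv : X -> X) : Prop := {
  mps_cancel : cancel T Tinv ;
  mps_cancel_inv : cancel Tinv T ;
  mps_measurable : measurable_fun [set: X] T ;
  mps_measurable_inv : measurable_fun [set: X] Tinv ;
  mps_preserving : forall A : set X, measurable A -> mu (T @^-1` A) = mu A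
}.

(* T^m for m : int; note that Negz n is the integer -(n+1). *)
Definition iterz (X : Type) (T Tinv : X -> X) (m : int) : X -> X :=
  match m with
  | Posz n => iter n T
  | Negz n => iter n.+1 Tinv
  end.

(* The spaces L^2 of the library are real; eigenvectors require the complex
   space. Its elements are represented by functions X -> R[i], taken up to
   equality mu-almost everywhere. *)
Definition L2C_norm (R : realType) (d : measure_display)
    (X : measurableType d) (mu : probability X R) (f : X -> R[i]) : \bar R :=
  Lnorm mu 2%:E (fun x => (ComplexField.Normc.normc (f x))%:E).

Definition L2C (R : realType) (d : measure_display)
    (X : measurableType d) (mu : probability X R) : set (X -> R[i]) :=
  [set f | [/\ measurable_fun [set: X] (fun x => complex.Re (f x)),
               measurable_fun [set: X] (fun x => complex.Im (f x)) &
               (L2C_norm mu f < +oo)%E]].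

Definition eigenvector (R : realType) (d : measure_display)
    (X : measurableType d) (mu : probability X R) (T : X -> X)
    (lambda : R[i]) (f : X -> R[i]) : Prop :=
  [/\ L2C mu f,
      ~ {ae mu, forall x, f x = 0} &
      {ae mu, forall x, f (T x) = lambda * f x}].

Definition weakly_mixing (R : realType) (d : measure_display)
    (X : measurableType d) (mu : probability X R) (T : X -> X) : Prop :=
  forall (lambda : R[i]) (f : X -> R[i]), eigenvector mu T lambda f ->
    exists c : R[i], {ae mu, forall x, f x = c}.

Definition rigid (R : realType) (d : measure_display)
    (X : measurableType d) (mu : probability X R) (T : X -> X) : Prop :=
  forall f : X -> R[i], L2C mu f ->
    exists n : nat -> nat,
      [/\ forall k, (0 < n k)%N,
          {homo n : k l / (k < l)%N} &
          L2C_norm mu (fun x => f (iter (n k) T x) - f x) @[k --> \oo] --> 0%E].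

Definition IP (r : nat) (E : set nat) : Prop :=
  exists n : 'I_r -> nat,
    [/\ forall i, (0 < n i)%N,
        {homo n : i j / (i < j)%N} &
        forall F : {set 'I_r}, F != finset.set0 -> E (\sum_(j in F) n j)%N].

Definition IP0 (E : set nat) : Prop := forall r : nat, (0 < r)%N -> IP r E.

(* Main.v *)
Require Import Defs.
From HB Require Import structures.
From mathcomp Require Import all_boot all_order all_algebra.
From mathcomp Require Import zify ring lra.
Set Implicit Arguments.
Unset Strict Implicit.
Unset Printing Implicit Defensive.
Import Order.TTheory GRing.Theory Num.Theory.

(* The transformation is a limit of permutations of [0, Q_k), each an approximate
   extension of the previous one, along the inverse limit of the [0, Q_k). Some
   power [iter h_k] of the [k]-th permutation exchanges the event [A] with its
   complement while its square is the identity; the latter gives rigidity.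
   Every other extension follows two independent points one after the other, so
   that a single jump decouples the position from its image: this gives weak
   mixing. In the remaining extensions the [k]-th permutation is run on many
   copies with slightly perturbed speeds, so that over the copy [(s, t)], for [n]
   the sum of the [n_i] with [i] in [F], the iterate [p(n)] acts as [iter h_k] or
   as the identity according to whether [odd #|s n F| || odd #|t n F|] or not.
   This disjunction is a polynomial of degree 2 in [F] modulo 2, hence within
   reach of [p] as [p] is not linear; over uniform [s] and [t] it holds with
   probability 3/4 for every nonempty [F], whatever the number of the [n_i]. So
   the correlation of [A] is close to 1/8, below 1/4. *)

(** One parity would not do: it is odd with probability 1/2 over [s], and the correlation would stay
    at 1/4. Along a linear [p] nothing better is available, as a phase [n * b] is additive in [n]
    modulo 1; in larger degree, the term linear in [m] of the expansion of [p(n_r + m)] produces the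
    products of parities that a disjunction requires. The swap takes place at periods of the
    previous permutation: all [n_i] are multiples of [2 * h], hence so is [p(n)] as [p(0) = 0]. What
    moves is a slow clock on each copy, through [2 * h] long blocks of which the [j]-th shows the
    point displaced by [iter j f]; its drift at time [p(n)] is close to [h] blocks or to none,
    modulo [2 * h]. Weak mixing, rigidity and swapping must hold for one limit. So the times at
    which level [k] is used are bounded by [H k] before the next level is chosen, and that choice
    errs by at most [1 / (H k * 2 ^ (k + 1))]: later levels cannot undo it. The margins are 1/32
    near block boundaries, 1/32 for the limit and [delta = 1/32]; with 1/8 they stay below 1/4. *)

Local Open Scope ring_scope.

(** * Phases realising disjunctions of parities *)

Lemma ler_archi (x : rat) : exists K : nat, forall n, (K <= n)%N -> x <= n%:R.
Proof.
exists (Num.bound x) => n Kn.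
apply: le_trans (ler_norm _) _; apply/ltW.
apply: lt_le_trans (archi_boundP (normr_ge0 _)) _; rewrite ler_nat.
suff -> : Num.bound `|x| = Num.bound x by [].
by rewrite /Num.bound normr_id.
Qed.

(** Horner induction: [q X + c] has the leading coefficient of [q], and [q >= b] with
    [n >= (b - c) / b] gives [b * n + c >= b]. *)
Lemma lead_gt0_eventually (f : {poly rat}) : 0 < lead_coef f ->
  exists2 b : rat, 0 < b & exists K, forall n, (K <= n)%N -> b <= f.[n%:R].
Proof.
elim/poly_ind: f => [|q c IH]; first by rewrite lead_coef0 ltxx.
have [->|q0] := eqVneq q 0.
  rewrite mul0r add0r lead_coefC => c0; exists c => //.
  by exists 0%N => n _; rewrite hornerC.
rewrite lead_coefDl ?size_mulX // ?lead_coefMX => [lq|]; last first.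
  by rewrite size_polyC ltnS; case: (c != 0) => //=; rewrite lt0n size_poly_eq0.
have [b b0 [K HK]] := IH lq; exists b => //.
have [K' HK'] := ler_archi ((b - c) / b).
exists (maxn K K') => n; rewrite geq_max => /andP[/HK qn /HK'].
rewrite ler_pdivrMr // hornerMXaddC => h.
have h' : b * n%:R <= q.[n%:R] * n%:R by rewrite ler_wpM2r.
by rewrite -lerBlDr (le_trans _ h') // mulrC.
Qed.

Lemma poly_dominated (f g : {poly rat}) (e : rat) : (size f < size g)%N ->
  0 < lead_coef g -> 0 < e ->
  exists K, forall n, (K <= n)%N -> `|f.[n%:R]| <= e * g.[n%:R].
Proof.
move=> fg lg e0.
have sz : size (e *: g) = size g by rewrite size_scale ?gt_eqF.
have H (h : {poly rat}) : (size h < size g)%N ->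
    exists K, forall n, (K <= n)%N -> h.[n%:R] <= e * g.[n%:R].
  move=> hg; have /lead_gt0_eventually[b b0 [K HK]] : 0 < lead_coef (e *: g - h).
    by rewrite lead_coefDl ?size_polyN ?sz // lead_coefZ mulr_gt0.
  exists K => n /HK; rewrite hornerD hornerN hornerZ => hn.
  by rewrite -subr_ge0; apply: ltW; apply: lt_le_trans b0 _.
have [K1 H1] := H _ fg.
have [|K2 H2] := H (- f); first by rewrite size_polyN.
exists (maxn K1 K2) => n; rewrite geq_max => /andP[/H1 h1 /H2 h2].
by rewrite ler_norml h1 andbT lerNl -hornerN.
Qed.

Lemma eventually_bounded_forall (P : nat -> nat -> Prop) M :
  (forall m, exists K, forall n, (K <= n)%N -> P m n) ->
  exists K, forall n, (K <= n)%N -> forall m, (m <= M)%N -> P m n.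
Proof.
move=> H; elim: M => [|M [K HK]].
  have [K HK] := H 0%N; exists K => n Kn m; rewrite leqn0 => /eqP ->; exact: HK.
have [K' HK'] := H M.+1; exists (maxn K K') => n.
rewrite geq_max => /andP[h1 h2] m.
by rewrite leq_eqVlt => /predU1P[->|]; [apply: HK'|rewrite ltnS; apply: HK].
Qed.

(** Beyond the linear term in [h], everything has degree in [x] below that of the derivative, hence
    will be negligible against it. *)
Lemma size_taylor2 (P : {poly rat}) (h : rat) : (1 < size P)%N ->
  exists2 f : {poly rat}, (size f < (size P).-1)%N &
    forall x, P.[x + h] = P.[x] + P^`().[x] * h + f.[x].
Proof.
move=> sP; exists (\sum_(i < (size P).-2) h ^+ i.+2 *: P^`N(i.+2)).
  apply: leq_ltn_trans (size_sum _ _ _) _.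
  apply: (@leq_ltn_trans (size P).-2); last by case: (size P) sP => [|[]].
  apply/bigmax_leqP => i _; apply: leq_trans (size_scale_leq _ _) _.
  apply/leq_sizeP => j hj; rewrite coef_nderivn nth_default ?mul0rn //.
  by move: (nat_of_ord i) hj => k; rewrite -subn2 leq_subLR => /leq_trans; apply; rewrite leq_add2r.
move=> x; rewrite (nderiv_taylor P (mulrC _ _)).
case: (size P) sP => [|[|s]] // _ /=; rewrite !big_ord_recl /=.
rewrite nderivn0 nderivn1 /= expr0 mulr1 expr1 addrA; congr (_ + _).
rewrite horner_sum; apply: eq_bigr => i _.
by rewrite hornerZ /bump /= mulrC.
Qed.

(** Used for phases: if [n * b] is an integer, then [p(m + n) * b] and [p(m) * b] differ by an
    integer. *)
Lemma horner_diff_dvd (p : {poly int}) (m n : int) :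
  exists c : int, p.[m + n] - p.[m] = n * c.
Proof.
elim/poly_ind: p => [|q a [c Hc]]; first by exists 0; rewrite !horner0 subrr mulr0.
exists (c * m + q.[m + n]); rewrite !hornerMXaddC.
have -> : q.[m + n] = q.[m] + n * c by rewrite -Hc addrCA subrr addr0.
by ring.
Qed.

(** [x] lies within [e] of [b / 2] on the circle of numbers modulo 1. Since 1/2 has order two there,
    errors add up while the booleans add modulo 2. *)
Definition near_half (x : rat) (b : bool) (e : rat) : Prop :=
  exists2 a : rat, a \is a Num.int & `|x - b%:R / 2 - a| <= e.

Lemma near_halfD x y b c e d : near_half x b e -> near_half y c d ->
  near_half (x + y) (b (+) c) (e + d).
Proof.
(* [b && c] is the carry: 1/2 + 1/2 is an integer. *)
move=> [a ia ha] [a' ia' ha']; exists (a + a' + (b && c)%:R).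
  by rewrite !rpredD // natr_int.
apply: le_trans (lerD ha ha'); apply: le_trans (ler_normD _ _).
rewrite le_eqVlt; apply/orP; left; apply/eqP; congr `|_|.
by case: b ha; case: c ha' => /= _ _; field.
Qed.

Lemma near_halfW x b e d : e <= d -> near_half x b e -> near_half x b d.
Proof. by move=> ed [a ia ha]; exists a => //; apply: le_trans ed. Qed.

Lemma near_half_int x : x \is a Num.int -> near_half x false 0.
Proof. by move=> ix; exists x => //; rewrite mul0r subr0 subrr normr0. Qed.

Lemma near_half_half (b : bool) : near_half (b%:R / 2) b 0.
Proof. by exists 0; rewrite ?rpred0 // subrr subr0 normr0. Qed.

Lemma near_half_small x e : `|x| <= e -> near_half x false e.
Proof. by move=> h; exists 0; rewrite ?rpred0 // mul0r !subr0. Qed.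

Lemma near_halfMb x b e (c : bool) : 0 <= e -> near_half x b e ->
  near_half (c%:R * x) (c && b) e.
Proof.
move=> e0; case: c => /=; first by rewrite mul1r.
by move=> _; rewrite mul0r; apply: near_halfW e0 _; apply: near_half_int; exact: rpred0.
Qed.

Lemma near_halfN x b e : near_half x b e -> near_half (- x) b e.
Proof.
move=> [a ia ha]; exists (- a - b%:R); first by rewrite rpredB ?rpredN ?natr_int.
by rewrite -normrN; apply: le_trans ha; rewrite le_eqVlt; apply/orP; left;
  apply/eqP; congr `|_|; field.
Qed.

(* [s] and [F] stand for the subsets of [0, r) that they indicate. *)
Definition parity (r : nat) (s F : nat -> bool) : bool :=
  odd (\sum_(i < r) (s i && F i)).

Definition subsum (r : nat) (n : nat -> nat) (F : nat -> bool) : nat :=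
  \sum_(i < r) F i * n i.

Lemma parityS r s F : parity r.+1 s F = parity r s F (+) (s r && F r).
Proof. by rewrite /parity big_ord_recr /= oddD oddb. Qed.

Lemma subsumS r n F : subsum r.+1 n F = (subsum r n F + F r * n r)%N.
Proof. by rewrite /subsum big_ord_recr. Qed.

Lemma subsum_le r n F : (subsum r n F <= \sum_(i < r) n i)%N.
Proof. by apply: leq_sum => i _; case: (F i); rewrite ?mul1n ?mul0n. Qed.

Lemma eq_subsum r n n' F : (forall i, (i < r)%N -> n i = n' i) ->
  subsum r n F = subsum r n' F.
Proof. by move=> h; apply: eq_bigr => i _; rewrite h. Qed.

(** The solutions [g] of [P * g = u / 2] modulo 1 are spaced by [1 / P], so the values [d * g] are
    spaced by [d / P], at most [e], and one of them falls near [W]. Thus [g] controls the value of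
    [p] and its linear term independently. *)
Lemma int_multiple_near (P d W e : rat) (u : bool) : 0 < P -> 0 < d -> 0 <= W ->
  d <= e * P ->
  exists g : rat, [/\ 0 <= g, exists2 J : rat, J \is a Num.int & P * g = J + u%:R / 2
    & `|d * g - W| <= e].
Proof.
move=> P0 d0 W0 dP; pose J : rat := (Num.floor (W * P / d))%:~R.
have x0 : 0 <= W * P / d by rewrite divr_ge0 ?mulr_ge0 // ltW.
have J0 : 0 <= J by rewrite ler0z floor_ge0.
have hJ : J <= W * P / d by rewrite floor_le.
have hJ1 : W * P / d < J + 1 by have := floorD1_gt (W * P / d); rewrite intrD.
have u1 : 0 <= (u%:R : rat) <= 1 by case: (u).
exists ((J + u%:R / 2) / P); split.
- by rewrite divr_ge0 ?addr_ge0 ?divr_ge0 // ?ltW //; case/andP: u1.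
- by exists J; [exact: intr_int|rewrite mulrCA mulfV ?mulr1 // gt_eqF].
have -> : d * ((J + u%:R / 2) / P) - W = (d / P) * (J + u%:R / 2 - W * P / d).
  by field; rewrite !gt_eqF.
rewrite normrM [X in X * _]gtr0_norm ?divr_gt0 //.
apply: (@le_trans _ _ (d / P * 1)); last by rewrite mulr1 ler_pdivrMr.
rewrite ler_pM2l ?divr_gt0 // ler_norml.
move: (W * P / d) hJ hJ1 => x hJ hJ1; case/andP: u1 => u0 u1.
by apply/andP; split; lra.
Qed.

Lemma horner_natr (p : {poly int}) (n : nat) :
  (map_poly intr p).[n%:R] = (p.[n%:Z])%:~R :> rat.
Proof. by rewrite -[n%:R]/((n%:Z)%:~R) horner_map. Qed.

Lemma horner_natr_deriv (p : {poly int}) (n : nat) :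
  (map_poly intr p)^`().[n%:R] = (p^`().[n%:Z])%:~R :> rat.
Proof. by rewrite deriv_map horner_natr. Qed.

(** The scales of the induction below: the value [P] dominates the derivative [d], which dominates
    1, the values at the old sums [m] and the second-order remainder. A degree above 1 is what lets
    [d] outgrow constants. *)
Lemma eventually_taylor (p : {poly int}) (M : nat) (e : rat) :
  (1 < (size p).-1)%N -> 0 < lead_coef p -> 0 < e ->
  exists K, forall n, (K <= n)%N ->
    let P := (p.[n%:Z])%:~R : rat in let d := (p^`().[n%:Z])%:~R : rat in
    [/\ 0 < P, 0 < d, d <= e * P, 1 <= e * d & forall m, (m <= M)%N ->
      `|(p.[m%:Z])%:~R| <= e * d /\
      `|(p.[m%:Z + n%:Z])%:~R - P - d * m%:R| <= e * d].
Proof.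
move=> sp lp e0; pose P : {poly rat} := map_poly intr p.
have sP : size P = size p by rewrite size_map_inj_poly //; exact: intr_inj.
have lP : 0 < lead_coef P.
  by rewrite lead_coef_map_inj ?ltr0z //; exact: intr_inj.
have P0 : P != 0 by rewrite -lead_coef_eq0 gt_eqF.
have sP1 : (size P).-1.-1.+1 = (size P).-1.
  by rewrite -sP in sp; case: (size P) sp => [|[|s]].
have sd : size P^`() = (size P).-1.
  rewrite size_poly_eq // sP1 -lead_coefE mulrn_eq0 lead_coef_eq0 negb_or P0.
  by rewrite sP -lt0n (ltn_trans _ sp).
have ld : 0 < lead_coef P^`().
  rewrite lead_coefE sd coef_deriv sP1 -lead_coefE pmulrn_lgt0 // sP.
  exact: ltn_trans sp.
have [b b0 [K1 H1]] := lead_gt0_eventually lP.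
have [c c0 [K2 H2]] := lead_gt0_eventually ld.
have dlt : (size P^`() < size P)%N by rewrite sd; rewrite -sP in sp; case: (size P) sp.
have [K3 H3] := poly_dominated dlt lP e0.
have cst (a : rat) : exists K, forall n, (K <= n)%N -> `|a| <= e * P^`().[n%:R].
  have [|K HK] := @poly_dominated a%:P _ e _ ld e0.
    by rewrite sd size_polyC sP; apply: leq_ltn_trans sp; case: (a != 0).
  by exists K => n /HK; rewrite hornerC.
have [K4 H4] := cst 1.
have [K5 H5] := eventually_bounded_forall M (fun m => cst (p.[m%:Z])%:~R).
have tay (m : nat) : exists K, forall n, (K <= n)%N ->
    `|(p.[m%:Z + n%:Z])%:~R - P.[n%:R] - P^`().[n%:R] * m%:R| <= e * P^`().[n%:R].
  have [|f sf Hf] := @size_taylor2 P m%:R.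
    by rewrite sP; move: sp; case: (size p) => [|[|s]].
  rewrite -sd in sf; have [K HK] := poly_dominated sf ld e0.
  exists K => n /HK; apply: le_trans; rewrite le_eqVlt; apply/orP; left.
  apply/eqP; congr `|_|; rewrite -PoszD addnC -horner_natr natrD Hf.
  by rewrite -/P; ring.
have [K6 H6] := eventually_bounded_forall M tay.
exists (maxn K1 (maxn K2 (maxn K3 (maxn K4 (maxn K5 K6))))) => n.
rewrite !geq_max => /and5P[/H1 h1 /H2 h2 /H3 h3 /H4 h4 /andP[/H5 h5 /H6 h6]].
rewrite /= -horner_natr -horner_natr_deriv -/P; split.
- exact: lt_le_trans h1.
- exact: lt_le_trans h2.
- exact: le_trans (ler_norm _) h3.
- by rewrite normr1 in h4.
by move=> m mM; split; [exact: h5|exact: h6].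
Qed.
(* The phase [w] realises half the parity of [s] along subset sums; a phase
   [b] for [p] realising half of the disjunction of two parities needs the
   cross term [m * n] of [p (m + n)], hence the degree hypothesis. *)
Lemma parity_phases_small (p : {poly int}) (N r : nat) (e : rat) :
  p.[0] = 0 -> (1 < (size p).-1)%N -> 0 < lead_coef p -> (0 < N)%N -> 0 < e <= 1 ->
  exists (n : nat -> nat) (D : nat),
    [/\ (0 < D)%N,
        forall i, (i < r)%N -> (0 < n i)%N /\ (N %| n i)%N,
        forall i j, (i < j)%N -> (j < r)%N -> (n i < n j)%N,
        forall s : nat -> bool, exists w : rat,
          [/\ 0 <= w <= r%:R, D%:R * w \is a Num.int &
              forall F, near_half ((subsum r n F)%:R * w) (parity r s F) e]
      & forall s t : nat -> bool, exists b : rat,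
          [/\ 0 <= b <= e, D%:R * b \is a Num.int &
              forall F, near_half ((p.[(subsum r n F)%:Z])%:~R * b)
                (parity r s F || parity r t F) e]].
Proof.
move=> p0 sp lp N0; elim: r e => [|r IH] e /andP[e0 e1].
  exists (fun=> 1%N), 1%N; split => // [s|s t]; exists 0; split; rewrite ?lexx ?ltW ?mulr0 ?rpred0 //.
    by move=> F; rewrite mulr0 /parity big_ord0 /=; apply: near_halfW (ltW e0) _;
      exact: near_half_int (rpred0 _).
  move=> F; rewrite mulr0 /parity !big_ord0 /=; apply: near_halfW (ltW e0) _.
  exact: near_half_int (rpred0 _).
(* At most five errors of size [e2] are added below. *)
pose e2 := e / 8; have e20 : 0 < e2 by rewrite /e2; lra.
have e2e : e2 * 8 = e by rewrite /e2; field.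
have [|n [D [D0 nN nlt Hw Hb]]] := IH e2; first by rewrite e20 /e2; lra.
pose M := \sum_(i < r) n i.
(* [C] bounds the two factors that will multiply [e3]: the old sums, up to [M], and [g * d], up to
   [2 * r + 1]. *)
pose C := (M + 2 * r + 1)%N.
have C1 : 1 <= (C%:R : rat) by rewrite ler1n /C addn1.
pose e3 := e2 / C%:R.
have e30 : 0 < e3 by rewrite divr_gt0 // (lt_le_trans _ C1).
have Ce3 : C%:R * e3 = e2 by rewrite /e3 mulrCA mulfV ?mulr1 // gt_eqF // (lt_le_trans _ C1).
have CE : C%:R = M%:R + 2 * r%:R + 1 :> rat by rewrite /C natrD natrD natrM.
have rge0 : 0 <= (r%:R : rat) by [].
have Mge0 : 0 <= (M%:R : rat) by [].
have [K HK] := eventually_taylor M sp lp e30.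
have [K' HK'] := ler_archi (M%:R / e2).
pose k := (K + K' + M + 1)%N.
pose a := (2 * N * k)%N.
(* [D] divides the new generator, so the old phases are integral on it; the factor [k] puts it
   beyond all thresholds. *)
have [nr nrE] : exists nr, nr = (D * a)%N by exists (D * a)%N.
have ka : (k <= a)%N by rewrite leq_pmull // muln_gt0.
have knr : (k <= nr)%N by apply: leq_trans ka _; rewrite nrE leq_pmull.
have Knr : (K <= nr)%N by apply: leq_trans knr; rewrite /k; lia.
have K'nr : (K' <= nr)%N by apply: leq_trans knr; rewrite /k; lia.
have Mnr : (M < nr)%N by apply: leq_trans knr; rewrite /k; lia.
have nr0 : (0 < nr)%N by apply: leq_trans Mnr.
have [P0 d0 dP d1 Hm] := HK _ Knr.
set P : rat := (p.[nr%:Z])%:~R in P0 dP Hm; set d : rat := (p^`().[nr%:Z])%:~R in d0 dP d1 Hm.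
have pnr0 : 0 < p.[nr%:Z] by rewrite -(ltr0z rat).
pose n' i := if i == r then nr else n i.
have n'r : n' r = nr by rewrite /n' eqxx.
have n'lt i : (i < r)%N -> n' i = n i by move=> ir; rewrite /n' ltn_eqF.
have sub F : subsum r.+1 n' F = (subsum r n F + F r * nr)%N.
  by rewrite subsumS n'r (@eq_subsum r n' n).
have subM F : (subsum r n F <= M)%N by exact: subsum_le.
pose pn := `|p.[nr%:Z]|%N.
have pnE : pn%:R = P by rewrite /P -[pn%:R]/((pn%:Z)%:~R) /pn gtz0_abs.
have pn0 : (0 < pn)%N by rewrite -(ltr_nat rat) pnE.
(* The factors [2 * nr] and [2 * pn] clear the denominators of the new parts of [w] and [b]. *)
pose D' := (D * (2 * nr) * (2 * pn))%N.
have DD' (x : rat) : D%:R * x \is a Num.int -> D'%:R * x \is a Num.int.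
  move=> h; have -> : D'%:R * x = (2 * nr * (2 * pn))%N%:R * (D%:R * x).
    by rewrite mulrA -natrM; congr (_%:R * _); rewrite /D' -mulnA mulnC.
  by rewrite rpredM ?natr_int.
have nrx (x : rat) : D%:R * x \is a Num.int -> nr%:R * x \is a Num.int.
  by move=> h; rewrite nrE mulnC natrM -mulrA rpredM ?natr_int.
have Mn m : (m <= M)%N -> (m%:R : rat) / nr%:R <= e2.
  move=> mM; rewrite ler_pdivrMr ?ltr0n //; have := HK' _ K'nr.
  by rewrite ler_pdivrMr // mulrC; apply: le_trans; rewrite ler_nat.
exists n', D'; split.
- by rewrite /D' (muln_gt0 (_ * _)) (muln_gt0 D) (muln_gt0 2 nr) (muln_gt0 2 pn) D0 nr0 pn0.
- move=> i; rewrite ltnS leq_eqVlt => /predU1P[->|ir].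
    rewrite n'r; split=> //; rewrite nrE /a; apply/dvdn_mull/dvdn_mulr.
    exact: dvdn_mull.
  by rewrite n'lt //; exact: nN.
- move=> i j ij; rewrite ltnS leq_eqVlt => /predU1P[jr|jr].
    rewrite jr in ij *; rewrite n'r n'lt //; apply: leq_ltn_trans Mnr.
    by rewrite /M (bigD1 (Ordinal ij)) //= leq_addr.
  by rewrite !n'lt ?(ltn_trans ij) //; exact: nlt.
- move=> s; have [w [/andP[w0 wr] wD wF]] := Hw s.
  have b1 : 0 <= ((s r)%:R : rat) <= 1 by case: (s r).
  have nrR : 1 <= (nr%:R : rat) by rewrite ler1n.
  (* The new part contributes [s r / 2] at [nr] and at most [m / nr] at an old sum [m]. *)
  exists (w + (s r)%:R / 2 / nr%:R); split.
  + have x0 : 0 <= ((s r)%:R / 2 / nr%:R : rat) <= 1.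
      rewrite divr_ge0 ?divr_ge0 //= ler_pdivrMr ?(lt_le_trans _ nrR) //.
      by case/andP: b1 => b0 b1; rewrite mul1r; lra.
    case/andP: x0 => x0 x1.
    rewrite addr_ge0 //=; apply: (@le_trans _ _ (r%:R + 1)); first exact: lerD.
    by rewrite natr1.
  + rewrite mulrDr; apply: rpredD; first exact: DD'.
    have -> : D'%:R * ((s r)%:R / 2 / nr%:R) = (D * (2 * pn) * s r)%N%:R :> rat.
      rewrite /D' !natrM; field; rewrite ?gt_eqF //; exact: lt_le_trans nrR.
    exact: natr_int.
  + move=> F; rewrite sub parityS.
    have -> : (subsum r n F + F r * nr)%N%:R * (w + (s r)%:R / 2 / nr%:R) =
       ((subsum r n F)%:R * w + (s r && F r)%:R / 2)
        + ((F r)%:R * (nr%:R * w) + (s r)%:R / 2 * ((subsum r n F)%:R / nr%:R)) :> rat.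
      rewrite natrD natrM -mulnb natrM; field; rewrite gt_eqF //; exact: lt_le_trans nrR.
    rewrite -[X in near_half _ X _]addbF.
    apply: (@near_halfW _ _ ((e2 + 0) + (0 + e2))); first by lra.
    apply: near_halfD; first by apply: near_halfD => //; exact: near_half_half.
    rewrite -[false]/(false (+) false); apply: near_halfD.
      by apply: near_half_int; rewrite rpredM ?natr_int ?nrx.
    have q0 : 0 <= ((subsum r n F)%:R : rat) / nr%:R by apply: divr_ge0.
    case/andP: b1 => b0 b1.
    apply: near_half_small; rewrite ger0_norm; last by rewrite mulr_ge0 ?divr_ge0.
    apply: le_trans (Mn _ (subM F)); apply: ler_piMl => //.
    by rewrite ler_pdivrMr //; lra.
move=> s t; have [w [/andP[w0 wr] wD wF]] := Hw s.
have [v [/andP[v0 vr] vD vF]] := Hw t; have [b [/andP[b0 be] bD bF]] := Hb s t.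
(* [m * W] is near half of the cross term of the disjunction, that is [t r] times the parity of [s]
   plus [s r] times that of [t]. The linear term [d * m * g] of [p(m + nr) * g] has to reproduce
   it. *)
pose W := (t r)%:R * w + (s r)%:R * v.
have W0 : 0 <= W by rewrite addr_ge0 ?mulr_ge0.
have Wr : W <= 2 * r%:R.
  rewrite mulr_natl mulr2n lerD //.
    by case: (t r); rewrite ?mul1r ?mul0r.
  by case: (s r); rewrite ?mul1r ?mul0r.
have [g [g0 [J intJ Pg] dg]] := int_multiple_near (s r || t r) P0 d0 W0 dP.
have g2 : g * d <= 2 * r%:R + 1.
  have : e3 <= 1 by rewrite /e3 ler_pdivrMr ?(lt_le_trans _ C1) // mul1r (le_trans _ C1) //; lra.
  move: dg; rewrite ler_norml mulrC => /andP[_]; lra.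
have g3 x : `|x| <= e3 * d -> `|x * g| <= e2.
  move=> xd; rewrite normrM (ger0_norm g0).
  apply: (@le_trans _ _ (e3 * d * g)); first by rewrite ler_wpM2r.
  rewrite -mulrA [d * g]mulrC -Ce3 [e3 * _]mulrC; apply: ler_wpM2r; first exact: ltW.
  by rewrite CE; lra.
have gsmall : g <= e2.
  by have := g3 1; rewrite normr1 mul1r => /(_ d1); rewrite ger0_norm.
exists (b + g); split.
- by rewrite addr_ge0 //=; lra.
- rewrite mulrDr; apply: rpredD; first exact: DD'.
  have -> : D'%:R * g = (D * (2 * nr))%N%:R * (2 * (P * g)).
    by rewrite /D' -pnE !natrM; ring.
  rewrite Pg; apply: rpredM; first exact: natr_int.
  have -> : 2 * (J + (s r || t r)%:R / 2) = 2 * J + (s r || t r)%:R by field.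
  by rewrite rpredD ?rpredM ?natr_int.
move=> F; rewrite sub !parityS; set m := subsum r n F.
have mM : (m <= M)%N by exact: subM.
have [pm taym] := Hm m mM.
case Fr: (F r); rewrite ?mul1n ?mul0n ?andbT ?andbF ?addbF ?addn0; last first.
  rewrite mulrDr -[X in near_half _ X _]addbF.
  apply: (@near_halfW _ _ (e2 + e2)); first by lra.
  by apply: near_halfD; [exact: bF|apply: near_half_small; exact: g3].
(* Modulo 2 a disjunction is [x + y + x y], so adding [s r] and [t r] to its arguments adds their
   disjunction and a cross term linear in the old parities. *)
have -> : (parity r s F (+) s r) || (parity r t F (+) t r) =
   ((parity r s F || parity r t F) (+) (s r || t r)) (+)
    ((t r && parity r s F) (+) (s r && parity r t F)).
  by case: (parity r s F); case: (parity r t F); case: (s r); case: (t r).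
have [c Hc] := horner_diff_dvd p m nr.
rewrite PoszD; set q := p.[m%:Z + nr%:Z] in taym Hc *.
(* [q * b] is [p(m) * b] up to an integer, by [Hc]; Taylor expansion of [q * g] yields [P * g], the
   cross term [m * W] and two small errors. *)
have -> : q%:~R * (b + g) =
    (((p.[m%:Z])%:~R * b + (P * g + c%:~R * (nr%:R * b)))
    + ((t r)%:R * (m%:R * w) + (s r)%:R * (m%:R * v)))
    + (m%:R * (d * g - W) + (q%:~R - P - d * m%:R) * g).
  have -> : (p.[m%:Z])%:~R = q%:~R - nr%:R * c%:~R :> rat.
    by rewrite -[nr%:R]/((nr%:Z)%:~R) -intrM -Hc intrB opprB addrCA subrr addr0.
  by rewrite /W; ring.
rewrite -[X in near_half _ X _]addbF.
apply: (@near_halfW _ _ (((e2 + (0 + 0)) + (e2 + e2)) + (e2 + e2))); first by lra.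
apply: near_halfD; last first.
  rewrite -[false]/(false (+) false); apply: near_halfD; apply: near_half_small.
    rewrite normrM ger0_norm //; apply: (@le_trans _ _ (M%:R * e3)).
      by apply: ler_pM => //; rewrite ler_nat.
    by rewrite -Ce3 ler_wpM2r ?(ltW e30) // CE; lra.
  exact: g3.
apply: near_halfD; last first.
  by apply: near_halfD; apply: near_halfMb; rewrite ?(ltW e20); [|exact: wF| |exact: vF].
apply: near_halfD; first exact: bF.
rewrite -[X in near_half _ X _]addbF.
apply: near_halfD; last by apply: near_half_int; rewrite rpredM ?intr_int ?nrx.
rewrite Pg [J + _]addrC -[X in near_half _ X _]addbF -[X in near_half _ _ X]addr0.
by apply: near_halfD; [exact: near_half_half|exact: near_half_int].
Qed.

(** Correlations only see the absolute value of [p(n)], and 1/2 is its own opposite modulo 1, so a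
    negative leading coefficient reduces to [- p]. *)
Lemma parity_phases (p : {poly int}) (N r : nat) (e : rat) :
  p.[0] = 0 -> (1 < (size p).-1)%N -> (0 < N)%N -> 0 < e ->
  exists (n : nat -> nat) (D : nat),
    [/\ (0 < D)%N,
        forall i, (i < r)%N -> (0 < n i)%N /\ (N %| n i)%N,
        forall i j, (i < j)%N -> (j < r)%N -> (n i < n j)%N
      & forall s t : nat -> bool, exists b : rat,
          [/\ 0 <= b <= e, D%:R * b \is a Num.int &
              forall F, near_half (`|p.[(subsum r n F)%:Z]|%N%:R * b)
                (parity r s F || parity r t F) e]].
Proof.
move=> p0 sp N0 e0; pose e1 := Num.min e 1.
have e11 : 0 < e1 <= 1 by rewrite lt_min e0 ltr01 ge_min lexx orbT.
have e1e : e1 <= e by rewrite ge_min lexx.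
have absE (x : int) : (`|x|%N%:R : rat) = x%:~R \/ (`|x|%N%:R : rat) = (- x)%:~R.
  rewrite -[`|x|%N%:R]/((`|x|%N%:Z)%:~R).
  by case: (lerP 0 x) => x0; [left; rewrite gez0_abs|right; rewrite ltz0_abs].
have [lp|lp|lp] := ltgtP 0 (lead_coef p).
- have [n [D [D0 nN nlt _ H]]] := parity_phases_small r p0 sp lp N0 e11.
  exists n, D; split => // s t; have [b [/andP[b0 be] bD bF]] := H s t.
  exists b; split => // [|F]; first by rewrite b0 (le_trans be).
  apply: (near_halfW e1e); have := bF F; move: p.[_] => x hx.
  by case: (absE x) => -> //; rewrite intrN mulNr; exact: near_halfN.
- have [|||n [D [D0 nN nlt _ H]]] := @parity_phases_small (- p) N r e1 _ _ _ N0 e11.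
  + by rewrite hornerN p0 oppr0.
  + by rewrite size_polyN.
  + by rewrite lead_coefN oppr_gt0.
  exists n, D; split => // s t; have [b [/andP[b0 be] bD bF]] := H s t.
  exists b; split => // [|F]; first by rewrite b0 (le_trans be).
  apply: (near_halfW e1e); have := bF F; rewrite hornerN; move: p.[_] => x hx.
  by case: (absE x) => -> //; rewrite -[x]opprK intrN mulNr; exact: near_halfN.
- by move/eqP: lp; rewrite eq_sym lead_coef_eq0 => /eqP p00; rewrite p00 size_poly0 in sp.
Qed.

(** The circle becomes [2 * h] blocks of [M] integers and the phase an integer speed [b]: the drift
    is [M * h] times the disjunction, modulo full turns and within [W]. An odd [b] and an even [M]
    will make [h * M] a half period of the extension. The full turn added in [y] lets [a] be a
    natural number. *)
Lemma integer_phases (p : {poly int}) (h r : nat) (e : nat) :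
  p.[0] = 0 -> (1 < (size p).-1)%N -> (0 < h)%N -> (0 < e)%N ->
  exists (n : nat -> nat) (M W : nat),
    [/\ (0 < M)%N && ~~ odd M, (W * e <= M)%N,
        forall i, (i < r)%N -> (0 < n i)%N /\ (2 * h %| n i)%N,
        forall i j, (i < j)%N -> (j < r)%N -> (n i < n j)%N
      & forall s t : nat -> bool, exists b : nat,
          [/\ odd b, (b <= W)%N & forall F, exists a : nat,
              let x := (M * (2 * h) * a + M * h * (parity r s F || parity r t F))%N in
              let y := (`|p.[(subsum r n F)%:Z]| * b + M * (2 * h))%N in
              (x <= y + W)%N && (y <= x + W)%N]].
Proof.
move=> p0 sp h0 e0; pose d : rat := 1 / (4 * e%:R * h%:R).
have eR : 1 <= (e%:R : rat) by rewrite ler1n.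
have hR : 1 <= (h%:R : rat) by rewrite ler1n.
have d0 : 0 < d by rewrite divr_gt0 ?mulr_gt0 //; lra.
have N0 : (0 < 2 * h)%N by rewrite muln_gt0.
have [n [D [D0 nN nlt H]]] := parity_phases r p0 sp N0 d0.
have [B TB] : exists B, forall F, (`|p.[(subsum r n F)%:Z]| <= B)%N.
  pose S := \sum_(i < r) n i.
  exists (\sum_(m < S.+1) `|p.[m%:Z]|)%N => F.
  have mS : (subsum r n F < S.+1)%N by rewrite ltnS; exact: subsum_le.
  by rewrite (bigD1 (Ordinal mS)) //= leq_addr.
(* [K] is large enough for [(B + 1) * e <= D * K], which is half of [M]. *)
pose K := (2 * e * (B + 1))%N.
pose M := (2 * D * K)%N.
have K0 : (0 < K)%N by rewrite /K !muln_gt0 e0 addn1.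
have M0 : (0 < M)%N by rewrite /M (muln_gt0 (2 * D)) (muln_gt0 2) D0 K0.
(* [D * K / e] is the error of the phases; [B] is the cost, at times up to [B], of the 1 that makes
   the speed odd. *)
pose W := (D * K %/ e + B + 1)%N.
have DK : (D * K = D * (2 * (B + 1)) * e)%N by rewrite /K; ring.
have WE : (W * e <= M)%N.
  have -> : (M = (D * (2 * (B + 1)) + D * (2 * (B + 1))) * e)%N.
    by rewrite /M -mulnA DK; ring.
  rewrite /W DK mulnK // leq_mul2r; apply/orP; right.
  by rewrite -addnA leq_add2l mulnA leq_pmull // muln_gt0 D0.
exists n, M, W; split => //; first by rewrite M0 /M -mulnA oddM.
have DKe : ((D * K %/ e)%N%:R : rat) = D%:R * K%:R / e%:R.
  by rewrite -natrM DK mulnK // [in RHS]natrM mulfK // gt_eqF // (lt_le_trans _ eR).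
have MR : (M%:R : rat) = 2 * D%:R * K%:R by rewrite /M !natrM.
have DR : 1 <= (D%:R : rat) by rewrite ler1n.
have KR : 1 <= (K%:R : rat) by rewrite ler1n.
have dE : d * 4 * h%:R = 1 / e%:R by rewrite /d; field; rewrite !gt_eqF // (lt_le_trans _ hR, lt_le_trans _ eR).
move=> s t; have [b [/andP[b0 bd] bD bF]] := H s t.
have /natrP[c Hc] : D%:R * b \is a Num.nat.
  by rewrite natrEint bD mulr_ge0.
have Mhb : (M%:R : rat) * (2 * h%:R) * d = D%:R * K%:R / e%:R.
  have -> : D%:R * K%:R / e%:R = D%:R * K%:R * (1 / e%:R) :> rat by rewrite mul1r.
  by rewrite MR -dE; ring.
exists (4 * c * K * h + 1)%N.
have bE : ((4 * c * K * h + 1)%N%:R : rat) = M%:R * (2 * h%:R) * b + 1.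
  by rewrite natrD !natrM -Hc; ring.
split.
- by rewrite addn1 /= -!mulnA oddM.
- rewrite -(ler_nat rat) bE /W !natrD DKe -Mhb lerD2r.
  apply: (@le_trans _ _ (M%:R * (2 * h%:R) * d)); last by rewrite lerDl.
  by rewrite ler_wpM2l ?mulr_ge0.
move=> F; have [a /intrP[z ->] ha] := bF F; move: ha (TB F).
set T := `|_|%N; set q := _ || _; move=> ha TBF.
have yE : ((T * (4 * c * K * h + 1) + M * (2 * h))%N%:R : rat) =
    M%:R * (2 * h%:R) * (T%:R * b) + T%:R + M%:R * (2 * h%:R).
  by rewrite natrD natrM bE (natrM _ M) (natrM _ 2); ring.
have MhR : 0 < M%:R * (2 * h%:R) :> rat by rewrite !mulr_gt0 ?ltr0n.
have key : `|(T * (4 * c * K * h + 1) + M * (2 * h))%N%:R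
     - (M%:R * (2 * h%:R) * (z%:~R + 1) + M%:R * h%:R * q%:R)| <= W%:R :> rat.
  have -> : (T * (4 * c * K * h + 1) + M * (2 * h))%N%:R
     - (M%:R * (2 * h%:R) * (z%:~R + 1) + M%:R * h%:R * q%:R) =
     M%:R * (2 * h%:R) * (T%:R * b - q%:R / 2 - z%:~R) + T%:R :> rat.
    by rewrite yE; field.
  apply: le_trans (ler_normD _ _) _; rewrite normrM (gtr0_norm MhR) [`|T%:R|]ger0_norm //.
  apply: (@le_trans _ _ (M%:R * (2 * h%:R) * d + B%:R)).
    apply: lerD; last by rewrite ler_nat.
    by apply: ler_wpM2l => //; exact: ltW.
  by rewrite Mhb -DKe -natrD ler_nat /W leq_addr.
have z1 : 0 <= z + 1.
  rewrite -(ler0z rat) intrD leNgt; apply/negP => zn.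
  have zn1 : (z%:~R + 1 : rat) <= -1.
    have : (z + 1 < 0)%R by rewrite -(ltrz0 rat) intrD.
    move=> hz; have : z + 1 <= -1 by rewrite -ltzD1 addNr.
    by rewrite -(ler_int rat) intrD.
  have WM : (W%:R : rat) <= M%:R.
    by rewrite ler_nat; apply: leq_trans WE; rewrite leq_pmulr.
  move: key; rewrite ler_norml => /andP[_].
  have y0 : (M * (2 * h))%N%:R <= (T * (4 * c * K * h + 1) + M * (2 * h))%N%:R :> rat.
    by rewrite ler_nat leq_addl.
  rewrite (natrM _ M) (natrM _ 2) in y0; move: y0; move: (T * _ + _)%N%:R => y y0 hy.
  have q1 : (q%:R : rat) <= 1 by case: (q).
  have MR0 : 0 < (M%:R : rat) by rewrite ltr0n.
  have E : M%:R * (2 * h%:R) = 2 * (M%:R * h%:R) :> rat by rewrite mulrCA.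
  have x1 : M%:R * (2 * h%:R) * (z%:~R + 1) <= 2 * (M%:R * h%:R) * (- 1 : rat).
    by rewrite E ler_wpM2l // mulr_ge0 // mulr_ge0.
  have x2 : M%:R * h%:R * q%:R <= M%:R * h%:R * 1 :> rat by rewrite ler_wpM2l // mulr_ge0.
  have x3 : M%:R * 1 <= M%:R * h%:R :> rat by rewrite ler_wpM2l.
  rewrite E mulr1 in y0 x2 x3; move: y0 x1 x2 x3 hy WM MR0; clear.
  move: (M%:R * h%:R) (M%:R * (2 * h%:R) * (z%:~R + 1)) (M%:R * h%:R * q%:R).
  by move: M%:R W%:R => a b Z Y X; lra.
case: (z + 1) z1 (intrD rat z 1) key => // a' _ zE; rewrite -zE => key.
exists a'; rewrite /= -!(ler_nat rat) !(natrD _ _ W).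
have -> : (M * (2 * h) * a' + M * h * q)%N%:R = M%:R * (2 * h%:R) * a'%:~R + M%:R * h%:R * q%:R :> rat.
  by rewrite natrD (natrM _ _ q) (natrM _ _ a') (natrM _ M) (natrM _ 2) (natrM _ M).
move: key; move: (T * _ + _)%N%:R (_ * _ * _ + _) => y x; clear.
by rewrite ler_distl => /andP[h1 h2]; apply/andP; split; lra.
Qed.

Local Close Scope ring_scope.

(** * Finite extensions of permutations *)

Lemma card_prod_pred (Y Z : finType) (P : Y -> Z -> bool) :
  #|[pred w : Y * Z | P w.1 w.2]| = \sum_y #|[pred z | P y z]|.
Proof.
rewrite -sum1_card -(pair_big_dep xpredT P (fun _ _ => 1)) /=.
by apply: eq_bigr => y _; rewrite sum1_card.
Qed.

Lemma card_can_pred (Z : finType) (f g : Z -> Z) (P : pred Z) :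
  cancel f g -> #|[pred z | P (f z)]| = #|P|.
Proof.
move=> /can_inj/injF_bij bij_f; rewrite -!sum1_card [RHS](reindex f) //.
exact: onW_bij.
Qed.

Lemma card_flip (Z : finType) (f g : Z -> Z) (P : pred Z) :
  cancel f g -> (forall z, P (f z) = ~~ P z) -> 2 * #|P| = #|Z|.
Proof.
move=> fK Pf; rewrite -(cardC P) mul2n -addnn; congr (_ + _).
by rewrite -(card_can_pred P fK); apply: eq_card => z; rewrite !inE Pf.
Qed.

Lemma iter_cancel (T : Type) (f g : T -> T) n :
  cancel f g -> cancel (iter n f) (iter n g).
Proof. by move=> fK; elim: n => // n IH x; rewrite iterSr /= fK IH. Qed.

Lemma iter_period (T : Type) (f : T -> T) N n m :
  (forall x, iter N f x = x) -> n = m %[mod N] -> forall x, iter n f x = iter m f x.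
Proof.
move=> fN nm x; have H k : iter k f x = iter (k %% N) f x.
  rewrite {1}(divn_eq k N) addnC iterD; congr (iter _ f _).
  by elim: (k %/ N) => // j IH; rewrite mulSn iterD IH fN.
by rewrite H nm -H.
Qed.

Definition rot (P : nat) (P0 : 0 < P) (b : nat) (u : 'I_P) : 'I_P :=
  Ordinal (ltn_pmod (u + b) P0).

Lemma iter_rot P P0 b t (u : 'I_P) : iter t (rot P0 b) u = rot P0 (t * b) u.
Proof.
elim: t => [|t IH]; apply: val_inj; rewrite /= ?IH /=.
  by rewrite mul0n addn0 modn_small.
by rewrite modnDml mulSn (addnC b) addnA.
Qed.

Lemma rot_cancel P P0 b : cancel (@rot P P0 b) (rot P0 (b * P.-1)).
Proof.
move=> u; apply: val_inj; rewrite /= modnDml -addnA -mulnS prednK //.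
by rewrite addnC modnMDl modn_small.
Qed.

Lemma rot_cancel_inv P P0 b : cancel (rot P0 (b * P.-1)) (@rot P P0 b).
Proof.
move=> u; apply: val_inj; rewrite /= modnDml -addnA (addnC _ b) -mulnS prednK //.
by rewrite addnC modnMDl modn_small.
Qed.

Lemma sum_periodic (K M : nat) (F : nat -> nat) :
  \sum_(i < K * M) F (i %% M) = K * \sum_(i < M) F i.
Proof.
rewrite -(big_mkord xpredT (fun i => F (i %% M))) -(big_mkord xpredT F).
elim: K => [|K IH]; first by rewrite !mul0n big_nil.
rewrite mulSnr (@big_cat_nat _ _ _ (K * M)) ?leq_addr //= IH mulSnr; congr (_ + _).
rewrite -{1}[K * M]add0n big_addn addKn !big_nat; apply: eq_bigr => i /andP[_ iM].
by rewrite addnC modnMDl modn_small.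
Qed.

(** Only these points can be carried to another block by a displacement of at most [W]. *)
Lemma card_near_boundary (K M W : nat) : 
  #|[pred u : 'I_(K * M) | ~~ ((W <= u %% M) && (u %% M + W < M))]| <= K * (2 * W).
Proof.
rewrite -sum1_card big_mkcond /=.
rewrite (eq_bigr (fun u : 'I_(K * M) =>
  (fun v => nat_of_bool (~~ ((W <= v) && (v + W < M)))) (u %% M))); last first.
  by move=> u _; case: ifP; rewrite inE => ->.
rewrite (sum_periodic K M (fun v => nat_of_bool (~~ ((W <= v) && (v + W < M))))).
rewrite leq_mul2l; apply/orP; right.
apply: (@leq_trans (\sum_(v < M) ((v < W : nat) + (M - W <= v : nat)))).
  apply: leq_sum => v _; have := ltn_ord v; move: (nat_of_ord v) => k kM.
  by case: (ltnP k W) => // kW; case: (leqP (M - W) k) => //; lia.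
rewrite big_split /= mul2n -addnn.
have H (N L : nat) : \sum_(v < N) (v < L : nat) <= L.
  elim: N L => [|N IH] L; first by rewrite big_ord0.
  case: L => [|L]; first by rewrite big1.
  by rewrite big_ord_recl /= add1n ltnS; apply: leq_trans (IH L); apply: leq_sum.
apply: leq_add; first exact: H.
rewrite (reindex_inj rev_ord_inj) /=; apply: leq_trans (H M W).
apply: leq_sum => v _; have := ltn_ord v; move: (nat_of_ord v) => k kM.
by case: leqP => //; case: ltnP => //; lia.
Qed.

Definition half_turn (Z : finType) (f : Z -> Z) (h : nat) (A : pred Z) : Prop :=
  (forall z, iter (2 * h) f z = z) /\ (forall z, A (iter h f z) = ~~ A z).

(** Equal fibres make [Phi] send uniform measure to uniform measure. Commutation may fail on a
    proportion [1 / C], so that errors can be made summable along a tower, and [h < h'] makes the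
    rigidity times increase. *)
Definition almost_extension (Z U : finType) (f : Z -> Z) (h : nat) (A : pred Z)
    (C : nat) (s si : U -> U) (Phi : U -> Z) (m h' : nat) : Prop :=
  [/\ cancel s si /\ cancel si s, 0 < m /\ forall z, #|[pred u | Phi u == z]| = m,
      half_turn s h' [pred u | A (Phi u)], h < h'
    & #|[pred u | Phi (s u) != f (Phi u)]| * C <= #|U|].

Lemma iter_fst (Y Z : Type) (f : Y -> Y) (g : Z -> Z) n w :
  iter n (fun w : Y * Z => (f w.1, g w.2)) w = (iter n f w.1, iter n g w.2).
Proof. by case: w => y z; elim: n => // n IH; rewrite !iterS IH. Qed.

Lemma card_fibre (Z : finType) (f g : Z -> Z) (z : Z) :
  cancel f g -> cancel g f -> #|[pred x | f x == z]| = 1.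
Proof.
by move=> fK gK; rewrite -(card1 (g z)); apply: eq_card => x; rewrite !inE (can2_eq fK gK).
Qed.

Lemma sum_pred_nat (Z : finType) (P : pred Z) :
  \sum_z (P z : nat) = #|[pred z | P z]|.
Proof.
by rewrite -[RHS]sum1_card [RHS]big_mkcond; apply: eq_bigr => z _; rewrite inE; case: (P z).
Qed.

Lemma card_cst_pred (Z : finType) (b : bool) : #|[pred z : Z | b]| = b * #|Z|.
Proof.
case: b => /=; first by rewrite mul1n; apply: eq_card.
by rewrite mul0n; apply: eq_card0.
Qed.

Section Mixing.
Variables (Z : finType) (f fi : Z -> Z) (h : nat) (A : pred Z).
Hypotheses (fK : cancel f fi) (fiK : cancel fi f) (h0 : 0 < h) (hA : half_turn f h A).
Hypothesis (Z0 : 0 < #|Z|).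

Lemma iter_dvd n : 2 * h %| n -> forall z, iter n f z = z.
Proof.
by move=> /eqP dn z; rewrite (@iter_period _ f (2 * h) n 0) // ?mod0n //; case: hA.
Qed.

(* The first coordinate is followed for [L] steps, then the second one, then both
   again after half a turn: a jump of [L] decouples the two observed points. *)
Lemma mixing_extension (C : nat) :
  exists (U : finType) (s si : U -> U) (Phi : U -> Z) (m h' t : nat),
    almost_extension f h A C s si Phi m h' /\
    forall z z', #|[pred u | (Phi u == z) && (Phi (iter t s u) == z')]| * #|Z| ^ 2 = #|U|.
Proof.
(* A multiple of the period [2 * h], and at least [2 * C]: each of the four blocks of length [L] has
   two positions next to its ends. *)
pose L := 2 * h * (2 * C + 1).
have L0 : 0 < L by rewrite /L addn1 !muln_gt0 h0.
have hL : 2 * h %| L by rewrite dvdn_mulr.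
have hltL : h < L.
  by apply: (@leq_trans (2 * h)); [rewrite mul2n -addnn -addn1 leq_add2l|rewrite /L addn1 leq_pmulr].
have C2L : C * 2 <= L.
  by rewrite /L mulnDr muln1 -mulnA; apply: leq_trans (leq_addr _ _);
     rewrite mulnC leq_mul2l /= mulnA leq_pmull // muln_gt0 h0.
move: L L0 hL hltL C2L => L L0 hL hltL C2L.
have P0 : 0 < 4 * L by rewrite muln_gt0.
have hf := iter_dvd.
pose s (w : 'I_(4 * L) * (Z * Z)) := (rot P0 1 w.1, (f w.2.1, f w.2.2)).
pose si (w : 'I_(4 * L) * (Z * Z)) := (rot P0 (1 * (4 * L).-1) w.1, (fi w.2.1, fi w.2.2)).
(* The four blocks show the first point, the second one, then both again after half a turn; the
   cycle closes as [iter (2 * h) f] is the identity. *)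
pose sel (j : nat) (d : Z * Z) : Z := iter (h * (j %/ 2)) f (if odd j then d.2 else d.1).
pose Phi (w : 'I_(4 * L) * (Z * Z)) := sel (w.1 %/ L) w.2.
have iter_s n w : iter n s w = (rot P0 (n * 1) w.1, (iter n f w.2.1, iter n f w.2.2)).
  by rewrite /s (iter_fst _ (fun d : Z * Z => (f d.1, f d.2))) iter_rot iter_fst.
have sel4 j : sel (j %% 4) =1 sel j.
  move=> d; have oj : odd (j %% 4) = odd j.
    by rewrite [in RHS](divn_eq j 4) oddD oddM andbF.
  rewrite /sel oj; apply: (@iter_period _ _ (2 * h)); first by case: hA.
  have -> : j %/ 2 = j %/ 4 * 2 + j %% 4 %/ 2.
    by rewrite -divnMDl // -mulnA -divn_eq.
  by rewrite mulnDr mulnCA (mulnC h 2) modnMDl.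
have modL u : (u %% (4 * L)) %/ L = (u %/ L) %% 4 by rewrite -modn_divl.
have Phi_iter n w : 2 * h %| n -> Phi (iter n s w) = sel ((w.1 + n) %/ L) w.2.
  by move=> hn; rewrite iter_s /Phi /= !hf //= muln1 modL sel4; case: (w.2).
have cardU : #|{: 'I_(4 * L) * (Z * Z)}| = 4 * L * #|Z| ^ 2.
  by rewrite !card_prod card_ord -mulnn.
have fibre z : forall n, #|[pred x | iter n f x == z]| = 1.
  by move=> n; apply: card_fibre (iter_cancel n fK) (iter_cancel n fiK).
exists ('I_(4 * L) * (Z * Z))%type, s, si, Phi, (4 * L * #|Z|), (2 * L), L.
split; first split.
- by split=> [[u [x y]]|[u [x y]]]; rewrite /s /si /= ?fK ?fiK ?rot_cancel ?rot_cancel_inv.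
- split=> [|z]; first by rewrite muln_gt0 P0.
  rewrite (card_prod_pred (fun (u : 'I_(4 * L)) d => sel (u %/ L) d == z)).
  rewrite (eq_bigr (fun=> #|Z|)) ?sum_nat_const ?card_ord // => u _.
  rewrite /sel; case: odd.
    rewrite (card_prod_pred (fun x y => iter _ f y == z)).
    by rewrite (eq_bigr (fun=> 1)) ?sum1_card // => x _; rewrite fibre.
  rewrite (card_prod_pred (fun x y => iter _ f x == z)).
  rewrite (eq_bigr (fun x => (iter (h * (u %/ L %/ 2)) f x == z) * #|Z|)).
    by rewrite -big_distrl /= sum_pred_nat fibre mul1n.
  by move=> x _; exact: card_cst_pred.
- split=> w.
    by rewrite mulnA iter_s !hf ?dvdn_mull //; case: w => u [x y] /=; congr (_, _);
       apply: val_inj; rewrite /= muln1 modnDr modn_small.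
  rewrite /= Phi_iter ?dvdn_mull // divnDMl // /sel addn2 /= negbK.
  by rewrite divn2 /= -divn2 mulnSr addnC iterD (proj2 hA).
- by rewrite (ltn_trans hltL) // mul2n -addnn -addn1 leq_add2l.
- rewrite cardU.
  have bad (w : 'I_(4 * L) * (Z * Z)) : Phi (s w) != f (Phi w) ->
      ~~ ((1 <= w.1 %% L) && (w.1 %% L + 1 < L)).
    apply: contraNN => /andP[_ uL].
    have uE : (w.1 + 1) %/ L = w.1 %/ L.
      by rewrite {1}(divn_eq w.1 L) -addnA divnMDl // (divn_small uL) addn0.
    rewrite /Phi /s /= modL sel4 uE /sel /=.
    by case: odd; rewrite -iterSr iterS.
  apply: (@leq_trans (4 * (2 * 1) * #|Z| ^ 2 * C)).
    rewrite leq_mul2r; apply/orP; right.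
    apply: (@leq_trans #|[pred w : 'I_(4 * L) * (Z * Z) | ~~ ((1 <= w.1 %% L) && (w.1 %% L + 1 < L))]|).
      by apply: subset_leq_card; apply/subsetP => w; rewrite !inE; exact: bad.
    rewrite (card_prod_pred (fun (u : 'I_(4 * L)) d => ~~ ((1 <= u %% L) && (u %% L + 1 < L)))).
    under eq_bigr do rewrite card_cst_pred.
    rewrite -big_distrl /= sum_pred_nat card_prod mulnn leq_mul2r.
    by rewrite card_near_boundary orbT.
  have -> : 4 * (2 * 1) * #|Z| ^ 2 * C = 4 * (C * 2) * #|Z| ^ 2 by ring.
  by rewrite leq_mul2r leq_mul2l C2L !orbT.
(* At time [L] the next block is observed, which reads the other coordinate: for each [u], exactly
   one pair of points realises [(z, z')]. *)
move=> z z'; rewrite cardU.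
transitivity (#|[pred w : 'I_(4 * L) * (Z * Z) |
    (sel (w.1 %/ L) w.2 == z) && (sel (w.1 %/ L).+1 w.2 == z')]| * #|Z| ^ 2).
  congr (_ * _); apply: eq_card => w.
  by rewrite !inE Phi_iter // divnDr // divnn L0 addn1.
rewrite (card_prod_pred (fun (u : 'I_(4 * L)) d => (sel (u %/ L) d == z) && (sel (u %/ L).+1 d == z'))).
rewrite (eq_bigr (fun=> 1)) ?sum_nat_const ?card_ord ?muln1 // => u _.
have one n n' y y' (b : bool) : #|[pred d : Z * Z |
    (iter n f (if b then d.2 else d.1) == y) && (iter n' f (if b then d.1 else d.2) == y')]| = 1.
  case: b.
    rewrite (card_prod_pred (fun x x' => (iter n f x' == y) && (iter n' f x == y'))).
    rewrite -(fibre y' n') -sum_pred_nat; apply: eq_bigr => x _.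
    case: eqP => _ /=; last by apply: eq_card0 => x'; rewrite inE andbF.
    by rewrite -[RHS](fibre y n); apply: eq_card => x'; rewrite !inE andbT.
  rewrite (card_prod_pred (fun x x' => (iter n f x == y) && (iter n' f x' == y'))).
  rewrite -(fibre y n) -sum_pred_nat; apply: eq_bigr => x _.
  by case: eqP => _ /=; [exact: fibre|apply: eq_card0 => x'; rewrite inE].
rewrite -[RHS](one (h * (u %/ L %/ 2)) (h * ((u %/ L).+1 %/ 2)) z z' (odd (u %/ L))).
by apply: eq_card => d; rewrite !inE /sel /=; case: odd.
Qed.
End Mixing.

Definition indicator (r : nat) (g : {ffun 'I_r -> bool}) (i : nat) : bool :=
  if insub i is Some j then g j else false.

Lemma indicatorE r (g : {ffun 'I_r -> bool}) (i : 'I_r) : indicator g i = g i.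
Proof. by rewrite /indicator valK. Qed.

(** Toggling [i] in the subset flips its parity along [F], which contains [i]. *)
Lemma card_parity0 (r : nat) (F : nat -> bool) (i : nat) : i < r -> F i ->
  2 * #|[pred g : {ffun 'I_r -> bool} | ~~ parity r (indicator g) F]| =
  #|{ffun 'I_r -> bool}|.
Proof.
move=> ir Fi; pose j := Ordinal ir.
pose tog (g : {ffun 'I_r -> bool}) := [ffun i => g i (+) (i == j)].
have togK : cancel tog tog by move=> g; apply/ffunP => k; rewrite !ffunE -addbA addbb addbF.
apply: (card_flip togK) => g; rewrite /=; congr (~~ _).
have parityE (s : nat -> bool) :
    parity r s F = \big[addb/false]_(i < r) (s i && F i).
  rewrite /parity (big_morph odd oddD (erefl : odd 0 = false)).
  by apply: eq_bigr => k _; rewrite oddb.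
have Fj : F j by [].
rewrite !parityE (bigD1 j) // [in RHS](bigD1 j) // !indicatorE ffunE eqxx Fj !andbT.
rewrite addbT [LHS]addNb; congr (~~ addb _ _); apply: eq_bigr => k kj.
by rewrite !indicatorE ffunE (negbTE kj) addbF.
Qed.

(** This makes the times [p(n)] periods of the previous permutation as soon as the [n] are. *)
Lemma dvd_horner (p : {poly int}) (m : nat) : (p.[0] = 0)%R -> m %| `|p.[m%:Z]%R|.
Proof.
move=> p0; have [c] := horner_diff_dvd p 0 m.
by rewrite p0 subr0 add0r => ->; rewrite abszM dvdn_mulr.
Qed.

Lemma dvd_subsum (N r : nat) n F : (forall i, i < r -> N %| n i) -> N %| subsum r n F.
Proof. by move=> H; apply: dvdn_sum => i _; apply/dvdn_mull/H. Qed.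

Lemma half_turn_iter (Z : finType) (f : Z -> Z) (h : nat) (A : pred Z) k z :
  half_turn f h A -> A (iter (h * k) f z) = odd k (+) A z.
Proof.
move=> [_ H]; elim: k => [|k IH]; first by rewrite muln0.
by rewrite mulnS iterD H IH /= addNb.
Qed.

Section PolynomialSwap.
Variables (Z : finType) (f fi : Z -> Z) (h : nat) (A : pred Z).
Hypotheses (fK : cancel f fi) (fiK : cancel fi f) (h0 : 0 < h) (hA : half_turn f h A).
Variables (p : {poly int}).
Hypotheses (p0 : (p.[0] = 0)%R) (sp : 1 < (size p).-1).

(* Averaged over the copies [(s, t)], the [p (subsum F)]-th iterate exchanges [A]
   with its complement with probability 3/4. *)
Lemma swapping_extension (r C : nat) :
  exists (U : finType) (s si : U -> U) (Phi : U -> Z) (m h' : nat) (n : nat -> nat),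
    [/\ almost_extension f h A C s si Phi m h',
        forall i, i < r -> 0 < n i,
        forall i j, i < j -> j < r -> n i < n j &
        forall (F : nat -> bool) i, i < r -> F i ->
          #|[pred u | A (Phi u) && A (Phi (iter `|p.[(subsum r n F)%:Z]%R| s u))]| * 32
            <= 5 * #|U| ].
Proof.
(* [2 * C] serves the commutation errors; 64 bounds by 1/32 the proportion [2 * W / M] of points
   near block boundaries. *)
have e0 : 0 < 2 * C + 64 by rewrite addn_gt0 orbT.
have [n [M [W [/andP[M0 Meven] WM nN nlt Hb]]]] := integer_phases r p0 sp h0 e0.
pose X := ({ffun 'I_r -> bool} * {ffun 'I_r -> bool})%type.
have [b {}Hb] := fin_all_exists (fun x : X => Hb (indicator x.1) (indicator x.2)).

pose P := 2 * h * M.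
have P0 : 0 < P by rewrite /P !muln_gt0 h0.
(* Copy [x] carries a clock of speed [b x]; block [j] of the clock shows the point moved by
   [iter j f]. *)
pose s (w : X * 'I_P * Z) := ((w.1.1, rot P0 (b w.1.1) w.1.2), f w.2).
pose si (w : X * 'I_P * Z) := ((w.1.1, rot P0 (b w.1.1 * P.-1) w.1.2), fi w.2).
pose Phi (w : X * 'I_P * Z) := iter (w.1.2 %/ M) f w.2.
have hf := iter_dvd hA.
have iter_s k w : iter k s w = ((w.1.1, rot P0 (k * b w.1.1) w.1.2), iter k f w.2).
  elim: k w => [|k IH] [[x u] z]; first by congr (_, _, _); apply: val_inj; rewrite /= mul0n addn0 modn_small.
  rewrite iterS IH /s /= -iterS; congr (_, _, _).
  by rewrite -[LHS]/(iter 1 (rot P0 (b x)) _) -iter_rot -iterD add1n iter_rot.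
have modP k z : iter ((k %% P) %/ M) f z = iter (k %/ M) f z.
  apply: (@iter_period _ _ (2 * h)); first by case: hA.
  by rewrite -modn_divl modn_mod.
have cardU : #|{: X * 'I_P * Z}| = #|{: X}| * P * #|Z| by rewrite !card_prod card_ord.
have dens (Q : pred (X * 'I_P * Z)) V : (forall w, Q w -> ~~ ((V <= w.1.2 %% M) && (w.1.2 %% M + V < M))) ->
    #|[pred w | Q w]| <= #|{: X}| * (2 * h * (2 * V)) * #|Z|.
  move=> HQ.
  apply: (@leq_trans #|[pred w : X * 'I_P * Z | ~~ ((V <= w.1.2 %% M) && (w.1.2 %% M + V < M))]|).
    by apply: subset_leq_card; apply/subsetP => w; rewrite !inE; exact: HQ.
  rewrite (card_prod_pred (fun (w : X * 'I_P) (z : Z) => ~~ ((V <= w.2 %% M) && (w.2 %% M + V < M)))).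
  under eq_bigr do rewrite card_cst_pred.
  rewrite -big_distrl /= sum_pred_nat leq_mul2r; apply/orP; right.
  rewrite (card_prod_pred (fun (x : X) (u : 'I_P) => ~~ ((V <= u %% M) && (u %% M + V < M)))).
  by rewrite sum_nat_const leq_mul2l card_near_boundary orbT.
have cardA : 2 * #|A| = #|Z| by apply: card_flip (iter_cancel h fK) _; case: hA.
have inA k : #|[pred z | A (iter k f z)]| = #|A| by apply: card_can_pred (iter_cancel k fK).
have MW : 2 * W <= M.
  apply: leq_trans WM; rewrite mulnC leq_mul2l; apply/orP; right.
  by apply: leq_trans (leq_addl _ _).
exists (X * 'I_P * Z)%type, s, si, Phi, (#|{: X}| * P), (h * M), n; split => //.
- split.
  + by split=> [[[x u] z]|[[x u] z]]; rewrite /s /si /= ?fK ?fiK ?rot_cancel ?rot_cancel_inv.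
  + have X0 : 0 < #|{: X}| by rewrite card_prod muln_gt0 !card_ffun card_bool card_ord !expn_gt0.
    split=> [|z]; first by rewrite muln_gt0 X0 P0.
    rewrite (card_prod_pred (fun (w : X * 'I_P) (z' : Z) => iter (w.2 %/ M) f z' == z)).
    rewrite (eq_bigr (fun=> 1)) ?sum1_card ?card_prod ?card_ord // => w _.
    exact: card_fibre (iter_cancel _ fK) (iter_cancel _ fiK).
  + have [H1 H2] : (2 * h %| 2 * (h * M)) /\ 2 * h %| h * M.
      split; first by rewrite mulnA dvdn_mulr.
      by rewrite mulnC dvdn_pmul2l // dvdn2.
    split=> w.
      rewrite iter_s hf //; case: w => [[x u] z] /=; congr (_, _, _); apply: val_inj => /=.
      by rewrite [2 * _]mulnA -/P addnC (mulnC P) modnMDl modn_small.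
    (* In time [h * M] the clock advances by [h * b] blocks, which is [b] half turns with [b]
       odd. *)
    have [ob _ _] := Hb w.1.1.
    rewrite /= iter_s /Phi /= modP (hf (h * M)) // mulnAC divnDMl // addnC iterD.
    by rewrite (half_turn_iter _ _ hA) ob.
  + by rewrite -{1}[h]muln1 ltn_mul2l h0; case: (M) M0 Meven => [|[]].
  + rewrite cardU; apply: (@leq_trans (#|{: X}| * (2 * h * (2 * W)) * #|Z| * C)).
      rewrite leq_mul2r; apply/orP; right; apply: dens => w /=.
      apply: contraNN => /andP[_ uW]; have [_ bW _] := Hb w.1.1.
      rewrite /Phi /s /= modP -iterSr iterS.
      rewrite {1}(divn_eq w.1.2 M) -addnA divnMDl // (@divn_small (w.1.2 %% M + b w.1.1)) ?addn0 //.
      by apply: leq_ltn_trans uW; rewrite leq_add2l.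
    have -> : #|{: X}| * (2 * h * (2 * W)) * #|Z| * C = #|{: X}| * (2 * h * (W * (2 * C))) * #|Z|.
      by ring.
    rewrite leq_mul2r !leq_mul2l (leq_trans _ WM) ?orbT //.
    by rewrite leq_mul2l leq_addr orbT.
- by move=> i /nN[].
move=> F i ir Fi.
set T := `|_|%N.
(* The base point returns at time [T], so only the clock matters. *)
have hT : 2 * h %| T.
  apply: dvdn_trans (dvd_horner _ p0); apply: dvd_subsum => j /nN[] //.
pose q (x : X) := parity r (indicator x.1) F || parity r (indicator x.2) F.
have key w : A (Phi w) && A (Phi (iter T s w)) ->
    (~~ ((W <= w.1.2 %% M) && (w.1.2 %% M + W < M))) || (~~ q w.1.1 && A (Phi w)).
  case: (boolP (_ && (_ < _))) => //= /andP[Wu uM] /andP[Aw]; rewrite Aw andbT.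
  have [_ _ /(_ F)[a /= /andP[]]] := Hb w.1.1; rewrite -/(q w.1.1) -/T.
  set k := T * _; move=> xy yx.
  rewrite iter_s /Phi /= modP (hf T) // -/k.
  (* Away from block boundaries the error [W] does not change the block: the drift is exactly
     [h * q] blocks modulo [2 * h]. *)
  have kE : (w.1.2 + k) %/ M + 2 * h = w.1.2 %/ M + (2 * h * a + h * q w.1.1).
    rewrite [LHS]addnC -divnMDl //; set v := 2 * h * a + h * q w.1.1.
    have xE : M * (2 * h) * a + M * h * q w.1.1 = v * M by rewrite /v; ring.
    rewrite {}xE in xy yx; rewrite {1}(divn_eq w.1.2 M).
    have -> : 2 * h * M + (w.1.2 %/ M * M + w.1.2 %% M + k) =
        (w.1.2 %/ M + v) * M + (w.1.2 %% M + (k + M * (2 * h)) - v * M).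
      rewrite mulnDl (mulnC (2 * h)) -[RHS]addnA subnKC.
        by rewrite addnCA addnA [in RHS](addnC k) !addnA (addnAC _ (M * (2 * h))).
      by apply: leq_trans xy _; rewrite addnC leq_add2r.
    rewrite divnMDl // (@divn_small (_ - _)) ?addn0 //.
    rewrite ltn_subLR.
      by apply: leq_ltn_trans (_ : _ <= w.1.2 %% M + (v * M + W)) _;
        rewrite ?leq_add2l // addnCA ltn_add2l.
    by apply: leq_trans xy _; rewrite addnC leq_add2r.
  have <- : iter ((w.1.2 + k) %/ M + 2 * h) f w.2 = iter ((w.1.2 + k) %/ M) f w.2.
    by rewrite iterD (hf (2 * h)).
  rewrite kE addnC iterD; have -> : 2 * h * a + h * q w.1.1 = h * (2 * a + q w.1.1) by ring.
  rewrite (half_turn_iter _ _ hA) oddD oddM /= oddb; rewrite /Phi in Aw.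
  by rewrite Aw addbT.
(* The copies without swap contribute 1/4 times 1/2, the boundaries 1/32: together 5/32. *)
apply: (@leq_trans ((#|[pred w : X * 'I_P * Z | ~~ ((W <= w.1.2 %% M) && (w.1.2 %% M + W < M))]|
   + #|[pred w : X * 'I_P * Z | ~~ q w.1.1 && A (Phi w)]|) * 32)).
  rewrite leq_mul2r /=; rewrite -cardUI; apply: leq_trans (leq_addr _ _).
  apply: subset_leq_card; apply/subsetP => w; rewrite !inE; exact: key.
have -> : #|[pred w : X * 'I_P * Z | ~~ q w.1.1 && A (Phi w)]| = #|[pred x : X | ~~ q x]| * P * #|A|.
  rewrite (card_prod_pred (fun (w : X * 'I_P) (z : Z) => ~~ q w.1 && A (iter (w.2 %/ M) f z))).
  rewrite (eq_bigr (fun w => (~~ q w.1) * #|A|)).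
    rewrite -big_distrl /= (sum_pred_nat (fun w : X * 'I_P => ~~ q w.1)); congr (_ * _).
    rewrite (card_prod_pred (fun x (u : 'I_P) => ~~ q x)).
    under eq_bigr do rewrite card_cst_pred.
    by rewrite -big_distrl /= sum_pred_nat card_ord.
  move=> w _; case: (q w.1) => /=; first by rewrite mul0n; apply: eq_card0.
  by rewrite mul1n -[RHS](inA (w.2 %/ M)); apply: eq_card.
(* The two subsets are independent, so both parities are even for one pair in four. *)
have cardq : 4 * #|[pred x : X | ~~ q x]| = #|{: X}|.
  have -> : #|[pred x : X | ~~ q x]| = #|[pred g : {ffun 'I_r -> bool} | ~~ parity r (indicator g) F]| ^ 2.
    rewrite -mulnn -cardX; apply: eq_card => -[g g'].
    by rewrite !inE /q negb_or.
  by rewrite [RHS]card_prod -(card_parity0 ir Fi); ring.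
apply: (@leq_trans ((#|{: X}| * (2 * h * (2 * W)) * #|Z| + #|[pred x : X | ~~ q x]| * P * #|A|) * 32)).
  by rewrite leq_mul2r leq_add2r /=; apply: dens.
rewrite cardU -cardq -cardA /P.
set a := #|A|; set c := #|_|.
have -> : (4 * c * (2 * h * (2 * W)) * (2 * a) + c * (2 * h * M) * a) * 32 =
  16 * (c * h * a) * (64 * W) + 64 * (c * h * a) * M by ring.
have -> : 5 * (4 * c * (2 * h * M) * (2 * a)) = 16 * (c * h * a) * M + 64 * (c * h * a) * M by ring.
rewrite leq_add2r leq_mul2l; apply/orP; right; apply: leq_trans WM.
by rewrite mulnC leq_mul2l leq_addl orbT.
Qed.
End PolynomialSwap.

(** Numbering the points fibre by fibre turns [Phi] into division by [m], the map that relates the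
    codes of a real number at two successive scales. *)
Lemma fibre_enumeration (U : finType) (Q m : nat) (Phi : U -> 'I_Q) :
  (forall z, #|[pred u | Phi u == z]| = m) ->
  exists (phi : U -> 'I_(Q * m)) (psi : 'I_(Q * m) -> U),
    [/\ cancel phi psi, cancel psi phi & forall u, phi u %/ m = Phi u].
Proof.
move=> Hm; pose fib u := enum [pred u' | Phi u' == Phi u].
have idx u : index u (fib u) < m.
  by rewrite -(Hm (Phi u)) cardE index_mem mem_enum inE.
have lt u : Phi u * m + index u (fib u) < Q * m.
  apply: leq_trans (_ : (Phi u).+1 * m <= _); last by rewrite leq_mul2r ltn_ord orbT.
  by rewrite mulSn addnC ltn_add2r.
pose phi u := Ordinal (lt u).
have m0 (u : U) : 0 < m by exact: leq_ltn_trans (leq0n _) (idx u).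
have phiE u : phi u %/ m = Phi u.
  by rewrite /= divnMDl ?(m0 u) // divn_small ?addn0 // idx.
have phi_inj : injective phi.
  move=> u v uv; have Puv : Phi u = Phi v by apply: val_inj; rewrite /= -!phiE uv.
  move: uv => [] /eqP; rewrite /fib Puv eqn_add2l => /eqP uv.
  have mem w : Phi w = Phi v -> w \in enum [pred u' | Phi u' == Phi v].
    by move=> e; rewrite mem_enum inE e.
  by rewrite -(nth_index u (mem u Puv)) uv nth_index ?mem.
have cardU : #|U| = Q * m.
  rewrite -sum1_card (partition_big Phi xpredT) //= -[Q in RHS]card_ord -sum_nat_const.
  by apply: eq_bigr => z _; rewrite -(Hm z) -sum1_card.
have [psi phiK psiK] : bijective phi.
  by apply: inj_card_bij => //; rewrite card_ord cardU.
by exists phi, psi.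
Qed.

(** * Levels and towers *)

(* [lfwd], with inverse [lbwd], matters only on [0, lsize); [lhalf] is half of a
   period, and [iter lhalf lfwd] exchanges the two halves of [0, lsize). *)
Record level := Level {
  lsize : nat ; lfwd : nat -> nat ; lbwd : nat -> nat ; lhalf : nat }.

(** Bijectivity and periodicity are asked on all of [nat]; [level_of_extension] arranges this by the
    identity beyond [lsize]. *)
Record wf_level (l : level) : Prop := {
  wf_size : 0 < lsize l ;
  wf_even : ~~ odd (lsize l) ;
  wf_can : cancel (lfwd l) (lbwd l) ;
  wf_can_inv : cancel (lbwd l) (lfwd l) ;
  wf_bound : forall i, (lfwd l i < lsize l) = (i < lsize l) ;
  wf_half : 0 < lhalf l ;
  wf_period : forall i, iter (2 * lhalf l) (lfwd l) i = i ;
  wf_swap : forall i, i < lsize l ->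
    (2 * iter (lhalf l) (lfwd l) i < lsize l) = ~~ (2 * i < lsize l) }.

Definition lratio (l l' : level) : nat := lsize l' %/ lsize l.

Record refines (C : nat) (l l' : level) : Prop := {
  refines_size : lsize l' = lsize l * lratio l l' ;
  refines_half : lhalf l < lhalf l' ;
  refines_close : #|[pred i : 'I_(lsize l') |
      lfwd l' i %/ lratio l l' != lfwd l (i %/ lratio l l')]| * C <= lsize l' }.

Lemma iter_bound l n i : wf_level l -> (iter n (lfwd l) i < lsize l) = (i < lsize l).
Proof. by move=> wf; elim: n => // n IH; rewrite iterS (wf_bound wf). Qed.

Definition restrict (l : level) (wf : wf_level l) (i : 'I_(lsize l)) : 'I_(lsize l) :=
  Ordinal (etrans (wf_bound wf i) (ltn_ord i)).

Lemma bwd_bound l i : wf_level l -> (lbwd l i < lsize l) = (i < lsize l).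
Proof. by move=> wf; rewrite -(wf_bound wf) (wf_can_inv wf). Qed.

Definition restrict_inv (l : level) (wf : wf_level l) (i : 'I_(lsize l)) : 'I_(lsize l) :=
  Ordinal (etrans (bwd_bound i wf) (ltn_ord i)).

Lemma restrictK l (wf : wf_level l) : cancel (restrict wf) (restrict_inv wf).
Proof. by move=> i; apply: val_inj; rewrite /= (wf_can wf). Qed.

Lemma restrict_invK l (wf : wf_level l) : cancel (restrict_inv wf) (restrict wf).
Proof. by move=> i; apply: val_inj; rewrite /= (wf_can_inv wf). Qed.

Lemma iter_restrict l (wf : wf_level l) n i : iter n (restrict wf) i = iter n (lfwd l) i :> nat.
Proof. by elim: n => //= n ->. Qed.

Definition low_half (l : level) : pred 'I_(lsize l) := fun i => 2 * i < lsize l.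

Lemma half_turn_restrict l (wf : wf_level l) : half_turn (restrict wf) (lhalf l) (@low_half l).
Proof.
split=> i; first by apply: val_inj; rewrite /= iter_restrict (wf_period wf).
by rewrite /low_half iter_restrict (wf_swap wf).
Qed.

(** As [Q] is even, its midpoint is a block boundary, so a finer position is in the lower half
    exactly when its block is. Hence a single event serves all levels. *)
Lemma low_half_divn Q m i : 0 < m -> ~~ odd Q -> (2 * i < Q * m) = (2 * (i %/ m) < Q).
Proof.
move=> m0 ev; rewrite -(even_halfK ev) -muln2 mulnAC (mulnC _ 2) ltn_mul2l.
by rewrite (mulnC _ 2) ltn_mul2l /= ltn_divLR.
Qed.

Lemma level_of_extension (l : level) (wf : wf_level l) (C : nat) (U : finType)
    (s si : U -> U) (Phi : U -> 'I_(lsize l)) (m h' : nat) :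
  almost_extension (restrict wf) (lhalf l) (@low_half l) C s si Phi m h' ->
  exists l' : level, [/\ wf_level l', refines C l l' &
    exists2 phi : U -> 'I_(lsize l'), bijective phi &
      (forall u, (phi u %/ lratio l l' = Phi u)) /\
      (forall n u, iter n (lfwd l') (phi u) = phi (iter n s u))].
Proof.
move=> [[sK siK] [m0 Hm] [hper hswap] hh' close].
have [phi [psi [phiK psiK phiE]]] := fibre_enumeration Hm.
pose F (g : U -> U) (i : nat) : nat :=
  if insub i is Some j then phi (g (psi j)) else i.
have F_ord g (j : 'I_(lsize l * m)) : F g j = phi (g (psi j)) by rewrite /F valK.
have F_phi g u : F g (phi u) = phi (g u) by rewrite F_ord phiK.
have F_out g i : lsize l * m <= i -> F g i = i.
  by move=> hi; rewrite /F insubN // -leqNgt.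
have FK g g' : cancel g g' -> cancel (F g) (F g').
  move=> gK i; case: (ltnP i (lsize l * m)) => hi; last by rewrite !F_out.
  by rewrite -[i]/(val (Ordinal hi)) F_ord F_phi gK psiK.
have F_bound g i : (F g i < lsize l * m) = (i < lsize l * m).
  case: (ltnP i (lsize l * m)) => hi; last by rewrite F_out // ltnNge hi.
  by rewrite -[i]/(val (Ordinal hi)) F_ord ltn_ord.
have F_iter n u : iter n (F s) (phi u) = phi (iter n s u).
  by elim: n => //= n ->; rewrite F_phi.
have l0 := wf_size wf.
pose l' := Level (lsize l * m) (F s) (F si) h'.
have rE : lratio l l' = m by rewrite /lratio /= mulKn.
have lowE u : (2 * phi u < lsize l * m) = low_half (Phi u).
  by rewrite low_half_divn ?(wf_even wf) // phiE.
have bij : bijective phi by exists psi.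
have transfer (P : nat -> bool) : #|[pred i : 'I_(lsize l * m) | P i]| = #|[pred u | P (phi u)]|.
  rewrite -!sum1_card (reindex phi) //; exact: onW_bij.
have cardU : #|U| = lsize l * m by rewrite (bij_eq_card bij) card_ord.
exists l'; split.
- split => //=; rewrite ?muln_gt0 ?l0 //.
  + by rewrite oddM negb_and (wf_even wf).
  + exact: FK.
  + exact: FK.
  + exact: leq_ltn_trans (leq0n _) hh'.
  + move=> i; case: (ltnP i (lsize l * m)) => hi; last first.
      by elim: (2 * h') => //= n ->; rewrite F_out.
    by rewrite -[i]/(val (Ordinal hi)) -[Ordinal hi]psiK F_iter hper.
  + move=> i hi; rewrite -[i]/(val (Ordinal hi)) -[Ordinal hi]psiK F_iter !lowE.
    by rewrite [LHS]hswap.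
- split; rewrite ?rE //=.
  rewrite (transfer (fun i => F s i %/ m != lfwd l (i %/ m))).
  move: close; rewrite cardU; apply: leq_trans; rewrite leq_mul2r; apply/orP; right.
  apply: eq_leq; apply: eq_card => u; rewrite !inE F_phi !phiE.
  by rewrite -val_eqE.
exists phi => //; split=> // u; by rewrite rE.
Qed.

Lemma refine_mixing (l : level) (C : nat) : wf_level l ->
  exists (l' : level) (t : nat), [/\ wf_level l', refines C l l' &
    forall z z', z < lsize l -> z' < lsize l ->
      #|[pred i : 'I_(lsize l') | (i %/ lratio l l' == z) &&
          (iter t (lfwd l') i %/ lratio l l' == z')]| * lsize l ^ 2 = lsize l'].
Proof.
move=> wf; have l0 : 0 < #|'I_(lsize l)| by rewrite card_ord (wf_size wf).
have [U [s [si [Phi [m [h' [t [ext mix]]]]]]]] := mixing_extension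
  (restrictK wf) (restrict_invK wf) (wf_half wf) (half_turn_restrict wf) l0 C.
have [l' [wf' ref [phi bij [phiE phi_iter]]]] := level_of_extension ext.
exists l', t; split=> // z z' hz hz'.
have := mix (Ordinal hz) (Ordinal hz'); rewrite card_ord (bij_eq_card bij) card_ord => e.
apply: etrans e; congr (_ * _); rewrite -!sum1_card [LHS](reindex phi) /=; last exact: onW_bij.
by apply: eq_bigl => u; rewrite !inE phi_iter !phiE.
Qed.

Lemma refine_swapping (l : level) (C r : nat) (p : {poly int}) :
  (p.[0] = 0)%R -> 1 < (size p).-1 -> wf_level l ->
  exists (l' : level) (n : nat -> nat), [/\ wf_level l', refines C l l',
      forall i, i < r -> 0 < n i,
      forall i j, i < j -> j < r -> n i < n j &
    forall (F : nat -> bool) i, i < r -> F i ->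
      #|[pred i : 'I_(lsize l') | (2 * i < lsize l') &&
          (2 * iter `|p.[(subsum r n F)%:Z]%R| (lfwd l') i < lsize l')]| * 32 <= 5 * lsize l'].
Proof.
move=> p0 sp wf.
have [U [s [si [Phi [m [h' [n [ext n0 nlt sw]]]]]]]] := swapping_extension
  (restrictK wf) (restrict_invK wf) (wf_half wf) (half_turn_restrict wf) p0 sp r C.
have [l' [wf' ref [phi bij [phiE phi_iter]]]] := level_of_extension ext.
exists l', n; split=> // F i ir Fi; have := sw F i ir Fi.
rewrite (bij_eq_card bij) card_ord; apply: leq_trans; rewrite leq_mul2r; apply/orP; right.
rewrite -!sum1_card (reindex phi) /=; last exact: onW_bij.
rewrite eq_leq //; apply: eq_bigl => u; rewrite !inE phi_iter.
have E v : (2 * phi v < lsize l') = low_half (Phi v).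
  have r0 : 0 < lratio l l'.
    by have := wf_size wf'; rewrite (refines_size ref) muln_gt0 => /andP[].
  by rewrite /low_half -phiE -(low_half_divn _ r0 (wf_even wf)) -(refines_size ref).
by rewrite !E.
Qed.

From mathcomp Require Import complex.
From mathcomp Require Import all_classical all_reals all_analysis.
From mathcomp Require Import measurable_realfun.
Import numFieldNormedType.Exports.

Local Open Scope classical_set_scope.
Local Open Scope ring_scope.

Lemma dependent_sequence (T : Type) (P : T -> Prop) (Rel : nat -> T -> T -> Prop) (x0 : T) :
  P x0 -> (forall k x, P x -> exists y, P y /\ Rel k x y) ->
  exists u : nat -> T, forall k, P (u k) /\ Rel k (u k) (u k.+1).
Proof.
move=> Px0 H; pose S := {x : T | P x}.
have [g Hg] : {g : nat -> S -> S | forall k s, Rel k (sval s) (sval (g k s))}.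
  have G k (s : S) : {s' : S | Rel k (sval s) (sval s')}.
    by apply: cid; case: s => x Px /=; have [y [Py Ry]] := H k x Px; exists (exist _ y Py).
  by exists (fun k s => sval (G k s)) => k s; exact: svalP (G k s).
pose v := fix v n := if n is m.+1 then g m (v m) else exist P x0 Px0.
by exists (fun n => sval (v n)) => k; split; [exact: svalP (v k)|exact: Hg].
Qed.

(** The coarse positions at times 0 and [t] are exactly independent and uniform for the uniform
    measure of the finer level. *)
Definition mixes (l l' : level) (t : nat) : Prop :=
  forall z z', (z < lsize l)%N -> (z' < lsize l)%N ->
    (#|[pred i : 'I_(lsize l') | (i %/ lratio l l' == z)%N &&
       (iter t (lfwd l') i %/ lratio l l' == z')%N]| * lsize l ^ 2 = lsize l')%N.

Definition swaps (p : {poly int}) (l' : level) (B r : nat) (n : nat -> nat) : Prop :=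
  [/\ forall i, (i < r)%N -> (0 < n i)%N,
      forall i j, (i < j)%N -> (j < r)%N -> (n i < n j)%N &
      forall (F : nat -> bool) i, (i < r)%N -> F i ->
        (`|p.[(subsum r n F)%:Z]| <= B)%N /\
        (#|[pred i : 'I_(lsize l') | (2 * i < lsize l')%N &&
          (2 * iter `|p.[(subsum r n F)%:Z]|%N (lfwd l') i < lsize l')%N]| * 32
            <= 5 * lsize l')%N].

(* [H k] bounds the times at which the level [k] is observed; the next levels
   are close to it on the scale [H k]. *)
Record tower (p : {poly int}) (L : nat -> level) (H : nat -> nat) : Prop := {
  tower_wf : forall k, wf_level (L k) ;
  tower_refines : forall k, refines (H k * 2 ^ k.+1) (L k) (L k.+1) ;
  tower_period : forall k, (2 * lhalf (L k) <= H k)%N ;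
  tower_nondecr : forall k, (H k <= H k.+1)%N ;
  tower_mixes : forall k, odd k -> exists2 t, (t <= H k.+1)%N & mixes (L k) (L k.+1) t ;
  tower_swaps : forall k, ~~ odd k -> exists n, swaps p (L k.+1) (H k.+1) k n }.

Lemma exists_tower (p : {poly int}) : p.[0] = 0 -> (1 < (size p).-1)%N ->
  exists (L : nat -> level) (H : nat -> nat), tower p L H.
Proof.
move=> p0 sp.
pose P (x : level * nat) := wf_level x.1 /\ (2 * lhalf x.1 <= x.2)%N.
pose Rel k (x y : level * nat) := [/\ refines (x.2 * 2 ^ k.+1) x.1 y.1, (x.2 <= y.2)%N,
  odd k -> exists2 t, (t <= y.2)%N & mixes x.1 y.1 t &
  ~~ odd k -> exists n, swaps p y.1 y.2 k n].
pose swap2 i := if i == 0%N then 1%N else if i == 1%N then 0%N else i.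
have swap2K : cancel swap2 swap2 by case=> [|[]].
(* The tower starts from the swap of two points, of half period 1. *)
have P0 : P (Level 2 swap2 swap2 1, 2%N).
  split => //; split => //=; try exact: swap2K.
  - by case=> [|[]].
  - by case=> [|[]].
have step k x : P x -> exists y, P y /\ Rel k x y.
  case: x => l B [/= wf hB]; case: (boolP (odd k)) => ok.
    have [l' [t [wf' ref mix]]] := refine_mixing (B * 2 ^ k.+1) wf.
    (* The bound attached to the new level is fixed once its times are known; the next extension is
       then made accurate on that scale. *)
    exists (l', maxn B (maxn (2 * lhalf l') t)); split.
      by split=> //=; rewrite !leq_max leqnn orbT.
    split => //=; rewrite ?leq_maxl // ?ok // => _.
    by exists t => //; rewrite !leq_max leqnn !orbT.
  have [l' [n [wf' ref n0 nlt sw]]] := refine_swapping (B * 2 ^ k.+1) k p0 sp wf.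
  pose S := (\sum_(i < k) n i)%N.
  pose b := (\sum_(m < S.+1) `|p.[m%:Z]|)%N.
  exists (l', maxn B (maxn (2 * lhalf l') b)); split.
    by split=> //=; rewrite !leq_max leqnn orbT.
  split => //=; rewrite ?leq_maxl // ?(negbTE ok) // => _.
  exists n; split => // F i ir Fi; split; last exact: sw Fi.
  rewrite !leq_max; apply/orP; right; apply/orP; right.
  have mS : (subsum k n F < S.+1)%N by rewrite ltnS; exact: subsum_le.
  by rewrite /b (bigD1 (Ordinal mS)) //= leq_addr.
have [u Hu] := dependent_sequence P0 step.
exists (fun k => (u k).1), (fun k => (u k).2); split => k;
  by have [[? ?] []] := Hu k.
Qed.

(** * The space of digit sequences *)

Section ProbabilityCalculus.
Context {d : measure_display} {X : measurableType d} {R : realType}.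
Variable mu : probability X R.

Definition pr (A : set X) : R := fine (mu A).

Lemma prE A : measurable A -> mu A = (pr A)%:E.
Proof. by move=> mA; rewrite /pr fineK // fin_num_measure. Qed.

Lemma pr_ge0 A : 0 <= pr A.
Proof. by rewrite /pr fine_ge0. Qed.

Lemma pr_setT : pr setT = 1.
Proof. by rewrite /pr probability_setT. Qed.

Lemma pr_set0 : pr set0 = 0.
Proof. by rewrite /pr measure0. Qed.

Lemma pr_le A B : measurable A -> measurable B -> A `<=` B -> pr A <= pr B.
Proof. by move=> mA mB AB; rewrite -lee_fin -!prE // le_measure ?inE. Qed.

Lemma pr_le1 A : measurable A -> pr A <= 1.
Proof. by move=> mA; rewrite -pr_setT; exact: pr_le. Qed.

Lemma pr_setC A : measurable A -> pr (~` A) = 1 - pr A.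
Proof. by move=> mA; rewrite {1}/pr probability_setC // prE. Qed.

Lemma pr_setU A B : measurable A -> measurable B -> pr (A `|` B) <= pr A + pr B.
Proof.
move=> mA mB; rewrite -lee_fin EFinD -!prE //; last exact: measurableU.
exact: measureU2.
Qed.

Lemma pr_setU_disj A B : measurable A -> measurable B -> A `&` B = set0 ->
  pr (A `|` B) = pr A + pr B.
Proof. by move=> mA mB AB; rewrite {1}/pr measureU // fineD ?fin_num_measure. Qed.

Lemma pr_split A B : measurable A -> measurable B ->
  pr A = pr (A `&` B) + pr (A `&` ~` B).
Proof.
move=> mA mB; rewrite -pr_setU_disj; [|exact: measurableI|apply: measurableI|].
- by rewrite -setIUr setUCr setIT.
- by [].
- exact: measurableC.
- by rewrite setIACA setICr setI0.
Qed.

Lemma pr_close A B E : measurable A -> measurable B -> measurable E ->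
  (forall x, ~ E x -> A x -> B x) -> pr A <= pr B + pr E.
Proof.
move=> mA mB mE H; apply: le_trans (pr_setU mB mE).
apply: pr_le => //; first exact: measurableU.
by move=> x Ax; case: (pselect (E x)) => [|nEx]; [right|left; apply: H].
Qed.

Lemma pr_bigcup (A : nat -> set X) (e : R) : (forall i, measurable (A i)) -> 0 <= e ->
  (forall i, pr (A i) <= e / (2 ^ i.+1)%:R) -> pr (\bigcup_i A i) <= e.
Proof.
move=> mA e0 H; have mU : measurable (\bigcup_i A i) by exact: bigcupT_measurable.
rewrite -lee_fin -prE //; apply: le_trans (epsilon_trick0 xpredT e0).
have /(_ (\bigcup_i A i) A mA mU) := @measure_sigma_subadditive _ _ _ mu.
move=> /(_ (@subset_refl _ _)) /le_trans; apply.
apply: lee_nneseries => [i _ _|i _]; first exact: measure_ge0.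
by have := H i; rewrite -lee_fin -(prE (mA i)).
Qed.

Lemma pr_bigcup0 (A : nat -> set X) : (forall i, measurable (A i)) ->
  (forall i, pr (A i) = 0) -> pr (\bigcup_i A i) = 0.
Proof.
move=> mA A0; apply/eqP; rewrite eq_le pr_ge0 andbT.
by apply: pr_bigcup => // i; rewrite A0 mul0r.
Qed.

End ProbabilityCalculus.

Definition cylinder (k : nat) (a : nat -> nat) : set (nat -> nat) :=
  [set x | forall j, (j <= k)%N -> x j = a j].

(** Two cylinders may be disjoint: [set0] makes the family closed under intersection. *)
Definition cylinders : set (set (nat -> nat)) :=
  [set B | B = set0 \/ exists k a, B = cylinder k a].

Lemma cylinders_setI : setI_closed cylinders.
Proof.
move=> A B [->|[k [a ->]]]; first by rewrite set0I; left.
case=> [->|[l [b ->]]]; first by rewrite setI0; left.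
wlog kl : k l a b / (k <= l)%N.
  move=> H; have [/H|/ltnW/H] := leqP k l; first exact.
  by rewrite setIC; apply.
case: (pselect (forall j, (j <= k)%N -> a j = b j)) => ab.
  right; exists l, b; rewrite setIidr // => x xb j jk.
  by rewrite xb ?ab // (leq_trans jk).
left; apply/seteqP; split => // x [xa xb]; apply: ab => j jk.
by rewrite -xa // xb // (leq_trans jk).
Qed.

Notation seqspace := (g_sigma_algebraType cylinders).

(** Such a set is a union of cylinders indexed by the countably many prefixes, coded by [pickle]. *)
Lemma measurable_finite_dim (k : nat) (B : set seqspace) :
  (forall x y : nat -> nat, (forall j, (j <= k)%N -> x j = y j) -> B x -> B y) ->
  measurable B.
Proof.
move=> HB; have -> : B = \bigcup_n (B `&` [set x : nat -> nat | pickle (mkseq x k.+1) = n]).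
  by apply/seteqP; split=> [x Bx|x [n _ []]] //; exists (pickle (mkseq x k.+1)).
apply: bigcupT_measurable => n; apply: sub_sigma_algebra.
case: (pselect (exists x, (B `&` [set x : nat -> nat | pickle (mkseq x k.+1) = n]) x)); last first.
  by move=> H; left; apply/seteqP; split=> // x Hx; apply: H; exists x.
move=> [x [Bx /= xn]]; right; exists k, x.
have eqk (y z : nat -> nat) : mkseq y k.+1 = mkseq z k.+1 <-> forall j, (j <= k)%N -> y j = z j.
  split=> [yz j jk|yz]; first by rewrite -(nth_mkseq 0%N y (_ : (j < k.+1)%N)) // yz nth_mkseq.
  by apply/eq_in_map => j; rewrite mem_iota add0n => /andP[_ jk]; exact: yz.
apply/seteqP; split=> y.
  by move=> [By /= yn]; apply/eqk/(pcan_inj pickleK); rewrite yn xn.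
move=> yx; split=> /=; first by apply: HB Bx => j jk; rewrite yx.
by rewrite -xn; congr pickle; apply/eqk.
Qed.

Lemma measurable_coord (k : nat) (P : set nat) :
  measurable ([set x | P (x k)] : set seqspace).
Proof. by apply: (@measurable_finite_dim k) => x y xy /=; rewrite xy. Qed.

Lemma measurable_to_seqspace d (X : measurableType d) (g : X -> seqspace) :
  (forall j v, measurable [set x | g x j = v]) -> measurable_fun setT g.
Proof.
move=> Hg; have mS := @measurability _ _ X seqspace setT g cylinders erefl; apply: mS.
move=> _ [_ [->|[k [a ->]]] <-]; first by rewrite preimage_set0 setI0.
rewrite setTI (_ : _ @^-1` _ = \bigcap_(j in `I_k.+1) [set x | g x j = a j]).
  by apply: fin_bigcap_measurable => //; exact: finite_II.
by apply/seteqP; split=> x H j; [move=> jk; apply: H|move=> jk; apply: H => /=].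
Qed.

Section Odometer.
Context {R : realType}.
Variable Q : nat -> nat.
Hypothesis Q0 : forall k, (0 < Q k)%N.
Hypothesis Qdvd : forall k, (Q k %| Q k.+1)%N.

(* [t] in [0, 1) is coded by its position among the intervals [i / Q k, (i + 1) / Q k). *)
Definition digits (t : measurableTypeR R) : seqspace := fun k => Num.truncn ((Q k)%:R * (t : R)).

Lemma truncn_mulVn (m : nat) (y : R) : (0 < m)%N ->
  (Num.truncn (m%:R * y) %/ m)%N = Num.truncn y.
Proof.
move=> m0; have mR : 0 < (m%:R : R) by rewrite ltr0n.
have [y0|y0] := leP 0 y; last first.
  rewrite !(@truncn_floor _ _) !leNgt pmulr_rlt0 // y0 /=; exact: div0n.
apply/esym/truncn_def; set n := Num.truncn _.
have /andP[h1 h2] : n%:R <= m%:R * y < n.+1%:R by apply: truncn_itv; rewrite mulr_ge0 // ltW.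
apply/andP; split.
  rewrite -(ler_pM2l mR); apply: le_trans h1; rewrite -natrM ler_nat mulnC.
  exact: leq_trunc_div.
rewrite -(ltr_pM2l mR); apply: lt_le_trans h2 _; rewrite -natrM ler_nat.
by rewrite mulnC ltn_ceil.
Qed.

(** The inverse limit of the levels, taken as a set of full measure among all sequences rather than
    as a type of its own. *)
Definition compatible : set seqspace :=
  [set x | forall k, x k = (x k.+1 %/ (Q k.+1 %/ Q k))%N].

Lemma digits_compatible t : compatible (digits t).
Proof.
move=> k; rewrite /digits -[X in (Num.truncn X %/ _)%N](_ : (Q k.+1 %/ Q k)%N%:R * ((Q k)%:R * t) = _).
  by rewrite truncn_mulVn // divn_gt0 // dvdn_leq.
by rewrite mulrA -natrM divnK.
Qed.

Lemma measurable_digits : measurable_fun [set: measurableTypeR R] digits.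
Proof.
apply: measurable_to_seqspace => j v.
have Qj : 0 < ((Q j)%:R : R) by rewrite ltr0n.
(* Truncation sends negative numbers to 0, hence the half-line when [v] is 0. *)
have -> : [set x : R | digits x j = v] =
    `[v%:R / (Q j)%:R, v.+1%:R / (Q j)%:R[%classic `|`
     (if v == 0%N then `]-oo, 0[%classic else set0).
  apply/seteqP; split=> x /=.
    have [x0 <-|x0] := leP 0 x.
      left; rewrite in_itv /= ler_pdivrMr // ltr_pdivlMr // ![x * _]mulrC.
      by apply: truncn_itv; rewrite mulr_ge0 // ltW.
    rewrite /digits truncn_floor leNgt pmulr_rlt0 // x0 /= => <-; right.
    by rewrite eqxx /= in_itv.
  case; rewrite ?in_itv /= => H.
    by apply: truncn_def; move: H; rewrite ler_pdivrMr // ltr_pdivlMr // ![x * _]mulrC.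
  move: H; case: eqP => // -> /=; rewrite in_itv /= => x0.
  by rewrite /digits truncn_floor leNgt pmulr_rlt0 // x0.
by apply: measurableU => //; case: ifP.
Qed.

HB.instance Definition _ :=
  @isMeasurableFun.Build _ _ (measurableTypeR R) seqspace digits measurable_digits.

(** Transporting Lebesgue measure on [0, 1] makes every coordinate uniform and puts full mass on
    compatible sequences. *)
Definition odometer_measure : probability seqspace R :=
  distribution (uniform_prob (@ltr01 R)) digits.

Local Notation mu := odometer_measure.

Lemma measurable_compatible : measurable compatible.
Proof.
rewrite (_ : compatible = \bigcap_k [set x : seqspace | x k = (x k.+1 %/ (Q k.+1 %/ Q k))%N]).
  apply: bigcapT_measurable => k; apply: (@measurable_finite_dim k.+1) => x y xy /=.
  by rewrite -!xy.
by apply/seteqP; split=> x H k; have := H k; [move=> h _|apply].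
Qed.

Lemma pr_compatible : pr mu (~` compatible) = 0.
Proof.
rewrite /pr /= /distribution /pushforward (_ : _ @^-1` _ = set0) ?measure0 //.
by apply/seteqP; split=> t // /(_ (digits_compatible t)).
Qed.

Lemma pr_coord_eq k i : (i < Q k)%N -> pr mu [set x | x k = i] = (Q k)%:R^-1.
Proof.
move=> iQ; have Qk : 0 < ((Q k)%:R : R) by rewrite ltr0n.
rewrite /pr /= /distribution /pushforward /uniform_prob integral_uniform_pdf.
have -> : digits @^-1` [set x | x k = i] `&` `[0, 1]%classic =
    `[i%:R / (Q k)%:R, i.+1%:R / (Q k)%:R[%classic.
  apply/seteqP; split=> x /=; rewrite !in_itv /=.
    move=> [<- /andP[x0 _]]; rewrite ler_pdivrMr // ltr_pdivlMr // ![x * _]mulrC.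
    by apply: truncn_itv; rewrite mulr_ge0 // ltW.
  move=> /andP[h1 h2]; split.
    by apply: truncn_def; rewrite -ler_pdivrMl // -ltr_pdivlMl // ![_^-1 * _]mulrC h1.
  rewrite (le_trans _ h1) ?divr_ge0 //=; apply: le_trans (ltW h2) _.
  by rewrite ler_pdivrMr // mul1r ler_nat.
rewrite (eq_integral (cst 1%:E)); last first.
  move=> x; rewrite inE /= in_itv /= => /andP[h1 h2]; rewrite /uniform_pdf.
  rewrite (le_trans _ h1) ?divr_ge0 //= (le_trans (ltW h2)) ?subr0 ?invr1 //.
  by rewrite ler_pdivrMr // mul1r ler_nat.
rewrite integral_cst //= mul1e lebesgue_measure_itv /= lte_fin ltr_pM2r ?invr_gt0 //.
by rewrite ltr_nat ltnSn /= -mulrBl -natrB ?subSnn ?mul1r.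
Qed.

Lemma pr_coord_sum k (P : pred nat) :
  pr mu [set x | P (x k) /\ (x k < Q k)%N] = #|[pred i : 'I_(Q k) | P i]|%:R / (Q k)%:R.
Proof.
pose F (i : nat) : set seqspace := [set x : seqspace | x k = i /\ P (x k)].
have mF i : measurable (F i) by apply: (@measurable_coord k [set v | v = i /\ P v]).
have -> : [set x : seqspace | P (x k) /\ (x k < Q k)%N] = \big[setU/set0]_(i < Q k) F i.
  apply/seteqP; split=> x; rewrite -bigcup_mkord.
    by move=> [Px xQ]; exists (x k).
  by move=> [i /= iQ [xi Pi]]; split=> //; rewrite xi.
rewrite /pr measure_bigsetU //; last first.
  apply/trivIsetP => i j _ _ ij; apply/seteqP; split=> // x [[xi _] [xj _]].
  by move/eqP: ij; apply; rewrite -xi -xj.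
rewrite (eq_bigr (fun i : 'I_(Q k) => ((P i)%:R / (Q k)%:R)%:E)).
  rewrite sumEFin /= -mulr_suml -natr_sum; congr (_%:R / _).
  by rewrite -sum1_card [RHS]big_mkcond; apply: eq_bigr => i _; rewrite inE; case: (P i).
move=> i _; case: (boolP (P i)) => Pi.
  rewrite mul1r -(pr_coord_eq (ltn_ord i)) -prE; last exact: (@measurable_coord k [set nat_of_ord i]).
  by congr (mu _); apply/seteqP; split=> x /=; [case|move=> xi; rewrite /F /= xi].
by rewrite mul0r (_ : F i = set0) ?measure0 //; apply/seteqP; split=> // x [-> ]; rewrite (negbTE Pi).
Qed.

Lemma pr_coord_bound k : pr mu [set x | ~ (x k < Q k)%N] = 0.
Proof.
have m : measurable ([set x | (x k < Q k)%N] : set seqspace).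
  exact: (@measurable_coord k [set v | (v < Q k)%N]).
rewrite (_ : [set x | _] = ~` [set x : seqspace | (x k < Q k)%N]) // pr_setC //.
have := @pr_coord_sum k xpredT.
rewrite (_ : [set x | _] = [set x | (x k < Q k)%N]); last first.
  by apply/seteqP; split=> x /= => [[]|].
move=> ->; rewrite (_ : #|_| = Q k); last by rewrite -[RHS]card_ord; apply: eq_card.
by rewrite divff ?subrr // pnatr_eq0 -lt0n.
Qed.

Lemma pr_coord k (P : pred nat) :
  pr mu [set x | P (x k)] = #|[pred i : 'I_(Q k) | P i]|%:R / (Q k)%:R.
Proof.
have m1 : measurable ([set x | (x k < Q k)%N] : set seqspace).
  exact: (@measurable_coord k [set v | (v < Q k)%N]).
have m2 : measurable ([set x | P (x k)] : set seqspace).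
  exact: (@measurable_coord k [set v | P v]).
rewrite (pr_split mu m2 m1) -pr_coord_sum.
have -> : pr mu ([set x | P (x k)] `&` ~` [set x | (x k < Q k)%N]) = 0; last by rewrite addr0.
apply/eqP; rewrite eq_le pr_ge0 andbT -(pr_coord_bound k); apply: pr_le.
- exact: measurableI (measurableC m1).
- exact: measurableC.
- by move=> x [].
Qed.

End Odometer.

(** * The limit transformation *)

Lemma le_of_geometric (R : realType) (x y : R) (k : nat) :
  (forall l, (k <= l)%N -> x <= y + (2 ^ l)%:R^-1) -> x <= y.
Proof.
move=> H; apply/ler_addgt0Pr => e e0.
have e'0 : 0 < e^-1 by rewrite invr_gt0.
have [N HN] : exists N, (e^-1 <= N%:R).
  by exists (Num.bound e^-1); apply/ltW/archi_boundP/ltW.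
apply: le_trans (H (maxn k N) (leq_maxl _ _)) _; rewrite lerD2l.
rewrite -[e]invrK lef_pV2 ?posrE ?invr_gt0 ?ltr0n ?expn_gt0 //.
apply: le_trans HN _; rewrite ler_nat.
by apply: leq_trans (leq_maxr k N) _; apply/ltnW/ltn_expl.
Qed.

Section LimitMap.
Context {R : realType}.
Variable Q : nat -> nat.
Hypothesis Q0 : forall k, (0 < Q k)%N.
Hypothesis Qdvd : forall k, (Q k %| Q k.+1)%N.
Local Notation mu := (odometer_measure (R := R) Q0).

Definition level_proj (j k i : nat) : nat := (i %/ (Q k %/ Q j))%N.

Lemma Qdvd_le j k : (j <= k)%N -> (Q j %| Q k)%N.
Proof.
move=> /subnKC <-; elim: (k - j)%N => [|n IH]; first by rewrite addn0.
by rewrite addnS (dvdn_trans IH).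
Qed.

Lemma level_proj_id k i : level_proj k k i = i.
Proof. by rewrite /level_proj divnn Q0 divn1. Qed.

Lemma level_projS j k i : (j <= k)%N -> level_proj j k.+1 i = level_proj j k (i %/ (Q k.+1 %/ Q k)).
Proof.
move=> jk; rewrite /level_proj -divnMA; congr (_ %/ _)%N.
by rewrite -[in LHS](divnK (Qdvd k)) muln_divA ?Qdvd_le.
Qed.

Lemma compatible_proj (x : seqspace) j k : compatible Q x -> (j <= k)%N ->
  x j = level_proj j k (x k).
Proof.
move=> cx /subnKC <-; elim: (k - j)%N => [|n IH]; first by rewrite addn0 level_proj_id.
by rewrite addnS level_projS ?leq_addr // -cx.
Qed.

Lemma cylinder_levelP (x : seqspace) k l a : compatible Q x -> (k <= l)%N ->
  cylinder k a x <-> [forall j : 'I_k.+1, level_proj j l (x l) == a j].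
Proof.
move=> cx kl; split=> [xa|/forallP Pl j jk].
  apply/forallP => j; have jk : (j <= k)%N by rewrite -ltnS.
  by rewrite -(compatible_proj cx) ?(leq_trans jk) // xa.
have /eqP <- := Pl (Ordinal (jk : (j < k.+1)%N)).
by rewrite -(compatible_proj cx) // (leq_trans jk).
Qed.

(* The eventual value of [u], or [0] when [u] is not eventually constant. *)
Definition limseq (u : nat -> nat) : nat :=
  xget 0%N [set v | exists K, forall k, (K <= k)%N -> u k = v].

Lemma limseqE u v K : (forall k, (K <= k)%N -> u k = v) -> limseq u = v.
Proof.
move=> Hv; rewrite /limseq; case: xgetP => [w _ [K' Hw]|H].
  by rewrite -(Hv (maxn K K')) ?leq_maxl // Hw ?leq_maxr.
by exfalso; apply: (H v); exists K.
Qed.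

Lemma measurable_limseq d (X : measurableType d) (u : X -> nat -> nat) (v : nat) :
  (forall k w, measurable [set x | u x k = w]) -> measurable [set x | limseq (u x) = v].
Proof.
move=> Hu; pose C w := \bigcup_K \bigcap_(k in [set k | (K <= k)%N]) [set x | u x k = w].
have mC w : measurable (C w).
  by apply: bigcupT_measurable => K; by apply: bigcap_measurableType => k _; exact: Hu.
have CE x w : C w x <-> exists K, forall k, (K <= k)%N -> u x k = w.
  by split=> [[K _ H]|[K H]]; exists K.
(* Sequences that are not eventually constant take the default value 0. *)
have -> : [set x | limseq (u x) = v] = C v `|` (if v == 0%N then ~` (\bigcup_w C w) else set0).
  apply/seteqP; split=> x /=.
    case: (pselect (exists w, C w x)) => [[w Cw] |nC xv].
      have [K HK] := (CE x w).1 Cw.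
      by rewrite (limseqE HK) => <-; left.
    right; have -> : v = 0%N.
      rewrite -xv /limseq; case: xgetP => // w _ Hw.
      by exfalso; apply: nC; exists w; apply/CE.
    by rewrite eqxx => -[w _ Cw]; apply: nC; exists w.
  case=> [/CE[K HK]|]; first exact: (limseqE HK).
  case: eqP => // -> nC; rewrite /limseq; case: xgetP => // w _ Hw.
  by exfalso; apply: nC; exists w => //; apply/CE.
apply: measurableU => //; case: ifP => // _.
by apply: measurableC; apply: bigcupT_measurable.
Qed.

Variables (f g : nat -> nat -> nat) (H : nat -> nat).
Hypothesis fK : forall k, cancel (f k) (g k).
Hypothesis f_bound : forall k i, (f k i < Q k)%N = (i < Q k)%N.
Hypothesis H0 : forall k, (0 < H k)%N.
Hypothesis H_nondecr : forall k, (H k <= H k.+1)%N.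
Hypothesis f_close : forall k, (#|[pred i : 'I_(Q k.+1) |
  (f k.+1 i %/ (Q k.+1 %/ Q k))%N != f k (i %/ (Q k.+1 %/ Q k))%N]| * (H k * 2 ^ k.+1)
    <= Q k.+1)%N.

(** The positions [f k (x k)] need not be compatible with one another; their projections to level
    [j] stabilise for almost every [x], because the commutation errors are summable. *)
Definition limmap (x : seqspace) : seqspace := fun j => limseq (fun k => level_proj j k (f k (x k))).

Lemma measurable_limmap : measurable_fun setT limmap.
Proof.
apply: measurable_to_seqspace => j v; apply: measurable_limseq => k w.
exact: (@measurable_coord k [set i | level_proj j k (f k i) = w]).
Qed.

(** How badly level [k] may misjudge one step of the limit; the factor [H k] leaves an error
    [1 / 2 ^ k] after [H k] steps. *)
Definition defect (k : nat) : R := (H k * 2 ^ k)%:R^-1.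

Lemma defect_le k : defect k <= (2 ^ k)%:R^-1.
Proof.
by rewrite lef_pV2 ?posrE ?ltr0n ?muln_gt0 ?H0 ?expn_gt0 // ler_nat leq_pmull.
Qed.

Definition bad_step (k : nat) : set seqspace := [set x |
  (f k.+1 (x k.+1) %/ (Q k.+1 %/ Q k))%N != f k (x k.+1 %/ (Q k.+1 %/ Q k))%N].

Definition bad_from (k : nat) : set seqspace := \bigcup_i bad_step (k + i).

Lemma measurable_bad_step k : measurable (bad_step k).
Proof.
exact: (@measurable_coord k.+1 [set i |
  (f k.+1 i %/ (Q k.+1 %/ Q k))%N != f k (i %/ (Q k.+1 %/ Q k))%N]).
Qed.

Lemma measurable_bad_from k : measurable (bad_from k).
Proof. by apply: bigcupT_measurable => i; exact: measurable_bad_step. Qed.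

Lemma H_le k i : (H k <= H (k + i))%N.
Proof. by elim: i => [|i IH]; rewrite ?addn0 // addnS (leq_trans IH). Qed.

(** Step [k + i] fails with probability at most [1 / (H (k + i) * 2 ^ (k + i + 1))], and [H] is
    nondecreasing: the sum is geometric. *)
Lemma pr_bad_from k : pr mu (bad_from k) <= defect k.
Proof.
have Hk2 n i : 0 < ((H n * 2 ^ i)%N%:R : R) by rewrite ltr0n muln_gt0 H0 expn_gt0.
apply: pr_bigcup => [i||i]; first exact: measurable_bad_step.
  by rewrite /defect invr_ge0.
have := @pr_coord R Q Q0 (k + i).+1 [pred j |
  (f (k + i).+1 j %/ (Q (k + i).+1 %/ Q (k + i)))%N != f (k + i) (j %/ (Q (k + i).+1 %/ Q (k + i)))%N].
rewrite /bad_step => ->.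
have QR : 0 < ((Q (k + i).+1)%:R : R) by rewrite ltr0n.
rewrite ler_pdivrMr // /defect -invfM -natrM.
have p0 : 0 < ((H k * 2 ^ k * 2 ^ i.+1)%N%:R : R) by rewrite ltr0n !muln_gt0 H0 !expn_gt0.
rewrite ler_pdivlMl // -natrM ler_nat; apply: leq_trans (f_close (k + i)).
rewrite mulnC leq_mul2l; apply/orP; right.
by rewrite -mulnA -expnD addnS leq_mul2r H_le orbT.
Qed.

Lemma limmap_good (x : seqspace) j k : compatible Q x -> ~ bad_from k x -> (j <= k)%N ->
  limmap x j = level_proj j k (f k (x k)).
Proof.
move=> cx nb jk; apply: (@limseqE _ _ k) => l /subnKC <-.
elim: (l - k)%N => [|n IH]; first by rewrite addn0.
rewrite addnS level_projS ?(leq_trans jk) ?leq_addr // -IH; congr level_proj.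
have : ~ bad_step (k + n) x by move=> b; apply: nb; exists n.
by rewrite /bad_step /= => /negP; rewrite negbK => /eqP ->; rewrite -cx.
Qed.

Lemma pr_bad k : pr mu (bad_from k `|` ~` compatible Q) <= defect k.
Proof.
apply: le_trans (pr_setU _ (measurable_bad_from k) _) _.
  by apply: measurableC; exact: measurable_compatible.
by rewrite (pr_compatible Q0 Qdvd) addr0; exact: pr_bad_from.
Qed.

Lemma measurable_bad k : measurable (bad_from k `|` ~` compatible Q).
Proof.
apply: measurableU; first exact: measurable_bad_from.
by apply: measurableC; exact: measurable_compatible.
Qed.

Lemma limmap_level k : exists E : set seqspace,
  [/\ measurable E, pr mu E <= defect k &
      forall x, ~ E x -> forall j, (j <= k)%N -> limmap x j = level_proj j k (f k (x k))].
Proof.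
exists (bad_from k `|` ~` compatible Q); split.
- exact: measurable_bad.
- exact: pr_bad.
move=> x /not_orP[nb /contrapT cx] j jk; exact: limmap_good.
Qed.

(** On a cylinder the limit agrees, up to [defect H l], with the permutation of any fine level [l],
    which preserves uniform measure; letting [l] grow gives equality. Cylinders are closed under
    intersection, so they determine the image measure. *)
Lemma limmap_preserves (A : set seqspace) : measurable A ->
  pr mu (limmap @^-1` A) = pr mu A.
Proof.
have mpre (B : set seqspace) : measurable B -> measurable (limmap @^-1` B).
  by move=> mB; rewrite -[X in measurable X]setTI; exact: measurable_limmap.
have main (B : set seqspace) : cylinders B -> pr mu (limmap @^-1` B) = pr mu B.
  move=> [->|[k [a ->]]]; first by rewrite preimage_set0.
  have mC : measurable (cylinder k a : set seqspace).
    by apply: sub_sigma_algebra; right; exists k, a.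
  pose P l i := [forall j : 'I_k.+1, level_proj j l i == a j].
  have PE l (x : seqspace) : compatible Q x -> (k <= l)%N -> cylinder k a x <-> P l (x l).
    exact: cylinder_levelP.
  have prC l : (k <= l)%N -> pr mu (cylinder k a) = pr mu [set x : seqspace | P l (x l)].
    have mP : measurable ([set x : seqspace | P l (x l)]).
      exact: (@measurable_coord l [set i | P l i]).
    have mcc : measurable (~` compatible Q) by apply: measurableC; exact: measurable_compatible.
    move=> kl; apply/eqP; rewrite eq_le -[X in _ <= X]addr0 -[X in _ && (_ <= X)]addr0.
    rewrite -(pr_compatible (R := R) Q0 Qdvd); apply/andP; split; apply: pr_close => //.
      by move=> x /contrapT cx /(PE _ _ cx kl).
    by move=> x /contrapT cx /(PE _ _ cx kl).
  have prS l : (k <= l)%N -> pr mu [set x : seqspace | P l (f l (x l))] = pr mu (cylinder k a).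
    move=> kl; rewrite (prC l) // !(@pr_coord R Q Q0 _ (P l)).
    rewrite (@pr_coord R Q Q0 _ (fun i => P l (f l i))); congr (_%:R / _).
    pose F (i : 'I_(Q l)) : 'I_(Q l) := Ordinal (etrans (f_bound l i) (ltn_ord i)).
    have F_inj : injective F.
      by move=> i j [] /(can_inj (fK l)) /val_inj.
    rewrite -!sum1_card [RHS](reindex F) //=.
    by apply: onW_bij; exact: injF_bij.
  have Pgood l (x : seqspace) E : (forall x, ~ E x -> forall j, (j <= l)%N -> limmap x j = level_proj j l (f l (x l))) ->
     (k <= l)%N -> ~ E x -> cylinder k a (limmap x) <-> P l (f l (x l)).
    move=> good kl nE; split=> [xa|/forallP Pl j jk].
      apply/forallP => j; have jk : (j <= k)%N by rewrite -ltnS.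
      by rewrite -(good x) ?(leq_trans jk) // xa.
    have /eqP <- := Pl (Ordinal (jk : (j < k.+1)%N)).
    by rewrite -(good x) // (leq_trans jk).
  have mPf l : measurable ([set x : seqspace | P l (f l (x l))]).
    exact: (@measurable_coord l [set i | P l (f l i)]).
  apply/eqP; rewrite eq_le; apply/andP; split; apply: (@le_of_geometric _ _ _ k) => l kl;
    have [E [mE prE good]] := limmap_level l; rewrite -(prS l kl).
    apply: (@le_trans _ _ (pr mu [set x : seqspace | P l (f l (x l))] + pr mu E)).
      apply: pr_close => //; first exact: mpre.
      by move=> x nE /= /(Pgood l x E good kl nE).
    by rewrite lerD2l (le_trans prE) ?defect_le.
  apply: (@le_trans _ _ (pr mu (limmap @^-1` cylinder k a) + pr mu E)).
    apply: pr_close => //; first exact: mpre.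
    by move=> x nE /= /(Pgood l x E good kl nE).
  by rewrite lerD2l (le_trans prE) ?defect_le.
move=> mA; rewrite /pr; congr fine.
pose nu := distribution mu (mfun_Sub (mem_set measurable_limmap)).
rewrite -[LHS]/(nu A).
apply: (@g_sigma_algebra_measure_unique _ R seqspace cylinders _ (fun i => cylinder 0 (fun=> i)) _ _ nu mu) => //.
- by move=> B cB; exact: sub_sigma_algebra.
- by move=> i; right; exists 0%N, (fun=> i).
- by rewrite -subTset => x _; exists (x 0%N) => // j; rewrite leqn0 => /eqP ->.
- exact: cylinders_setI.
- move=> B cB; have mB : measurable (B : set seqspace) by exact: sub_sigma_algebra.
  have := prE mu (mpre _ mB); rewrite main // => e.
  exact: etrans e (esym (prE mu mB)).
- move=> k; have mk : measurable (cylinder 0 (fun=> k) : set seqspace).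
    by apply: sub_sigma_algebra; right; exists 0%N, (fun=> k).
  by apply: le_lt_trans (probability_le1 nu mk) _; rewrite ltry.
Qed.

End LimitMap.

(** Two maps inverse to each other almost everywhere become a true bijection and its inverse once
    both are replaced by the identity on a suitable null set. *)
Lemma exact_inverse d (X : measurableType d) (R : realType) (mu : probability X R)
    (S S' : X -> X) (E : set X) :
  measurable_fun setT S -> measurable_fun setT S' ->
  (forall A, measurable A -> pr mu (S @^-1` A) = pr mu A) ->
  (forall A, measurable A -> pr mu (S' @^-1` A) = pr mu A) ->
  measurable E -> pr mu (~` E) = 0 -> (forall x, E x -> S' (S x) = x /\ S (S' x) = x) ->
  exists T Tinv : X -> X, invertible_mps mu T Tinv /\
    exists N : set X, [/\ measurable N, pr mu N = 0 & forall x, ~ N x -> T x = S x].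
Proof.
move=> mS mS' pS pS' mE E0 HE.
have pre (F : X -> X) : measurable_fun setT F -> forall A, measurable A -> measurable (F @^-1` A).
  by move=> mF A mA; rewrite -[X in measurable X]setTI; exact: mF.
have iterm (F : X -> X) : measurable_fun setT F -> forall n, measurable_fun setT (iter n F).
  move=> mF; elim=> [|n IH]; first exact: measurable_id.
  exact: (measurableT_comp mF IH).
have iterp (F : X -> X) : measurable_fun setT F ->
    (forall A, measurable A -> pr mu (F @^-1` A) = pr mu A) ->
    forall n A, measurable A -> pr mu (iter n F @^-1` A) = pr mu A.
  move=> mF pF; elim=> // n IH A mA.
  by rewrite -[LHS]/(pr mu (iter n F @^-1` (F @^-1` A))) IH ?pF //; exact: pre.
(* All preimages of the complement of [E] are taken, so that [S] and [S'] map the complement of [N]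
   to itself. *)
pose N := \bigcup_n (iter n S @^-1` (~` E) `|` iter n S' @^-1` (~` E)).
have mC := measurableC mE.
have mNn n : measurable (iter n S @^-1` (~` E) `|` iter n S' @^-1` (~` E)).
  by apply: measurableU; apply: pre => //; exact: iterm.
have mN : measurable N by exact: bigcupT_measurable.
have N0 : pr mu N = 0.
  apply: pr_bigcup0 => // n; apply/eqP; rewrite eq_le pr_ge0 andbT.
  apply: le_trans (pr_setU _ _ _) _; try by apply: pre => //; exact: iterm.
  by rewrite !iterp // E0 addr0.
have NE x : ~ N x -> forall n, E (iter n S x) /\ E (iter n S' x).
  by move=> nN n; split; apply: contrapT => nE; apply: nN; exists n => //; [left|right].
have EN x : (forall n, E (iter n S x) /\ E (iter n S' x)) -> ~ N x.
  by move=> H [n _ []] h; have [] := H n.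
have NS x : ~ N x -> ~ N (S x).
  move=> nN; apply: EN => -[|n]; first by split; have [] := NE x nN 1%N.
  split; first by rewrite -iterSr; have [] := NE x nN n.+2.
  by rewrite iterSr (HE x (NE x nN 0%N).1).1; have [] := NE x nN n.
have NS' x : ~ N x -> ~ N (S' x).
  move=> nN; apply: EN => -[|n]; first by split; have [] := NE x nN 1%N.
  split; last by rewrite -iterSr; have [] := NE x nN n.+2.
  by rewrite iterSr (HE x (NE x nN 0%N).1).2; have [] := NE x nN n.
pose T x := if pselect (N x) then x else S x.
pose Tinv x := if pselect (N x) then x else S' x.
have TN x : N x -> T x = x by rewrite /T; case: pselect.
have TS x : ~ N x -> T x = S x by rewrite /T; case: pselect.
have TiN x : N x -> Tinv x = x by rewrite /Tinv; case: pselect.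
have TiS x : ~ N x -> Tinv x = S' x by rewrite /Tinv; case: pselect.
have mcut (F G : X -> X) : measurable_fun setT F -> (forall x, N x -> G x = x) ->
    (forall x, ~ N x -> G x = F x) -> measurable_fun setT G.
  move=> mF GN GF _ A mA; rewrite setTI.
  have -> : G @^-1` A = (N `&` A) `|` (~` N `&` (F @^-1` A)).
    apply/seteqP; split=> x /=.
      by case: (pselect (N x)) => Nx; [rewrite GN //; left|rewrite GF //; right].
    by case=> -[Nx]; [rewrite GN|rewrite GF].
  apply: measurableU; first exact: measurableI.
  by apply: measurableI; [exact: measurableC|exact: pre].
have mT := mcut _ _ mS TN TS.
exists T, Tinv; split; last by exists N.
split.
- move=> x; case: (pselect (N x)) => Nx; first by rewrite TN // TiN.
  have [e1 e2] := HE x (NE x Nx 0%N).1.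
  by rewrite TS // TiS ?e1 //; exact: NS.
- move=> x; case: (pselect (N x)) => Nx; first by rewrite TiN // TN.
  have [e1 e2] := HE x (NE x Nx 0%N).1.
  by rewrite TiS // TS ?e2 //; exact: NS'.
- exact: mT.
- exact: mcut mS' TiN TiS.
- move=> A mA; rewrite !prE //; last exact: pre.
  congr (_%:E); rewrite -(pS A) //; apply/eqP; rewrite eq_le.
  rewrite -[X in _ <= X]addr0 -[X in _ && (_ <= X)]addr0 -N0; apply/andP.
  have m1 := pre _ mT A mA; have m2 := pre _ mS A mA.
  by split; apply: pr_close => // x Nx /=; rewrite TS.
Qed.

Lemma pr_iter_preimage d (X : measurableType d) (R : realType) (mu : probability X R)
    (T : X -> X) : measurable_fun setT T ->
  (forall A, measurable A -> mu (T @^-1` A) = mu A) -> forall n A, measurable A ->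
  measurable (iter n T @^-1` A) /\ mu (iter n T @^-1` A) = mu A.
Proof.
move=> mT pT; elim=> // n IH A mA.
have mTA : measurable (T @^-1` A) by rewrite -[X in measurable X]setTI; exact: mT.
by have [h1 h2] := IH _ mTA; split=> //; rewrite -[LHS]/(mu (iter n T @^-1` (T @^-1` A))) h2 pT.
Qed.

Section TowerSystem.
Context {R : realType} {p : {poly int}} {L : nat -> level} {H : nat -> nat}.
Hypothesis tow : tower p L H.

Definition tower_size (k : nat) : nat := lsize (L k).

Lemma tower_size_gt0 k : (0 < tower_size k)%N.
Proof. exact: wf_size (tower_wf tow k). Qed.

Lemma tower_size_dvd k : (tower_size k %| tower_size k.+1)%N.
Proof. by rewrite /tower_size (refines_size (tower_refines tow k)) dvdn_mulr. Qed.

Definition tower_measure : probability seqspace R := odometer_measure tower_size_gt0.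
Local Notation mu := tower_measure.

Lemma tower_H_gt0 k : (0 < H k)%N.
Proof.
apply: leq_trans (tower_period tow k).
by rewrite muln_gt0 (wf_half (tower_wf tow k)).
Qed.

Let f k := lfwd (L k).
Let g k := lbwd (L k).

Let close_fwd k : (#|[pred i : 'I_(tower_size k.+1) |
  (f k.+1 i %/ (tower_size k.+1 %/ tower_size k))%N
    != f k (i %/ (tower_size k.+1 %/ tower_size k))%N]| * (H k * 2 ^ k.+1)
    <= tower_size k.+1)%N.
Proof. exact: refines_close (tower_refines tow k). Qed.

(** Substituting for [i] its image under the permutation turns a failure for the inverses into a
    failure for the maps. *)
Let close_bwd k : (#|[pred i : 'I_(tower_size k.+1) |
  (g k.+1 i %/ (tower_size k.+1 %/ tower_size k))%N
    != g k (i %/ (tower_size k.+1 %/ tower_size k))%N]| * (H k * 2 ^ k.+1)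
    <= tower_size k.+1)%N.
Proof.
apply: leq_trans (close_fwd k); rewrite leq_mul2r; apply/orP; right.
set m := (_ %/ _)%N.
have wf := tower_wf tow k; have wf' := tower_wf tow k.+1.
rewrite -(card_can_pred _ (restrictK wf')); apply/eq_leq/eq_card => i; rewrite !inE /=.
rewrite /g (wf_can wf') -/m; congr (~~ _); apply/eqP/eqP => [->|->].
  by rewrite /f (wf_can_inv wf).
by rewrite /f (wf_can wf).
Qed.

Lemma defect_lim_le (k : nat) (x y : R) (c : nat) :
  (forall l, (k <= l)%N -> x <= y + c%:R * defect H l) -> x <= y.
Proof.
move=> h; apply: (@le_of_geometric _ _ _ (k + c)%N) => l hl.
have kl : (k + c <= l + c)%N by rewrite (leq_trans hl) ?leq_addr.
apply: le_trans (h (l + c)%N _) _; first by rewrite (leq_trans _ kl) ?leq_addr.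
rewrite lerD2l; apply: le_trans (ler_wpM2l _ (defect_le tower_H_gt0 _)) _ => //.
rewrite ler_pdivrMr ?ltr0n ?expn_gt0 // expnD natrM mulKf ?pnatr_eq0 -?lt0n ?expn_gt0 //.
by rewrite ler_nat; apply/ltnW/ltn_expl.
Qed.

(** A failure within [n] steps lies in one of [n] preimages of the exceptional set of one step, all
    of the same measure. *)
Lemma tower_system : exists T Tinv : seqspace -> seqspace, invertible_mps mu T Tinv /\
  forall k n, exists E : set seqspace, [/\ measurable E, pr mu E <= n%:R * defect H k &
    forall x, ~ E x -> iter n T x k = iter n (lfwd (L k)) (x k)].
Proof.
have Q0 := tower_size_gt0; have Qd := tower_size_dvd; have H0 := tower_H_gt0.
have Hn := tower_nondecr tow.
pose S : seqspace -> seqspace := limmap tower_size f.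
pose S' : seqspace -> seqspace := limmap tower_size g.
have mS : measurable_fun setT S by exact: measurable_limmap.
have mS' : measurable_fun setT S' by exact: measurable_limmap.
have fK k : cancel (f k) (g k) := wf_can (tower_wf tow k).
have gK k : cancel (g k) (f k) := wf_can_inv (tower_wf tow k).
have fb k i : (f k i < tower_size k)%N = (i < tower_size k)%N := wf_bound (tower_wf tow k) i.
have gb k i : (g k i < tower_size k)%N = (i < tower_size k)%N := bwd_bound i (tower_wf tow k).
have pS A : measurable A -> pr mu (S @^-1` A) = pr mu A.
  exact: (@limmap_preserves R _ Q0 Qd f g H fK fb H0 Hn close_fwd).
have pS' A : measurable A -> pr mu (S' @^-1` A) = pr mu A.
  exact: (@limmap_preserves R _ Q0 Qd g f H gK gb H0 Hn close_bwd).
have Slev := @limmap_level R _ Q0 Qd f H H0 Hn close_fwd.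
have S'lev := @limmap_level R _ Q0 Qd g H H0 Hn close_bwd.
have pre (F : seqspace -> seqspace) : measurable_fun setT F -> forall A, measurable A -> measurable (F @^-1` A).
  by move=> mF A mA; rewrite -[X in measurable X]setTI; exact: mF.
have mcomp : measurable (compatible tower_size) by exact: measurable_compatible.
have pcomp : pr mu (~` compatible tower_size) = 0 := pr_compatible Q0 Qd.
have mneq (F : seqspace -> seqspace) j : measurable_fun setT F -> measurable [set x | F x j <> x j].
  move=> mF; have -> : [set x | F x j <> x j] =
      ~` \bigcup_v ((F @^-1` [set y : seqspace | y j = v]) `&` [set x | x j = v]).
    apply/seteqP; split=> x /= h; first by move=> [v _ [/= e1 e2]]; apply: h; rewrite e1 e2.
    by move=> e; apply: h; exists (x j).
  apply: measurableC; apply: bigcupT_measurable => v; apply: measurableI.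
    by apply: pre => //; exact: (@measurable_coord j [set v]).
  exact: (@measurable_coord j [set v]).
(* Coordinate [j] of [V (U x)] is [x j] off a set of measure [2 * defect H k], for every [k >= j],
   hence almost everywhere. Both orders of the two limits are needed. *)
have inv (F G : nat -> nat -> nat) (U V : seqspace -> seqspace) :
    (forall k, cancel (F k) (G k)) ->
    measurable_fun setT U -> measurable_fun setT V ->
    (forall A, measurable A -> pr mu (U @^-1` A) = pr mu A) ->
    (forall A, measurable A -> pr mu (V @^-1` A) = pr mu A) ->
    (forall k, exists E : set seqspace, [/\ measurable E, pr mu E <= defect H k &
      forall x, ~ E x -> forall j, (j <= k)%N -> U x j = level_proj tower_size j k (F k (x k))]) ->
    (forall k, exists E : set seqspace, [/\ measurable E, pr mu E <= defect H k &
      forall x, ~ E x -> forall j, (j <= k)%N -> V x j = level_proj tower_size j k (G k (x k))]) ->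
    exists E, [/\ measurable E, pr mu (~` E) = 0 & forall x, E x -> V (U x) = x].
  move=> FG mU mV pU pV Ulev Vlev; have mVU : measurable_fun setT (V \o U) by exact: measurableT_comp.
  exists (~` \bigcup_j [set x | (V \o U) x j <> x j]); split.
  - by apply: measurableC; apply: bigcupT_measurable => j; exact: mneq.
  - rewrite setCK; apply: pr_bigcup0 => [j|j]; first exact: mneq.
    apply/eqP; rewrite eq_le pr_ge0 andbT; apply: (@defect_lim_le j _ _ 2) => k jk.
    have [E1 [mE1 p1 h1]] := Ulev k; have [E2 [mE2 p2 h2]] := Vlev k.
    have mE2' := pre _ mU _ mE2; have mcc := measurableC mcomp.
    rewrite add0r; apply: le_trans (_ : pr mu (E1 `|` (U @^-1` E2 `|` ~` compatible tower_size)) <= _).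
      apply: pr_le; [exact: mneq|by do 2 apply: measurableU => //|].
      move=> x /= hx; apply: contrapT => /not_orP[n1 /not_orP[n2 /contrapT cx]]; apply: hx.
      by rewrite (h2 _ n2) // (h1 _ n1) // level_proj_id // FG -compatible_proj.
    apply: le_trans (pr_setU _ mE1 _) _; first exact: measurableU.
    rewrite mulr_natl mulr2n lerD //; apply: le_trans (pr_setU _ mE2' mcc) _.
    by rewrite pcomp addr0 pU.
  - move=> x h; apply/funext => j; apply: contrapT => hj; apply: h; exists j => //.
have [E1 [mE1 p1 h1]] := inv f g S S' fK mS mS' pS pS' Slev S'lev.
have [E2 [mE2 p2 h2]] := inv g f S' S gK mS' mS pS' pS S'lev Slev.
have pE : pr mu (~` (E1 `&` E2)) = 0.
  apply/eqP; rewrite eq_le pr_ge0 andbT setCI; apply: le_trans (pr_setU _ _ _) _;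
    try exact: measurableC.
  by rewrite p1 p2 addr0.
have [T [Tinv [mps [N [mN N0 TS]]]]] := exact_inverse mS mS' pS pS' (measurableI _ _ mE1 mE2) pE
  (fun x Ex => conj (h1 x Ex.1) (h2 x Ex.2)).
exists T, Tinv; split=> // k n.
have mT := mps_measurable mps.
elim: n => [|n [E [mE prE' hE]]].
  by exists set0; split=> //; rewrite pr_set0 mul0r.
have [D [mD pD hD]] := Slev k.
have [mTn pTn] := pr_iter_preimage mT (mps_preserving mps) n (measurableU _ _ mD mN).
exists (E `|` iter n T @^-1` (D `|` N)); split; first exact: measurableU.
  apply: le_trans (pr_setU _ mE mTn) _; rewrite -natr1 mulrDl mul1r lerD //.
  rewrite {1}/pr pTn; apply: le_trans (pr_setU _ mD mN) _; by rewrite N0 addr0.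
move=> x /not_orP[nE /not_orP[nD nN]]; rewrite !iterS TS // /S (hD _ nD) // level_proj_id //.
by rewrite hE.
Qed.

End TowerSystem.

(** * Approximation of measurable sets by levels *)

Lemma pr_nondecreasing_union d (X : measurableType d) (R : realType) (mu : probability X R)
    (F : nat -> set X) (e : R) : (forall n, measurable (F n)) ->
  (forall m n, (m <= n)%N -> F m `<=` F n) -> 0 < e ->
  exists n, pr mu (\bigcup_i F i `\` F n) <= e.
Proof.
move=> mF ndF e0; have mU : measurable (\bigcup_i F i) by exact: bigcupT_measurable.
have cv : mu (F n) @[n --> \oo] --> mu (\bigcup_i F i).
  by apply: nondecreasing_cvg_mu => // m n mn; apply/subsetPset; exact: ndF.
have [N _ HN] : \forall n \near \oo, `|pr mu (\bigcup_i F i) - pr mu (F n)| <= e.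
  have : fine (mu (F n)) @[n --> \oo] --> fine (mu (\bigcup_i F i)).
    by apply: fine_cvg; rewrite fineK ?fin_num_measure.
  by move/cvgrPdist_le; apply.
exists N; have := HN N (leqnn N); apply: le_trans; apply: le_trans (ler_norm _).
rewrite lerBrDr (pr_split mu mU (mF N)) addrC lerD2r.
by apply: pr_le => //; [exact: measurableI|move=> x FN; split=> //; exists N].
Qed.

Section Approximation.
Context {R : realType} {Q : nat -> nat}.
Hypothesis Q0 : forall k, (0 < Q k)%N.
Hypothesis Qdvd : forall k, (Q k %| Q k.+1)%N.
Local Notation mu := (odometer_measure (R := R) Q0).

(** All large levels are required, so that several sets can be read at a common level. *)
Definition approximable (A : set seqspace) : Prop := forall e : R, 0 < e ->
  exists K, forall k, (K <= k)%N -> exists (P : pred nat) (E : set seqspace),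
    [/\ measurable E, pr mu E <= e & forall x, ~ E x -> A x <-> P (x k)].

Lemma approximable_setC A : approximable A -> approximable (~` A).
Proof.
move=> aA e /aA[K HK]; exists K => k /HK[P [E [mE pE H]]].
exists (predC P), E; split=> // x /H AP; split=> [nA|/negP nP]; last by move/AP.
by apply/negP => /AP.
Qed.

Lemma approximable_setU A B : approximable A -> approximable B -> approximable (A `|` B).
Proof.
move=> aA aB e e0; have e2 : 0 < e / 2 by rewrite divr_gt0.
have [K HK] := aA _ e2; have [K' HK'] := aB _ e2.
exists (maxn K K') => k; rewrite geq_max => /andP[/HK[P [E [mE pE H]]] /HK'[P' [E' [mE' pE' H']]]].
exists (predU P P'), (E `|` E'); split.
- exact: measurableU.
- by apply: le_trans (pr_setU _ mE mE') _; rewrite [e]splitr lerD.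
move=> x /not_orP[/H AP /H' BP] /=; split=> [[/AP ->|/BP ->]|/orP[/AP|/BP]] //; rewrite ?orbT //.
  by left.
by right.
Qed.

Lemma approximable_bigcup (A : nat -> set seqspace) : (forall i, measurable (A i)) ->
  (forall i, approximable (A i)) -> approximable (\bigcup_i A i).
Proof.
move=> mA aA e e0; have e2 : 0 < e / 2 by rewrite divr_gt0.
pose F n := \bigcup_(i < n) A i.
have mF n : measurable (F n) by apply: bigcup_measurable.
have FE : \bigcup_i F i = \bigcup_i A i.
  apply/seteqP; split=> x [n _ h]; first by case: h => i _ Ai; exists i.
  by exists n.+1 => //; exists n => //=.
have ndF m n : (m <= n)%N -> F m `<=` F n.
  by move=> mn x [i /= im Ai]; exists i => //=; exact: leq_trans mn.
have aF n : approximable (F n).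
  elim: n => [|n IH].
    rewrite /F bigcup_mkord big_ord0 => e' e'0; exists 0%N => k _; exists pred0, set0.
    by split=> //; rewrite pr_set0 ltW.
  by rewrite /F bigcup_mkord big_ord_recr /= -bigcup_mkord; exact: approximable_setU.
have [n pn] := pr_nondecreasing_union mu mF ndF e2; rewrite FE in pn.
have [K HK] := aF n _ e2; exists K => k /HK[P [E [mE pE H]]].
exists P, (E `|` (\bigcup_i A i `\` F n)).
have mU : measurable (\bigcup_i A i) by exact: bigcupT_measurable.
have mD : measurable (\bigcup_i A i `\` F n) by exact: measurableD.
split; first exact: measurableU.
  by apply: le_trans (pr_setU _ mE mD) _; rewrite [e]splitr lerD.
move=> x /not_orP[/H FP nD]; rewrite -FP; split=> [Ax|]; last by rewrite -FE; exists n.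
by apply: contrapT => nF; apply: nD.
Qed.

Lemma approximable_cylinder k a : approximable (cylinder k a).
Proof.
move=> e e0; exists k => l kl.
exists (fun i => [forall j : 'I_k.+1, level_proj Q j l i == a j]), (~` compatible Q); split.
- by apply: measurableC; exact: measurable_compatible.
- by rewrite (pr_compatible Q0 Qdvd) ltW.
by move=> x /contrapT cx; exact: cylinder_levelP.
Qed.

(** Measurable approximable sets form a sigma-algebra containing the cylinders; countable unions
    reduce to finite ones by continuity of the measure. *)
Lemma approximable_measurable (A : set seqspace) : measurable A -> approximable A.
Proof.
move=> mA; suff [] : (measurable `&` approximable) A by [].
move: A mA; apply: smallest_sub.
  split.
  - split; first exact: measurable0.
    by rewrite -setCT; apply: approximable_setC => e e0; exists 0%N => k _;
       exists predT, set0; split=> //; rewrite pr_set0 ltW.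
  - move=> A [mA aA]; rewrite setTD; split; first exact: measurableC.
    exact: approximable_setC.
  - move=> A HA; split; first by apply: bigcupT_measurable => i; case: (HA i).
    by apply: approximable_bigcup => i; case: (HA i).
move=> A cA; split; first exact: sub_sigma_algebra.
case: cA => [->|[k [a ->]]]; last exact: approximable_cylinder.
by rewrite -setCT; apply: approximable_setC => e e0; exists 0%N => k _;
   exists predT, set0; split=> //; rewrite pr_set0 ltW.
Qed.

End Approximation.

(** * Rigidity and decoupling of measurable sets *)

Section TowerDynamics.
Context {R : realType} {p : {poly int}} {L : nat -> level} {H : nat -> nat}.
Hypothesis tow : tower p L H.
Local Notation mu := (tower_measure (R := R) tow).
Variables (T Tinv : seqspace -> seqspace).
Hypothesis mps : invertible_mps mu T Tinv.
Hypothesis Tlevel : forall k n, exists E : set seqspace,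
  [/\ measurable E, pr mu E <= n%:R * defect H k &
      forall x, ~ E x -> iter n T x k = iter n (lfwd (L k)) (x k)].

Let Q0 := tower_size_gt0 tow.
Let Qdvd := tower_size_dvd tow.

Lemma tower_level k n : (n <= H k)%N -> exists E : set seqspace,
  [/\ measurable E, pr mu E <= (2 ^ k)%:R^-1 &
      forall x, ~ E x -> iter n T x k = iter n (lfwd (L k)) (x k)].
Proof.
move=> nH; have [E [mE pE hE]] := Tlevel k n; exists E; split=> //.
apply: le_trans pE _; have Hk : 0 < ((H k)%:R : R) by rewrite ltr0n (tower_H_gt0 tow).
rewrite /defect natrM invfM mulrA ler_piMl ?invr_ge0 //.
by rewrite ler_pdivrMr // mul1r ler_nat.
Qed.

Lemma small_pow (e : R) : 0 < e -> exists K, forall k, (K <= k)%N -> (2 ^ k)%:R^-1 <= e.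
Proof.
move=> e0; have e'0 : 0 < e^-1 by rewrite invr_gt0.
exists (Num.bound e^-1) => k hk.
rewrite -[e]invrK lef_pV2 ?posrE ?invr_gt0 ?ltr0n ?expn_gt0 //.
apply: le_trans (ltW (archi_boundP (ltW e'0))) _; rewrite ler_nat.
exact/(leq_trans hk)/ltnW/ltn_expl.
Qed.

Lemma measurable_iter_preimage n A : measurable A -> measurable (iter n T @^-1` A).
Proof.
by move=> mA; have [] := pr_iter_preimage (mps_measurable mps) (mps_preserving mps) n mA.
Qed.

Lemma pr_iter n A : measurable A -> pr mu (iter n T @^-1` A) = pr mu A.
Proof.
move=> mA; have [_ h] := pr_iter_preimage (mps_measurable mps) (mps_preserving mps) n mA.
by rewrite /pr h.
Qed.

Definition rigidity_time (k : nat) : nat := (2 * lhalf (L k))%N.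

(** Membership in [A] is nearly read from the [k]-th digit, both before and after, and
    [rigidity_time k] is a period of the permutation of level [k]. *)
Lemma rigid_set (A : set seqspace) (e : R) : measurable A -> 0 < e ->
  exists K, forall k, (K <= k)%N -> exists E : set seqspace,
    [/\ measurable E, pr mu E <= e &
        forall x, ~ E x -> A x <-> A (iter (rigidity_time k) T x)].
Proof.
move=> mA e0; have e3 : 0 < e / 3 by rewrite divr_gt0.
have [K HK] := approximable_measurable Q0 Qdvd mA e3; have [K' HK'] := small_pow e3.
exists (maxn K K') => k; rewrite geq_max => /andP[/HK[P [E [mE pE hE]]] /HK' kk].
have [D [mD pD hD]] := tower_level (tower_period tow k).
have mE' := measurable_iter_preimage (rigidity_time k) mE.
exists (D `|` (E `|` iter (rigidity_time k) T @^-1` E)); split.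
- by do 2 apply: measurableU => //.
- apply: le_trans (pr_setU _ mD (measurableU _ _ mE mE')) _.
  apply: le_trans (lerD (le_trans pD kk) (pr_setU _ mE mE')) _.
  rewrite pr_iter //; have := lerD pE pE; lra.
move=> x /not_orP[/hD DP /not_orP[/hE EP /hE]]; rewrite DP.
by rewrite (wf_period (tower_wf tow k)) => EP'; split=> [/EP/EP'|/EP'/EP].
Qed.

Lemma rigid_sets (A : nat -> set seqspace) (n : nat) (e : R) :
  (forall i, measurable (A i)) -> 0 < e ->
  exists K, forall k, (K <= k)%N -> exists E : set seqspace,
    [/\ measurable E, pr mu E <= e &
        forall x, ~ E x -> forall i, (i < n)%N -> A i x <-> A i (iter (rigidity_time k) T x)].
Proof.
move=> mA; elim: n e => [|n IH] e e0.
  by exists 0%N => k _; exists set0; split=> //; rewrite pr_set0 ltW.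
have e2 : 0 < e / 2 by rewrite divr_gt0.
have [K HK] := IH _ e2; have [K' HK'] := rigid_set (mA n) e2.
exists (maxn K K') => k; rewrite geq_max => /andP[/HK[E [mE pE hE]] /HK'[E' [mE' pE' hE']]].
exists (E `|` E'); split; first exact: measurableU.
  by apply: le_trans (pr_setU _ mE mE') _; rewrite [e]splitr lerD.
move=> x /not_orP[/hE EP /hE' EP'] i; rewrite ltnS leq_eqVlt => /predU1P[->|] //.
exact: EP.
Qed.

Lemma mixes_card k t (P P' : pred nat) : mixes (L k) (L k.+1) t ->
  (#|[pred i : 'I_(lsize (L k.+1)) | P (i %/ lratio (L k) (L k.+1))%N &&
     P' (iter t (lfwd (L k.+1)) i %/ lratio (L k) (L k.+1))%N]| * lsize (L k) ^ 2 =
   #|[pred z : 'I_(lsize (L k)) | P z]| * #|[pred z : 'I_(lsize (L k)) | P' z]| *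
     lsize (L k.+1))%N.
Proof.
move=> mix; set m := lratio _ _; set Q := lsize (L k); set Q' := lsize (L k.+1).
have szE : Q' = (Q * m)%N by rewrite /Q' (refines_size (tower_refines tow k)).
have m0 : (0 < m)%N by have := tower_size_gt0 tow k.+1; rewrite /tower_size -/Q' szE muln_gt0 => /andP[].
have lt (i : 'I_Q') : (i %/ m < Q)%N by rewrite ltn_divLR // -szE.
have lt' (i : 'I_Q') : (iter t (lfwd (L k.+1)) i %/ m < Q)%N.
  by rewrite ltn_divLR // -szE (iter_bound t i (tower_wf tow k.+1)).
pose h (i : 'I_Q') : 'I_Q * 'I_Q := (Ordinal (lt i), Ordinal (lt' i)).
pose PP (z : 'I_Q * 'I_Q) := P z.1 && P' z.2.
have -> : (#|[pred z : 'I_Q | P z]| * #|[pred z : 'I_Q | P' z]| = \sum_(z | PP z) 1)%N.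
  rewrite sum1_card -cardX; apply: eq_card => -[z z'].
  by rewrite !inE.
rewrite -sum1_card (partition_big h PP) /=; last by move=> i; rewrite inE.
rewrite !big_distrl /=; apply: eq_bigr => -[z z'] /andP[/= Pz Pz'].
rewrite mul1n; apply: etrans (mix z z' (ltn_ord z) (ltn_ord z')); congr (_ * _)%N.
rewrite -sum1_card; apply: eq_bigl => i; rewrite !inE /h.
apply/andP/andP => [[_ /eqP[<- <-]] //|[/eqP zi /eqP zi']].
split; first by rewrite -/m zi zi' Pz Pz'.
by apply/eqP; congr pair; apply: val_inj.
Qed.

(** [A] and [B] are read at level [k], whose positions at times 0 and [t] are independent in level
    [k.+1]; the orbit can be followed there because [t <= H k.+1]. A lower bound is enough to obtain
    intersections of positive measure. *)
Lemma mixing_lower (A B : set seqspace) (e : R) : measurable A -> measurable B -> 0 < e ->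
  exists K, forall k t, (K <= k)%N -> (t <= H k.+1)%N -> mixes (L k) (L k.+1) t ->
    pr mu A * pr mu B <= pr mu (A `&` iter t T @^-1` B) + e.
Proof.
(* The bad set costs three errors [e / 8], the product of the measures two more. *)
move=> mA mB e0; have e8 : 0 < e / 8 by rewrite divr_gt0.
have [K1 HK1] := approximable_measurable Q0 Qdvd mA e8.
have [K2 HK2] := approximable_measurable Q0 Qdvd mB e8.
have [K3 HK3] := small_pow e8.
exists (maxn K1 (maxn K2 K3)) => k t; rewrite !geq_max => /and3P[kK1 kK2 kK3] tH mix.
have [P [E [mE pE hE]]] := HK1 k kK1; have [P' [E' [mE' pE' hE']]] := HK2 k kK2.
have [D [mD pD hD]] := tower_level tH.
have {}pD := le_trans pD (HK3 _ (leqW kK3)).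
have mcc : measurable (~` compatible (tower_size (L := L))).
  by apply: measurableC; exact: measurable_compatible.
have pcc : pr mu (~` compatible (tower_size (L := L))) = 0 := pr_compatible Q0 Qdvd.
have mP (Z : pred nat) j : measurable ([set x : seqspace | Z (x j)]).
  exact: (@measurable_coord j [set v | Z v]).
have prP (Z : pred nat) : 0 <= pr mu [set x : seqspace | Z (x k)] <= 1.
  by rewrite pr_ge0 pr_le1.
have pA : pr mu A <= pr mu [set x : seqspace | P (x k)] + e / 8.
  by apply: le_trans (lerD (lexx _) pE); apply: pr_close => // x /hE[].
have pB : pr mu B <= pr mu [set x : seqspace | P' (x k)] + e / 8.
  by apply: le_trans (lerD (lexx _) pE'); apply: pr_close => // x /hE'[].
set m := lratio (L k) (L k.+1).
pose Z i := P (i %/ m)%N && P' (iter t (lfwd (L k.+1)) i %/ m)%N.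
have prZ : pr mu [set x : seqspace | Z (x k.+1)] =
    pr mu [set x : seqspace | P (x k)] * pr mu [set x : seqspace | P' (x k)].
  rewrite !(@pr_coord R _ Q0); have := mixes_card P P' mix; rewrite -/m => e1.
  have q0 : ((lsize (L k))%:R : R) != 0 by rewrite pnatr_eq0 -lt0n; exact: Q0.
  have q0' : ((lsize (L k.+1))%:R : R) != 0 by rewrite pnatr_eq0 -lt0n; exact: Q0.
  have : (#|[pred i : 'I_(lsize (L k.+1)) | Z i]| * lsize (L k) ^ 2)%N%:R =
    (#|[pred z : 'I_(lsize (L k)) | P z]| * #|[pred z : 'I_(lsize (L k)) | P' z]| *
     lsize (L k.+1))%N%:R :> R by rewrite e1.
  rewrite !natrM /tower_size => e2; apply: (mulIf q0'); apply: (mulIf (mulf_neq0 q0 q0)).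
  rewrite divfK // e2; field; exact: q0.
have mT (C : set seqspace) : measurable C -> measurable (iter t T @^-1` C).
  exact: measurable_iter_preimage.
have mE'T := mT _ mE'; have mccT := mT _ mcc; have mBT := mT _ mB.
set cc := ~` compatible _ in mcc pcc mccT.
have mU1 := measurableU _ _ mcc mccT; have mU2 := measurableU _ _ mD mU1.
have mU3 := measurableU _ _ mE'T mU2; have mbad := measurableU _ _ mE mU3.
have pbad : pr mu (E `|` (iter t T @^-1` E' `|` (D `|` (cc `|` iter t T @^-1` cc))))
   <= e / 8 + (e / 8 + e / 8).
  apply: le_trans (pr_setU _ mE mU3) _; apply: lerD => //.
  apply: le_trans (pr_setU _ mE'T mU2) _; apply: lerD; first by rewrite pr_iter.
  apply: le_trans (pr_setU _ mD mU1) _; rewrite -[X in _ <= X]addr0; apply: lerD => //.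
  by apply: le_trans (pr_setU _ mcc mccT) _; rewrite pr_iter // pcc addr0.
have key : pr mu [set x : seqspace | Z (x k.+1)] <=
    pr mu (A `&` iter t T @^-1` B) + (e / 8 + (e / 8 + e / 8)).
  apply: le_trans (lerD (lexx _) pbad); apply: pr_close => //.
    exact: measurableI.
  move=> x /not_orP[/hE xA /not_orP[/hE' xB /not_orP[/hD xD /not_orP[/contrapT cx /contrapT cTx]]]].
  move=> /andP[Px P'x]; split; first by apply/xA; rewrite cx.
  by apply/xB; rewrite cTx xD.
move: key; rewrite prZ; have := prP P; have := prP P'; have := pr_ge0 mu A; have := pr_ge0 mu B.
have := pr_le1 mu mA; have := pr_le1 mu mB; move: pA pB.
move: (pr mu A) (pr mu B) (pr mu [set x | P _]) (pr mu [set x | P' _]) (pr mu _).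
move=> a b c d q; clear -e0; nra.
Qed.

End TowerDynamics.

(** * Weak mixing *)

Section ComplexFunctions.
Context {d : measure_display} {X : measurableType d} {R : realType}.
Local Notation norm := (@ComplexField.Normc.normc R).

Lemma normc_le_sum (z : R[i]) : norm z <= `|complex.Re z| + `|complex.Im z|.
Proof.
case: z => a b /=; rewrite -[leRHS]ger0_norm ?addr_ge0 // -sqrtr_sqr.
rewrite ler_wsqrtr // sqrrD !real_normK ?num_real //.
by rewrite addrAC lerDl mulrn_wge0 // mulr_ge0.
Qed.

Lemma normc_triangle (a b c : R[i]) : norm (a - c) <= norm (a - b) + norm (b - c).
Proof.
have -> : a - c = (a - b) + (b - c) by rewrite addrA subrK.
exact: (@le_normcD R).
Qed.

Lemma normc_sub (a b : R[i]) : norm (a - b) = norm (b - a).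
Proof. by rewrite -[in LHS]opprB; exact: (@normcN R). Qed.

Lemma normc_ge0 (a : R[i]) : 0 <= norm a.
Proof. by case: a => a b; exact: sqrtr_ge0. Qed.

Lemma measurable_normc_sub (f g : X -> R[i]) :
  measurable_fun setT (fun x => complex.Re (f x)) ->
  measurable_fun setT (fun x => complex.Im (f x)) ->
  measurable_fun setT (fun x => complex.Re (g x)) ->
  measurable_fun setT (fun x => complex.Im (g x)) ->
  measurable_fun setT (fun x => norm (f x - g x)).
Proof.
move=> mRf mIf mRg mIg.
have -> : (fun x => norm (f x - g x)) = Num.sqrt \o (fun x =>
    (complex.Re (f x) - complex.Re (g x)) ^+ 2 + (complex.Im (f x) - complex.Im (g x)) ^+ 2).
  by apply/funext => x /=; case: (f x) => a b; case: (g x).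
apply: measurableT_comp; first by apply: continuous_measurable_fun; exact: sqrt_continuous.
by apply: measurable_funD; apply: measurable_funX; apply: measurable_funB.
Qed.

Lemma measurable_le (u : X -> R) (c : R) : measurable_fun setT u -> measurable [set x | u x <= c].
Proof.
move=> mu; have := mu measurableT `]-oo, c]%classic (measurable_itv _).
by rewrite setTI; congr measurable; apply/seteqP; split=> x /=; rewrite in_itv.
Qed.

End ComplexFunctions.

Section WeakMixing.
Context {d : measure_display} {X : measurableType d} {R : realType}.
Variables (mu : probability X R) (T : X -> X).
Hypothesis mT : measurable_fun setT T.
Hypothesis pT : forall A, measurable A -> mu (T @^-1` A) = mu A.
Local Notation norm := (@ComplexField.Normc.normc R).

Lemma ae_null (P : X -> Prop) : {ae mu, forall x, P x} ->
  exists N, [/\ measurable N, pr mu N = 0 & forall x, ~ N x -> P x].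
Proof.
move=> [N [mN N0 HN]]; exists N; split=> //; first by rewrite /pr N0.
by move=> x nN; apply: contrapT => nP; apply: nN; apply: HN.
Qed.

Lemma null_ae (N : set X) (P : X -> Prop) : measurable N -> pr mu N = 0 ->
  (forall x, ~ N x -> P x) -> {ae mu, forall x, P x}.
Proof.
move=> mN N0 HN; exists N; split=> //; first by rewrite prE // N0.
by move=> x /= nP; apply: contrapT => nN; apply: nP; apply: HN.
Qed.

Lemma eigen_iter (lambda : R[i]) (f : X -> R[i]) :
  {ae mu, forall x, f (T x) = lambda * f x} -> forall t, exists N,
  [/\ measurable N, pr mu N = 0 & forall x, ~ N x -> f (iter t T x) = lambda ^+ t * f x].
Proof.
move=> /ae_null[N [mN N0 HN]]; elim=> [|t [E [mE E0 HE]]].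
  by exists set0; split=> //; [rewrite pr_set0|move=> x _; rewrite expr0 mul1r].
have [mTN pTN] := pr_iter_preimage mT pT t mN.
exists (E `|` iter t T @^-1` N); split; first exact: measurableU.
  apply/eqP; rewrite eq_le pr_ge0 andbT; apply: le_trans (pr_setU _ mE mTN) _.
  by rewrite E0 add0r /pr pTN -/(pr mu N) N0.
by move=> x /not_orP[/HE Ex /HN Nx]; rewrite iterS Nx Ex exprS mulrA.
Qed.

Lemma pr_gt0_point (A N : set X) : measurable A -> measurable N -> pr mu N = 0 ->
  0 < pr mu A -> exists2 x, A x & ~ N x.
Proof.
move=> mA mN N0 A0; apply: contrapT => H.
have : pr mu A <= pr mu N.
  by apply: pr_le => // x Ax; apply: contrapT => nN; apply: H; exists x.
by rewrite N0 leNgt A0.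
Qed.

(** Countably many balls, centred on a grid of mesh [e / 2], cover the complex plane; their
    preimages cannot all be null. *)
Lemma positive_ball (f : X -> R[i]) (e : R) : 0 < e ->
  (forall z, measurable [set x | norm (f x - z) <= e]) ->
  exists z, 0 < pr mu [set x | norm (f x - z) <= e].
Proof.
move=> e0 mB; apply: contrapT => H; have e2 : 0 < e / 2 by rewrite divr_gt0.
pose z (ij : int * int) : R[i] := ((ij.1%:~R * (e / 2)) +i* (ij.2%:~R * (e / 2)))%C.
pose C n := if unpickle n is Some ij then [set x | norm (f x - z ij) <= e] else set0.
have mC n : measurable (C n) by rewrite /C; case: unpickle.
have C0 n : pr mu (C n) = 0.
  rewrite /C; case: unpickle => [ij|]; last exact: pr_set0.
  apply/eqP; rewrite eq_le pr_ge0 andbT leNgt; apply/negP => h; apply: H.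
  by exists (z ij).
have UC : \bigcup_n C n = setT.
  rewrite -subTset => x _.
  pose ij := (Num.floor (complex.Re (f x) / (e / 2)), Num.floor (complex.Im (f x) / (e / 2))).
  exists (pickle ij) => //; rewrite /C pickleK /= -/ij.
  apply: le_trans (normc_le_sum _) _; rewrite [e]splitr.
  have fl (y : R) : `|y - (Num.floor (y / (e / 2)))%:~R * (e / 2)| <= e / 2.
    rewrite ger0_norm ?subr_ge0 -?ler_pdivlMr ?floor_le //.
    have := floorD1_gt (y / (e / 2)); rewrite intrD ltr_pdivrMr // mulrDl mul1r => /ltW.
    by rewrite lerBlDr addrC.
  by apply: lerD; rewrite /ij /z /=; case: (f x) => a b /=; exact: fl.
have := pr_bigcup0 mC C0; rewrite UC pr_setT => /eqP.
by rewrite oner_eq0.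
Qed.

(* If [|lambda| <= 1], an eigenfunction close to [z] on [A] cannot be sent far from
   [z] from [A] at a time at which part of [A] returns to [A]; if [|lambda| > 1],
   the same holds for points entering [A] from far away. *)
Lemma weakly_mixing_of_sets :
  (forall A B, measurable A -> measurable B -> 0 < pr mu A -> 0 < pr mu B ->
    exists t, [/\ 0 < pr mu (A `&` iter t T @^-1` A), 0 < pr mu (A `&` iter t T @^-1` B)
      & 0 < pr mu (B `&` iter t T @^-1` A)]) ->
  weakly_mixing mu T.
Proof.
move=> mix lambda f [[mR mI _] _ eig].
have mB z e : measurable [set x | norm (f x - z) <= e].
  by apply: measurable_le; apply: (measurable_normc_sub mR mI); exact: measurable_cst.
(* The triangle inequalities below produce three distances of at most [e], so 4 is enough. *)
have claim e : 0 < e -> exists z, pr mu [set x | ~ (norm (f x - z) <= 4 * e)] = 0.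
  move=> e0; have [z pz] := positive_ball e0 (fun z => mB z e); exists z.
  set B := [set x | ~ _]; have mBB : measurable B := measurableC (mB z (4 * e)).
  apply/eqP; rewrite eq_le pr_ge0 andbT leNgt; apply/negP => B0.
  set A := [set x | _] in pz.
  have [t [AA AB BA]] := mix A B (mB z e) mBB pz B0.
  have [N [mN N0 HN]] := eigen_iter eig t.
  have mpre C : measurable C -> measurable (iter t T @^-1` C).
    by move=> mC; have [] := pr_iter_preimage mT pT t mC.
  have mA : measurable A := mB z e.
  have [x [Ax /= ATx] Nx] := pr_gt0_point (measurableI _ _ mA (mpre _ mA)) mN N0 AA.
  rewrite /A /= (HN _ Nx) in Ax ATx; set l := lambda ^+ t in ATx.
  have [l1|l1] := leP (norm l) 1.
    have [y [Ay /= By] Ny] := pr_gt0_point (measurableI _ _ mA (mpre _ mBB)) mN N0 AB.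
    rewrite /A /B /= (HN _ Ny) -/l in Ay By; apply: By.
    apply: le_trans (normc_triangle _ (l * f x) _) _.
    have : norm (l * f y - l * f x) <= norm (f y - f x).
      by rewrite -mulrBr ComplexField.Normc.normcM ler_piMl ?normc_ge0.
    have := normc_triangle (f y) z (f x); rewrite (normc_sub z); move: Ax ATx Ay e0; lra.
  have [y [By /= Ay] Ny] := pr_gt0_point (measurableI _ _ mBB (mpre _ mA)) mN N0 BA.
  rewrite /A /B /= (HN _ Ny) -/l in Ay By; apply: By.
  apply: le_trans (normc_triangle _ (f x) _) _.
  have : norm (f y - f x) <= norm (l * f y - l * f x).
    by rewrite -mulrBr ComplexField.Normc.normcM ler_peMl ?normc_ge0 // ltW.
  have := normc_triangle (l * f y) z (l * f x); rewrite (normc_sub z); move: Ax ATx Ay e0; lra.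
(* Off a single null set, any two values of [f] are then within [8 / (n + 1)] for every [n]. *)
have claim' (n : nat) : exists z, pr mu [set x | ~ (norm (f x - z) <= 4 * n.+1%:R^-1)] = 0.
  by apply: claim; rewrite invr_gt0.
have [z Hz] := boolp.choice claim'.
pose N := \bigcup_n [set x | ~ (norm (f x - z n) <= 4 * n.+1%:R^-1)].
have mNn n : measurable [set x | ~ (norm (f x - z n) <= 4 * n.+1%:R^-1)] :=
  measurableC (mB (z n) _).
have mN : measurable N by exact: bigcupT_measurable.
have N0 : pr mu N = 0 by exact: pr_bigcup0.
have [x0 _ Nx0] : exists2 x, setT x & ~ N x.
  by apply: pr_gt0_point; rewrite ?pr_setT.
exists (f x0); apply: (null_ae mN N0) => x Nx.
have good y n : ~ N y -> norm (f y - z n) <= 4 * n.+1%:R^-1.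
  by move=> Ny; apply: contrapT => h; apply: Ny; exists n.
apply/eqP; rewrite -subr_eq0; apply/eqP/ComplexField.Normc.eq0_normc.
apply/eqP; rewrite eq_le normc_ge0 andbT; apply/ler_addgt0Pr => e e0; rewrite add0r.
have e8 : 0 < 8 / e by rewrite divr_gt0.
have nR : 8 / e <= (Num.bound (8 / e)).+1%:R.
  by apply: le_trans (ltW (archi_boundP (ltW e8))) _; rewrite ler_nat.
set n := Num.bound _ in nR; have n0 : 0 < (n.+1%:R : R) by rewrite ltr0n.
apply: le_trans (normc_triangle _ (z n) _) _; rewrite (normc_sub (z n)).
apply: le_trans (lerD (good x n Nx) (good x0 n Nx0)) _.
rewrite -mulrDl -natrD -ler_pdivlMl ?ltr0n // -[X in _ <= X]invrK lef_pV2 ?posrE ?invr_gt0 ?mulr_gt0 ?invr_gt0 //.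
by rewrite invfM invrK.
Qed.

End WeakMixing.

(** * Rigidity *)

Section Rigidity.
Context {d : measure_display} {X : measurableType d} {R : realType}.
Variables (mu : probability X R) (T : X -> X).
Hypothesis mT : measurable_fun setT T.
Hypothesis pT : forall A, measurable A -> mu (T @^-1` A) = mu A.
Local Notation norm := (@ComplexField.Normc.normc R).

Lemma measurable_iter n : measurable_fun setT (iter n T).
Proof.
elim: n => [|n IH]; first exact: measurable_id.
exact: (measurableT_comp mT IH).
Qed.

Lemma integral_iter n (g : X -> \bar R) : measurable_fun setT g -> (forall x, (0 <= g x)%E) ->
  (\int[mu]_x g (iter n T x) = \int[mu]_x g x)%E.
Proof.
move=> mg g0; have := @ge0_integral_pushforward _ _ _ _ R _ (measurable_iter n) mu setT g.
move=> /(_ measurableT mg (fun x _ => g0 x)); rewrite preimage_setT => <-.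
apply: eq_measure_integral => [|? A mA _]; first exact: measurable_iter.
by have [_ e] := pr_iter_preimage mT pT n mA; exact: e.
Qed.

(** Dominated convergence, with [phi] itself as the bound. *)
Lemma tail_integral (phi : X -> R) (c : R) : measurable_fun setT phi ->
  (forall x, 0 <= phi x) -> (\int[mu]_x (phi x)%:E < +oo)%E -> 0 < c ->
  exists M : nat, (\int[mu]_x ((if (M%:R < phi x)%R then phi x else 0)%:E) <= c%:E)%E.
Proof.
move=> mphi phi0 fin c0.
pose tau (n : nat) x := if (n%:R < phi x)%R then phi x else 0.
have mtau n : measurable_fun setT (tau n).
  apply: measurable_fun_ifT => //; apply: measurable_fun_ltr => //; exact: measurable_cst.
have cv : (\int[mu]_x (tau n x)%:E)%E @[n --> \oo] --> (\int[mu]_x (cst 0%E x))%E.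
  apply: (@dominated_cvg _ _ _ _ _ measurableT _ _ (fun x => (phi x)%:E)) => //.
  - by move=> n; apply/measurable_EFinP.
  - move=> x _; apply: cvg_near_cst; exists (Num.bound (phi x)) => // n /= hn.
    rewrite /tau ltNge (_ : phi x <= n%:R) //.
    by apply: le_trans (ltW (archi_boundP (phi0 x))) _; rewrite ler_nat.
  - apply/integrableP; split; first by apply/measurable_EFinP.
    by under eq_integral do rewrite gee0_abs ?lee_fin //.
  - move=> n x _; rewrite /tau gee0_abs ?lee_fin; last by case: ifP.
    by case: ifP.
rewrite integral0 in cv; have [_ /cvgrPdist_le /(_ c c0)[N _ HN]] := (fine_cvgP _ _).1 cv.
exists N; have := HN N (leqnn N); rewrite /= sub0r normrN.
have fin_num : (\int[mu]_x (tau N x)%:E)%E \is a fin_num.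
  rewrite ge0_fin_numE; last by apply: integral_ge0 => x _; rewrite lee_fin /tau; case: ifP.
  apply: le_lt_trans fin; apply: ge0_le_integral => //.
  - by move=> x _; rewrite lee_fin /tau; case: ifP.
  - by apply/measurable_EFinP.
  - by apply/measurable_EFinP.
  - by move=> x _; rewrite lee_fin /tau; case: ifP.
by move=> /(le_trans (ler_norm _)); rewrite -lee_fin fineK.
Qed.

Variable N : nat -> nat.
Hypothesis rigidN : forall (A : nat -> set X) (n : nat) (e : R),
  (forall i, measurable (A i)) -> 0 < e ->
  exists K, forall k, (K <= k)%N -> exists E : set X,
    [/\ measurable E, pr mu E <= e &
        forall x, ~ E x -> forall i, (i < n)%N -> A i x <-> A i (iter (N k) T x)].

(** Off a small set [u] is bounded by some [n]; the finitely many sets [u >= i * eps - n] then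
    locate its value within [eps], and they are almost invariant. *)
Lemma rigid_in_measure (u : X -> R) (eps e : R) : measurable_fun setT u -> 0 < eps -> 0 < e ->
  exists K, forall k, (K <= k)%N -> exists E : set X,
    [/\ measurable E, pr mu E <= e & forall x, ~ E x -> `|u (iter (N k) T x) - u x| <= eps].
Proof.
move=> mu_ eps0 e0; have e2 : 0 < e / 2 by rewrite divr_gt0.
pose F (n : nat) := [set x | `|u x| <= n%:R].
have mF n : measurable (F n).
  by apply: measurable_le; apply: measurableT_comp mu_; exact: normr_measurable.
have ndF m n : (m <= n)%N -> F m `<=` F n.
  by move=> mn x /le_trans; apply; rewrite ler_nat.
have UF : \bigcup_n F n = setT.
  rewrite -subTset => x _; exists (Num.bound `|u x|) => //.
  by rewrite /F /=; apply/ltW/archi_boundP.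
have [n pn] := pr_nondecreasing_union mu mF ndF e2; rewrite UF setTD in pn.
pose m := (Num.bound (2 * n%:R / eps)).+2.
pose B (i : nat) := [set x | - u x <= n%:R - i%:R * eps].
have mB i : measurable (B i) by apply: measurable_le; exact: measurable_funN.
have [K HK] := rigidN m mB e2; exists K => k /HK[E [mE pE hE]].
exists (E `|` ~` F n); split; first by apply: measurableU => //; exact: measurableC.
  by apply: le_trans (pr_setU _ mE (measurableC (mF n))) _; rewrite [e]splitr lerD.
move=> x /not_orP[/hE H /contrapT]; rewrite /F /= ler_norml => /andP[u1 u2].
have un : 0 <= u x + n%:R by lra.
have y0 : 0 <= (u x + n%:R) / eps by rewrite divr_ge0 // ltW.
set j := Num.truncn ((u x + n%:R) / eps).
have /andP[j1 j2] : j%:R <= (u x + n%:R) / eps < j.+1%:R by exact: truncn_itv.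
have jm : (j.+1 < m)%N.
  rewrite /m ltnS ltnS -(ler_nat R); apply: ltW; apply: le_lt_trans j1 _.
  have x0 : 0 <= 2 * n%:R / eps by rewrite divr_ge0 ?mulr_ge0 // ltW.
  apply: le_lt_trans (archi_boundP x0); rewrite ler_pM2r ?invr_gt0 //; lra.
have Bj : B j x by rewrite /B /= lerBrDr; move: j1; rewrite ler_pdivlMr //; lra.
have nBj : ~ B j.+1 x.
  rewrite /B /= => h; move: j2; rewrite ltr_pdivrMr // => h2; move: h; lra.
have Bj' := (H j (ltnW jm)).1 Bj.
have nBj' : ~ B j.+1 (iter (N k) T x) by move=> h; apply: nBj; apply/(H j.+1 jm).
move: Bj Bj' nBj nBj'; rewrite /B /= -natr1 => h1 h2 /negP h3 /negP h4.
rewrite -!ltNge in h3 h4; rewrite ler_norml; apply/andP; split; lra.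
Qed.

Lemma rigid_in_measureC (f : X -> R[i]) (eps e : R) :
  measurable_fun setT (fun x => complex.Re (f x)) ->
  measurable_fun setT (fun x => complex.Im (f x)) -> 0 < eps -> 0 < e ->
  exists K, forall k, (K <= k)%N -> exists E : set X,
    [/\ measurable E, pr mu E <= e & forall x, ~ E x -> norm (f (iter (N k) T x) - f x) <= eps].
Proof.
move=> mR mI eps0 e0; have eps2 : 0 < eps / 2 by rewrite divr_gt0.
have e2 : 0 < e / 2 by rewrite divr_gt0.
have [K HK] := rigid_in_measure mR eps2 e2; have [K' HK'] := rigid_in_measure mI eps2 e2.
exists (maxn K K') => k; rewrite geq_max => /andP[/HK[E [mE pE hE]] /HK'[E' [mE' pE' hE']]].
exists (E `|` E'); split; first exact: measurableU.
  by apply: le_trans (pr_setU _ mE mE') _; rewrite [e]splitr lerD.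
move=> x /not_orP[/hE h /hE' h']; apply: le_trans (normc_le_sum _) _.
by rewrite [eps]splitr lerD //; move: h h'; case: (f _) => a b; case: (f x).
Qed.

Lemma normc_sqr_sub (a b : R[i]) : norm (a - b) ^+ 2 <= 2 * norm a ^+ 2 + 2 * norm b ^+ 2.
Proof.
have h : norm (a - b) <= norm a + norm b.
  have := normc_triangle a 0 b; rewrite subr0 sub0r.
  by have -> : norm (- b) = norm b by exact: (@normcN R).
have a0 := normc_ge0 a; have b0 := normc_ge0 b.
apply: (@le_trans _ _ ((norm a + norm b) ^+ 2)).
  by rewrite ler_sqr ?nnegrE ?normc_ge0 ?addr_ge0.
have := sqr_ge0 (norm a - norm b); rewrite sqrrB sqrrD; lra.
Qed.

(** Off a small set [E] the integrand is at most [eps ^+ 2]. On [E] it is at most [4 * M] plus twice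
    the tails of [phi] above [M] at the point and at its image, which have equal integrals. Each of
    the three contributions is at most [c / 4]. *)
Lemma rigid_integral (f : X -> R[i]) (c : R) :
  measurable_fun setT (fun x => complex.Re (f x)) ->
  measurable_fun setT (fun x => complex.Im (f x)) ->
  (\int[mu]_x (norm (f x) ^+ 2)%:E < +oo)%E -> 0 < c ->
  exists K, forall k, (K <= k)%N ->
    (\int[mu]_x (norm (f (iter (N k) T x) - f x) ^+ 2)%:E <= c%:E)%E.
Proof.
move=> mR mI fin c0.
pose phi x := norm (f x) ^+ 2.
have phi0 x : 0 <= phi x by exact: sqr_ge0.
have mphi : measurable_fun setT phi.
  apply: measurable_funX; have -> : (fun x => norm (f x)) = (fun x => norm (f x - 0)).
    by apply/funext => x; rewrite subr0.
  by apply: (measurable_normc_sub mR mI); exact: measurable_cst.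
have c16 : 0 < c / 16 by rewrite divr_gt0.
have [M HM] := tail_integral mphi phi0 fin c16.
pose tau x := if (M%:R < phi x)%R then phi x else 0.
have tau0 x : 0 <= tau x by rewrite /tau; case: ifP.
have mtau : measurable_fun setT tau.
  apply: measurable_fun_ifT => //; apply: measurable_fun_ltr => //; exact: measurable_cst.
pose eps := Num.min 1 (c / 4).
have eps0 : 0 < eps by rewrite lt_min ltr01 divr_gt0.
have eps2 : eps ^+ 2 <= c / 4.
  apply: (@le_trans _ _ (eps * 1)); last by rewrite mulr1 /eps ge_min lexx orbT.
  by apply: ler_wpM2l; [exact: ltW|rewrite /eps ge_min lexx].
have M1 : 0 < (M%:R + 1 : R) by rewrite ltr_wpDl.
pose e := c / 16 / (M%:R + 1).
have e0 : 0 < e by rewrite divr_gt0.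
have Me : M%:R * e <= c / 16.
  by rewrite /e mulrA ler_pdivrMr // mulrC ler_pM2l // lerDl.
have [K HK] := rigid_in_measureC mR mI eps0 e0.
exists K => k /HK[E [mE pE hE]].
set S := iter (N k) T.
have mS : measurable_fun setT S by exact: measurable_iter.
have phi_le x : phi x <= M%:R + tau x.
  by rewrite /tau; case: (ltP M%:R (phi x)) => h; rewrite ?addr0 // lerDr.
have bound x : norm (f (S x) - f x) ^+ 2 <=
    eps ^+ 2 + (4 * M%:R * \1_E x + (2 * tau x + 2 * tau (S x))).
  have t1 := tau0 x; have t2 := tau0 (S x).
  rewrite indicE; case: (boolP (x \in E)) => [xE|/negP xE].
    have := normc_sqr_sub (f (S x)) (f x); have := phi_le x; have := phi_le (S x).
    have := sqr_ge0 eps; rewrite [true%:R]/(1 : R) mulr1 -/(phi (S x)) -/(phi x).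
    move: (norm _ ^+ 2) (phi x) (phi (S x)) (tau x) (tau (S x)) (eps ^+ 2) t1 t2; clear.
    move=> *; lra.
  have h : norm (f (S x) - f x) <= eps by apply: hE => Ex; apply: xE; rewrite inE.
  have : norm (f (S x) - f x) ^+ 2 <= eps ^+ 2.
    by rewrite ler_sqr ?nnegrE ?normc_ge0 // ltW.
  rewrite mulr0; lra.
have mcomp (u : X -> R) : measurable_fun setT u -> measurable_fun setT (fun x => (u x)%:E).
  by move=> mu_; apply/measurable_EFinP.
have mtauS : measurable_fun setT (fun x => tau (S x)) by exact: (measurableT_comp mtau mS).
have mtau2 : measurable_fun setT (fun x => 2 * tau x) by apply: measurable_funM.
have mtauS2 : measurable_fun setT (fun x => 2 * tau (S x)) by apply: measurable_funM.
have mind : measurable_fun setT (fun x => 4 * M%:R * \1_E x : R).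
  by apply: measurable_funM => //; exact: measurable_indic.
have msum : measurable_fun setT (fun x => 2 * tau x + 2 * tau (S x)) by exact: measurable_funD.
have msum' : measurable_fun setT (fun x => 4 * M%:R * \1_E x + (2 * tau x + 2 * tau (S x)) : R).
  exact: measurable_funD.
have ind0 x : 0 <= 4 * M%:R * \1_E x :> R by rewrite !mulr_ge0 // indicE.
have s0 x : 0 <= 2 * tau x + 2 * tau (S x) by rewrite addr_ge0 // mulr_ge0.
apply: (@le_trans _ _ (\int[mu]_x (eps ^+ 2 + (4 * M%:R * \1_E x + (2 * tau x + 2 * tau (S x))))%:E)%E).
  apply: ge0_le_integral => //.
  - by move=> x _; rewrite lee_fin sqr_ge0.
  - apply/mcomp/measurable_funX.
    exact: (measurable_normc_sub (measurableT_comp mR mS) (measurableT_comp mI mS) mR mI).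
  - by apply/mcomp; apply: measurable_funD.
  - by move=> x _; rewrite lee_fin.
have split (u v : X -> R) : measurable_fun setT u -> measurable_fun setT v ->
    (forall x, 0 <= u x) -> (forall x, 0 <= v x) ->
    (\int[mu]_x (u x + v x)%:E = \int[mu]_x (u x)%:E + \int[mu]_x (v x)%:E)%E.
  move=> mu_ mv u0 v0; under eq_integral do rewrite EFinD.
  by rewrite ge0_integralD //; [move=> x _; rewrite lee_fin|exact: mcomp|
    move=> x _; rewrite lee_fin|exact: mcomp].
have scale (a : R) (u : X -> R) : measurable_fun setT u -> 0 <= a -> (forall x, 0 <= u x) ->
    (\int[mu]_x (a * u x)%:E = a%:E * \int[mu]_x (u x)%:E)%E.
  move=> mu_ a0 u0; under eq_integral do rewrite EFinM.
  by rewrite ge0_integralZl_EFin //; [move=> x _; rewrite lee_fin|exact: mcomp].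
rewrite (split (cst (eps ^+ 2))) //; last first.
- by move=> x; rewrite addr_ge0.
- by move=> x; exact: sqr_ge0.
rewrite (split (fun x => 4 * M%:R * \1_E x)) //.
rewrite (split (fun x => 2 * tau x)) //; last 2 first.
- by move=> x; rewrite mulr_ge0.
- by move=> x; rewrite mulr_ge0.
rewrite (scale (4 * M%:R)) // ?(scale 2) //.
rewrite (integral_iter (N k) (mcomp _ mtau)); last by move=> x; rewrite lee_fin.
rewrite [X in (X + _)%E](_ : _ = ((eps ^+ 2)%:E * mu setT)%E); last first.
  by rewrite -integral_cst.
rewrite integral_indic // setIT.
rewrite [X in (_ * X + _)%E](_ : _ = 1%E); last exact: probability_setT.
rewrite mule1 [X in (_ + (_ * X + _))%E](_ : _ = (pr mu E)%:E); last exact: prE.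
have HM' : (2%:E * \int[mu]_x (tau x)%:E <= (2 * (c / 16))%:E)%E.
  by rewrite EFinM; apply: lee_wpmul2l => //; rewrite lee_fin.
apply: (@le_trans _ _ ((eps ^+ 2)%:E + ((4 * M%:R)%:E * (pr mu E)%:E
    + ((2 * (c / 16))%:E + (2 * (c / 16))%:E)))%E).
  by rewrite leeD2l // leeD2l // leeD.
rewrite -!EFinM -!EFinD lee_fin.
have : M%:R * pr mu E <= M%:R * e by rewrite ler_wpM2l.
by move: eps2 Me; rewrite -!mulrA; move: (M%:R * _) (M%:R * _) (eps ^+ 2); clear -c0; move=> *; lra.
Qed.

End Rigidity.

Section RigidL2.
Context {d : measure_display} {X : measurableType d} {R : realType}.
Variable mu : probability X R.
Local Notation norm := (@ComplexField.Normc.normc R).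

Lemma L2C_norm_sqr (f : X -> R[i]) :
  (L2C_norm mu f `^ 2 = \int[mu]_x (norm (f x) ^+ 2)%:E)%E.
Proof.
rewrite /L2C_norm poweR_Lnorm //; apply: eq_integral => x _.
by rewrite gee0_abs ?lee_fin ?normc_ge0 // poweR_EFin powR_mulrn ?normc_ge0.
Qed.

Lemma L2C_norm_le (f : X -> R[i]) (e : R) : 0 <= e ->
  (\int[mu]_x (norm (f x) ^+ 2)%:E <= (e ^+ 2)%:E)%E -> (L2C_norm mu f <= e%:E)%E.
Proof.
move=> e0; rewrite -L2C_norm_sqr; have : (0 <= L2C_norm mu f)%E by exact: Lnorm_ge0.
case: (L2C_norm mu f) => [r| |] //.
  by rewrite lee_fin => r0; rewrite poweR_EFin !lee_fin powR_mulrn // ler_sqr.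
by rewrite poweRyr ?pnatr_eq0 ?leye_eq.
Qed.

(** The same times [N] serve every function, since they make every finite family of sets almost
    invariant. *)
Lemma rigid_of_sets (T : X -> X) (N : nat -> nat) : measurable_fun setT T ->
  (forall A, measurable A -> mu (T @^-1` A) = mu A) ->
  (forall k, (0 < N k)%N) -> (forall k, (N k < N k.+1)%N) ->
  (forall (A : nat -> set X) (n : nat) (e : R), (forall i, measurable (A i)) -> 0 < e ->
    exists K, forall k, (K <= k)%N -> exists E : set X,
    [/\ measurable E, pr mu E <= e &
        forall x, ~ E x -> forall i, (i < n)%N -> A i x <-> A i (iter (N k) T x)]) ->
  rigid mu T.
Proof.
move=> mT pT N0 Nlt rigidN f [mR mI fin]; exists N; split=> //.
  exact: homo_ltn ltn_trans Nlt.
have finI : (\int[mu]_x (norm (f x) ^+ 2)%:E < +oo)%E.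
  by rewrite -L2C_norm_sqr; exact: poweR_lty.
have small (e : R) : 0 < e -> exists K, forall k, (K <= k)%N ->
    (L2C_norm mu (fun x => (f (iter (N k) T x) - f x)%R) <= e%:E)%E.
  move=> e0; have e2 : 0 < e ^+ 2 by rewrite exprn_gt0.
  have [K HK] := rigid_integral mT pT rigidN mR mI finI e2.
  by exists K => k /HK; apply: L2C_norm_le; rewrite ltW.
have ge0 k : (0 <= L2C_norm mu (fun x => (f (iter (N k) T x) - f x)%R))%E by exact: Lnorm_ge0.
apply: (fine_cvgP _ 0).2; split.
  have [K HK] := small 1 ltr01; exists K => // k /HK h.
  by rewrite ge0_fin_numE //; apply: le_lt_trans h _; rewrite ltry.
apply/cvgrPdist_le => e e0; have [K HK] := small e e0; exists K => // k /= /HK.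
rewrite sub0r normrN; have := ge0 k.
by case: (L2C_norm _ _) => //= r; rewrite !lee_fin => r0 re; rewrite ger0_norm.
Qed.

End RigidL2.

(** * The system of a tower *)

Section TowerConclusion.
Context {R : realType} {p : {poly int}} {L : nat -> level} {H : nat -> nat}.
Hypothesis tow : tower p L H.
Local Notation mu := (tower_measure (R := R) tow).
Variables (T Tinv : seqspace -> seqspace).
Hypothesis mps : invertible_mps mu T Tinv.
Hypothesis Tlevel : forall k n, exists E : set seqspace,
  [/\ measurable E, pr mu E <= n%:R * defect H k &
      forall x, ~ E x -> iter n T x k = iter n (lfwd (L k)) (x k)].

Let Q0 := tower_size_gt0 tow.
Let Qdvd := tower_size_dvd tow.
Let mT := mps_measurable mps.
Let pT := mps_preserving mps.

Lemma tower_weakly_mixing : weakly_mixing mu T.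
Proof.
apply: (weakly_mixing_of_sets mT pT) => A B mA mB A0 B0.
have lower (C D : set seqspace) : measurable C -> measurable D -> 0 < pr mu C -> 0 < pr mu D ->
    exists K, forall k t, (K <= k)%N -> (t <= H k.+1)%N -> mixes (L k) (L k.+1) t ->
      0 < pr mu (C `&` iter t T @^-1` D).
  move=> mC mD C0 D0; have CD : 0 < pr mu C * pr mu D by rewrite mulr_gt0.
  have e0 : 0 < pr mu C * pr mu D / 2 by rewrite divr_gt0.
  have [K HK] := mixing_lower mps Tlevel mC mD e0.
  by exists K => k t Kk tH mix; have := HK k t Kk tH mix; move: CD; lra.
have [K1 H1] := lower A A mA mA A0 A0; have [K2 H2] := lower A B mA mB A0 B0.
have [K3 H3] := lower B A mB mA B0 A0.
(* An odd level beyond the three thresholds, so that one time [t] serves the three intersections. *)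
pose k := (2 * (K1 + K2 + K3) + 1)%N.
have [|t tH mix] := tower_mixes tow (k := k); first by rewrite /k addn1 /= oddM.
by exists t; split; [apply: H1 mix|apply: H2 mix|apply: H3 mix] => //; rewrite /k; lia.
Qed.

Lemma tower_rigid : rigid mu T.
Proof.
apply: (rigid_of_sets (N := rigidity_time (L := L)) mT pT).
- by move=> k; rewrite /rigidity_time muln_gt0 (wf_half (tower_wf tow k)).
- by move=> k; rewrite /rigidity_time ltn_mul2l (refines_half (tower_refines tow k)).
- by move=> A n e mA e0; exact: (rigid_sets mps Tlevel).
Qed.

Definition lower_half : set seqspace := [set x | (2 * x 0 < tower_size (L := L) 0)%N].

Lemma measurable_lower_half : measurable lower_half.
Proof. exact: (@measurable_coord 0 [set i | (2 * i < tower_size (L := L) 0)%N]). Qed.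

Lemma pr_lower_half : pr mu lower_half = 2^-1.
Proof.
rewrite (@pr_coord R _ Q0 0 (fun i => (2 * i < tower_size (L := L) 0)%N)).
have wf := tower_wf tow 0; have [_ flip] := half_turn_restrict wf.
have := card_flip (iter_cancel (lhalf (L 0)) (restrictK wf)) flip; rewrite card_ord => cardE.
have Q0R : ((lsize (L 0))%:R : R) != 0 by rewrite pnatr_eq0 -lt0n; exact: Q0.
apply: (mulIf Q0R); rewrite divfK // -[in RHS]cardE natrM mulKf ?pnatr_eq0 //.
Qed.

Lemma lower_half_level (x : seqspace) k : compatible (tower_size (L := L)) x ->
  lower_half x <-> (2 * x k < tower_size (L := L) k)%N.
Proof.
move=> cx; rewrite /lower_half /= (compatible_proj Q0 Qdvd cx (leq0n k)) /level_proj.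
have d0 := Qdvd_le Qdvd (leq0n k).
have m0 : (0 < tower_size (L := L) k %/ tower_size (L := L) 0)%N.
  by rewrite divn_gt0 ?Q0 // dvdn_leq ?Q0.
rewrite -(low_half_divn _ m0 (wf_even (tower_wf tow 0))) -/(tower_size (L := L) 0).
by rewrite muln_divA // mulKn ?Q0.
Qed.

(** The finite level gives 5/32 and the limit adds at most 1/32, as [k >= 5]; the sum 6/32 is below
    1/4 - 1/32 = 7/32. *)
Lemma lower_half_swap k t : (5 <= k)%N -> (t <= H k)%N ->
  (#|[pred i : 'I_(lsize (L k)) | (2 * i < lsize (L k))%N &&
    (2 * iter t (lfwd (L k)) i < lsize (L k))%N]| * 32 <= 5 * lsize (L k))%N ->
  pr mu (lower_half `&` iter t T @^-1` lower_half) < 4^-1 - 32^-1.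
Proof.
move=> k5 tH cardle; have [E [mE pE hE]] := tower_level Tlevel tH.
set cc := ~` compatible (tower_size (L := L)).
have mcc : measurable cc by apply: measurableC; exact: measurable_compatible.
have pcc : pr mu cc = 0 := pr_compatible Q0 Qdvd.
have mccT := measurable_iter_preimage mps t mcc.
have mA := measurable_lower_half; have mAT := measurable_iter_preimage mps t mA.
pose Z i := (2 * i < lsize (L k))%N && (2 * iter t (lfwd (L k)) i < lsize (L k))%N.
have mZ : measurable ([set x : seqspace | Z (x k)]) by exact: (@measurable_coord k [set v | Z v]).
have mU := measurableU _ _ mcc mccT; have mbad := measurableU _ _ mE mU.
have pbad : pr mu (E `|` (cc `|` iter t T @^-1` cc)) <= (2 ^ k)%:R^-1.
  apply: le_trans (pr_setU _ mE mU) _; rewrite -[X in _ <= X]addr0; apply: lerD => //.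
  by apply: le_trans (pr_setU _ mcc mccT) _; rewrite (pr_iter mps) // pcc addr0.
have main : pr mu (lower_half `&` iter t T @^-1` lower_half) <=
    pr mu [set x : seqspace | Z (x k)] + (2 ^ k)%:R^-1.
  apply: le_trans (lerD (lexx _) pbad); apply: pr_close => //.
    exact: measurableI.
  move=> x /not_orP[/hE xE /not_orP[/contrapT cx /contrapT cTx]] [/= Ax ATx].
  by rewrite /Z (lower_half_level k cx).1 // -xE (lower_half_level k cTx).1.
have prZ : pr mu [set x : seqspace | Z (x k)] <= 5 / 32.
  rewrite (@pr_coord R _ Q0 k Z) ler_pdivrMr ?ltr0n ?Q0 // mulrAC ler_pdivlMr ?ltr0n //.
  by rewrite -!natrM ler_nat.
have pk : (2 ^ k)%:R^-1 <= 32^-1 :> R.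
  rewrite lef_pV2 ?posrE ?ltr0n ?expn_gt0 // ler_nat.
  by rewrite -[32%N]/(2 ^ 5)%N leq_exp2l.
by apply: le_lt_trans main _; move: prZ pk; lra.
Qed.

(** For negative [m], taking the preimage under [iter n.+1 T], which preserves [mu], exchanges the
    roles of the two sets intersected. *)
Lemma pr_iterz (A : set seqspace) (m : int) : measurable A ->
  mu (A `&` iterz T Tinv m @^-1` A) = mu (A `&` iter `|m|%N T @^-1` A).
Proof.
case: m => n mA //.
have mpre n' : measurable (iter n' Tinv @^-1` A).
  elim: n' A mA => // n' IH A mA.
  have mTA : measurable (Tinv @^-1` A).
    by rewrite -[X in measurable X]setTI; apply: (mps_measurable_inv mps).
  exact: (IH _ mTA).
have mB := measurableI _ _ mA (mpre n.+1).
have [_ <-] := pr_iter_preimage mT pT n.+1 mB.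
congr (mu _); rewrite preimage_setI setIC; congr (_ `&` _).
apply/seteqP; split=> x; rewrite /preimage /mkset;
  by rewrite (iter_cancel n.+1 (mps_cancel mps)).
Qed.

End TowerConclusion.

Definition ord_indicator (r : nat) (F : {set 'I_r}) (i : nat) : bool :=
  if insub i is Some j then j \in F else false.

Lemma sum_in_subsum (r k : nat) (n : nat -> nat) (F : {set 'I_r}) : (r <= k)%N ->
  (\sum_(j in F) n j = subsum k n (ord_indicator F))%N.
Proof.
move=> rk; rewrite /subsum.
rewrite -(big_mkord xpredT (fun i => ord_indicator F i * n i)%N) (@big_cat_nat _ _ _ r) //=.
have -> : (\sum_(r <= i < k) ord_indicator F i * n i = 0)%N.
  rewrite big_nat; apply: big1 => i /andP[ri _].
  by rewrite /ord_indicator insubF ?mul0n // ltnNge ri.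
rewrite addn0 big_mkord big_mkcond /=; apply: eq_bigr => j _.
by rewrite /ord_indicator valK; case: (j \in F); rewrite ?mul1n ?mul0n.
Qed.

Theorem propositionB (R : realType) (p : {poly int})
    (p_at0 : p.[0] = 0) (deg_p : (1 < (size p).-1)%N) :
  exists (d : measure_display) (X : measurableType d) (mu : probability X R)
         (T Tinv : X -> X),
    [/\ invertible_mps mu T Tinv, weakly_mixing mu T, rigid mu T &
        exists (A : set X) (delta : R) (Gamma : set nat),
          [/\ measurable A /\ mu A = (2^-1)%:E,
              0 < delta,
              Gamma `<=` [set n | (0 < n)%N],
              IP0 Gamma &
              forall n : nat, Gamma n ->
                (mu (A `&` iterz T Tinv p.[n%:Z] @^-1` A)
                   < mu A ^+ 2 - delta%:E)%E]].
Proof.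
have [L [H tow]] := exists_tower p_at0 deg_p.
have [T [Tinv [mps Tlevel]]] := tower_system (R := R) tow.
exists _, seqspace, (tower_measure tow), T, Tinv; split.
- exact: mps.
- exact: tower_weakly_mixing mps Tlevel.
- exact: tower_rigid mps Tlevel.
have swaps_even k : exists n, ~~ odd k -> swaps p (L k.+1) (H k.+1) k n.
  case: (boolP (odd k)) => ok; first by exists (fun=> 0%N).
  by have [n Hn] := tower_swaps tow ok; exists n.
have [nn Hnn] := boolp.choice swaps_even.
have mA := measurable_lower_half (L := L).
have muA : tower_measure (R := R) tow (lower_half (L := L)) = (2^-1)%:E.
  by rewrite prE // pr_lower_half.
(* The sums of index [k] swap at level [k.+1], which [lower_half_swap] wants to be at least 5. *)
exists (lower_half (L := L)), 32^-1, [set n | exists (k : nat) (F : nat -> bool),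
  [/\ ~~ odd k, (4 <= k)%N, exists2 i, (i < k)%N & F i & n = subsum k (nn k) F]]; split.
- by split.
- by rewrite invr_gt0.
- move=> _ [k [F [ok _ [i ik Fi] ->]]] /=; have [n0 _ _] := Hnn k ok.
  rewrite /subsum (bigD1 (Ordinal ik)) //= Fi mul1n.
  exact: leq_trans (n0 i ik) (leq_addr _ _).
(* An even index, at least 4 and at least [r]; the first [r] of its [k] generators are used. *)
- move=> r r0; pose k := (2 * r + 4)%N.
  have rk : (r <= k)%N by rewrite /k; lia.
  have ok : ~~ odd k by rewrite /k oddD oddM.
  have [n0 nlt _] := Hnn k ok; exists (fun i => nn k i); split.
  + by move=> i; apply: n0; apply: leq_trans rk.
  + by move=> i j ij; apply: nlt => //; apply: leq_trans rk.
  move=> F /finset.set0Pn[j jF]; exists k, (ord_indicator F); split=> //.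
  * by rewrite /k leq_addl.
  * by exists j; [apply: leq_trans rk|rewrite /ord_indicator valK].
  * exact: sum_in_subsum.
move=> _ [k [F [ok k4 [i ik Fi] ->]]]; have [_ _ /(_ F i ik Fi)[tH cardle]] := Hnn k ok.
rewrite (pr_iterz mps) // muA prE; last first.
  by apply: measurableI => //; exact: (measurable_iter_preimage mps).
rewrite expe2 -EFinM -EFinB lte_fin -invfM -natrM.
exact: (lower_half_swap mps Tlevel (k4 : (5 <= k.+1)%N) tH cardle).
Qed.
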